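(* Let $\{\alpha_n\}_{n=1}^\infty$ and $\{\beta_n\}_{n=1}^\infty$ be two strictly decreasing sequences of positive numbers that are interlaced and converging to zero; in other words, $0<\alpha_{n+1}<\beta_{n+1}<\alpha_n$ for all $n\ge1$ and $\alpha_n\to0$ (and hence $\beta_n\to0$). For each $n\ge1$ let $$G_n:=\{re^{i\theta} : 2<r<2+\tfrac1n \text{ and } \alpha_n<\theta<\beta_n\}.$$ Let $G:=\bigcup_{n=1}^\infty G_n$ and let $L^2_a(G)$ be the Bergman space of all analytic functions on $G$ that are square integrable with respect to area measure on $G$. Then the operator $M_z^*$ is purely convex-cyclic on $L^2_a(G)$; meaning that $M_z^*$ is convex-cyclic on $L^2_a(G)$, but $p(M_z^* )$ is not hypercyclic on $L^2_a(G)$ for any convex polynomial $p$.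
   Context: $M_z$ is the operator of multiplication by the independent variable $z$ on $L^2_a(G)$, and $M_z^*$ is its adjoint. A convex polynomial is a polynomial $p(z)=a_0+a_1z+\cdots+a_nz^n$ with $a_k\ge0$ for all $k$ and $\sum_{k=0}^n a_k=1$. A bounded linear operator $T$ is convex-cyclic if there is a vector $x$ such that the convex hull of $\{T^n x : n=0,1,2,\ldots\}$ is dense in the space; it is hypercyclic if there is a vector $x$ such that $\{T^n x : n=0,1,2,\ldots\}$ is dense in the space.
   Formalization: The angle θ in G_n is taken as the polar angle in [0, 2π); this matters only if β_1 > 2π, where wrapping angles can make the claim false (e.g. α_1 = 1, β_1 = 10 gives G the full annulus 2<|z|<3, and (1+M_z^* )/2 is hypercyclic). *)

(* Defs.v *)
From HB Require Import structures.
From mathcomp Require Import all_boot all_order all_algebra.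
From mathcomp Require Import complex lra.
From mathcomp Require Import all_classical all_reals all_analysis measurable_realfun.

Set Implicit Arguments.
Unset Strict Implicit.
Unset Printing Implicit Defensive.

Import Order.TTheory GRing.Theory Num.Theory.
Import numFieldNormedType.Exports.
Import Normc.

Local Open Scope classical_set_scope.
Local Open Scope ring_scope.
Local Open Scope complex_scope.

Section BergmanFunctions.
Context {R : realType}.

Definition cpoint (p : measurableTypeR R * measurableTypeR R) : R[i] :=
  p.1 +i* p.2.

Definition area : {measure set (measurableTypeR R * measurableTypeR R) -> \bar R} :=
  (@lebesgue_measure R \x @lebesgue_measure R)%E.

(* Complex differentiability, the field of scalars of R[i]^o being R[i]; it is
   the derivative in the plane, so the notion is the usual one for G open. *)
Definition analytic_on (G : set R[i]) (f : R[i] -> R[i]^o) :=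
  forall z, G z -> derivable (f : R[i]^o -> R[i]^o) z 1.

Definition int_sqr (G : set R[i]) (f : R[i] -> R[i]^o) : \bar R :=
  (\int[area]_(p in cpoint @^-1` G) (normc (f (cpoint p)) ^+ 2)%:E)%E.

(* An element of the Bergman space of G is represented by its extension by 0
   outside G, so that equality of representatives is equality on G. *)
Definition bergman_fun (G : set R[i]) (f : R[i] -> R[i]^o) :=
  [/\ analytic_on G f, forall z, ~ G z -> f z = 0 & (int_sqr G f < +oo)%E].

Definition bergman_pred (G : set R[i]) : {pred R[i] -> R[i]^o} :=
  fun f => `[< bergman_fun G f >].

Definition modulus (f : R[i] -> R[i]^o) :
    measurableTypeR R * measurableTypeR R -> R :=
  fun p => normc (f (cpoint p)).

Lemma normc_norm (z : R[i]) : `|z| = (normc z)%:C.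
Proof. by []. Qed.

Lemma normcpoint (p q : R * R) :
  normc (cpoint p - cpoint q) <= `|p.1 - q.1| + `|p.2 - q.2|.
Proof.
case: p q => [a b] [c d] /=.
rewrite -[leRHS]ger0_norm ?addr_ge0// -sqrtr_sqr /normc/=; apply: ler_wsqrtr.
rewrite -(real_normK (num_real (a - c))) -(real_normK (num_real (b - d))).
by rewrite sqrrD lerD2r lerDl mulrn_wge0// mulr_ge0.
Qed.

Let box (q : rat * rat * rat) : set (measurableTypeR R * measurableTypeR R) :=
  `]ratr q.1.1 - ratr q.2, ratr q.1.1 + ratr q.2[%classic `*`
  `]ratr q.1.2 - ratr q.2, ratr q.1.2 + ratr q.2[%classic.

Let measurable_box q : measurable (box q).
Proof. by apply: measurableX; apply: measurable_itv. Qed.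

Let box_nbhs (U : set R[i]) p : nbhs (cpoint p : R[i]^o) U ->
  exists q, box q p /\ box q `<=` cpoint @^-1` U.
Proof.
move=> /nbhs_ballP[/= [e e']]; rewrite ltcE /= => /andP[/eqP e'0 e0] eU.
have e40 : 0 < e / 4 by lra.
have /rat_in_itvoo[s] := e40; rewrite in_itv/= => /andP[s0 se].
have [a] : exists a : rat, ratr a \in `](p.1 - ratr s : R), p.1 + ratr s[.
  by apply: rat_in_itvoo; lra.
have [b] : exists b : rat, ratr b \in `](p.2 - ratr s : R), p.2 + ratr s[.
  by apply: rat_in_itvoo; lra.
rewrite !in_itv/= => /andP[b1 b2] /andP[a1 a2].
exists (a, b, s); split.
  by split; rewrite /= in_itv/=; apply/andP; split; lra.
move=> q [/=]; rewrite !in_itv/= => /andP[x1 x2] /andP[y1 y2].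
apply: eU; rewrite /ball/= normc_norm ltcE/= e'0 eqxx/=.
apply: (le_lt_trans (normcpoint _ _)).
have h1 : `|p.1 - q.1| < 2 * ratr s by rewrite ltr_norml; apply/andP; split; lra.
have h2 : `|p.2 - q.2| < 2 * ratr s by rewrite ltr_norml; apply/andP; split; lra.
lra.
Qed.

Let measurable_nbhs (U : set R[i]) :
  (forall z, U z -> nbhs (z : R[i]^o) U) -> measurable (cpoint @^-1` U).
Proof.
move=> oU.
rewrite (_ : cpoint @^-1` U = \bigcup_q
    (if `[< box q `<=` cpoint @^-1` U >] then box q else set0)).
  apply: countable_bigcupT_measurable; first exact: countableP.
  by move=> q; case: ifP.
apply/seteqP; split=> [p Up|p [q _]]; last by case: asboolP => // qU /qU.
have [q [qp qU]] := box_nbhs (oU _ Up).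
by exists q => //; case: asboolP.
Qed.

Let box_pos q p : box q p -> (0 < area (box q))%E.
Proof.
move=> [/=]; rewrite !in_itv/= => /andP[x1 x2] /andP[y1 y2].
rewrite /area /box product_measure1E; [|exact: measurable_itv..].
have itv_pos (u v : R) : u < v -> (0 < @lebesgue_measure R `]u, v[%classic)%E.
  by move=> uv; rewrite lebesgue_measure_itv/= lte_fin uv -EFinB lte_fin subr_gt0.
by apply: mule_gt0; apply: itv_pos; lra.
Qed.

Lemma modulus_ge0 f p : 0 <= modulus f p.
Proof. by rewrite /modulus; case: (f _) => a b; exact: sqrtr_ge0. Qed.

Let modulus_nbhs (G : set R[i]) f (a : R) z : analytic_on G f ->
  (forall z, ~ G z -> f z = 0) -> 0 <= a -> a < normc (f z) ->
  nbhs (z : R[i]^o) [set w | a < normc (f w)].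
Proof.
move=> Gf f0 a0 az.
have Gz : G z.
  by apply: contrapT => /f0 E; move: az; rewrite E normc0 ltNge a0.
have /derivable1_diffP/differentiable_continuous cf := Gf _ Gz.

have e0 : 0 < (normc (f z) - a)%:C by rewrite ltcR subr_gt0.
have := (pseudometric_normed_Zmodule.cvgrPdist_lt _ _).1 cf _ e0.
move=> /(_ (nbhs_filter _)); apply: filterS => w /=.
rewrite normc_norm ltcR => h.
have := le_normcD (f z - f w) (f w); rewrite subrK; lra.
Qed.

Let mod_gt_measurable (G : set R[i]) f (a : R) : analytic_on G f ->
  (forall z, ~ G z -> f z = 0) -> 0 <= a ->
  measurable [set p | a < modulus f p].
Proof.
move=> Gf f0 a0; rewrite (_ : [set _ | _] =
  cpoint @^-1` [set w | a < normc (f w)])//.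
by apply: measurable_nbhs => z /= az; exact: modulus_nbhs Gf f0 a0 az.
Qed.

Lemma measurable_modulus (G : set R[i]) f : analytic_on G f ->
  (forall z, ~ G z -> f z = 0) -> measurable_fun setT (modulus f).
Proof.
move=> Gf f0 mD; apply: (measurability _ (RGenOInfty.measurableE R)) => //.
move=> /= _ [_ [a ->] <-]; rewrite setTI.
rewrite (_ : _ @^-1` _ = [set p | a < modulus f p]); last first.
  by apply/seteqP; split => p /=; rewrite in_itv/= andbT.
have [a0|a0] := leP 0 a; first exact: mod_gt_measurable Gf f0 a0.
rewrite [X in measurable X](_ : _ = setT)//; apply/seteqP; split => // p _ /=.
exact: lt_le_trans (modulus_ge0 _ _).
Qed.

Lemma int_sqrE (G : set R[i]) f : (forall z, ~ G z -> f z = 0) ->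
  int_sqr G f = (\int[area]_p (modulus f p ^+ 2)%:E)%E.
Proof.
move=> f0; rewrite /int_sqr integral_mkcond; apply: eq_integral => p _.
rewrite patchE; case: ifPn => // /negP; rewrite inE/= => /f0.
by rewrite /modulus => ->; rewrite normc0 expr0n.
Qed.

Lemma int_sqr_Lnorm (G : set R[i]) f : (forall z, ~ G z -> f z = 0) ->
  int_sqr G f = ('N[area]_2%:E[EFin \o modulus f] `^ 2)%E.
Proof.
move=> f0; rewrite int_sqrE// poweR_Lnorm//; apply: eq_integral => p _ /=.
by rewrite ger0_norm ?modulus_ge0// powR_mulrn ?modulus_ge0.
Qed.

Lemma int_sqr_ltyP (G : set R[i]) f : (forall z, ~ G z -> f z = 0) ->
  (int_sqr G f < +oo)%E <-> ('N[area]_2%:E[EFin \o modulus f] < +oo)%E.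
Proof.
move=> f0; rewrite int_sqr_Lnorm//.
by split; [exact: lty_poweRy|exact: poweR_lty].
Qed.

Lemma int_sqr_ge0 (G : set R[i]) f : (0 <= int_sqr G f)%E.
Proof. by apply: integral_ge0 => p _; rewrite lee_fin sqr_ge0. Qed.

Lemma sqrt_int_sqr (G : set R[i]) f : bergman_fun G f ->
  (Num.sqrt (fine (int_sqr G f)))%:E = ('N[area]_2%:E[EFin \o modulus f])%E.
Proof.
move=> [_ f0 /(int_sqr_ltyP f0)]; rewrite int_sqr_Lnorm//.
have := Lnorm_ge0 area 2%:E (EFin \o modulus f).
case: ('N[area]_2%:E[_])%E => // x; rewrite lee_fin => x0 _.
by rewrite poweR_EFin/= powR_mulrn// sqrtr_sqr ger0_norm.
Qed.

Lemma Lnorm_modulusD (G : set R[i]) f g : bergman_fun G f -> bergman_fun G g ->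
  analytic_on G (f + g) ->
  ('N[area]_2%:E[EFin \o modulus (f + g)%R] <=
   'N[area]_2%:E[EFin \o modulus f] + 'N[area]_2%:E[EFin \o modulus g])%E.
Proof.
move=> [Gf f0 _] [Gg g0 _] Gfg.
have fg0 z : ~ G z -> (f + g) z = 0.
  by move=> nGz; rewrite addrfctE f0// g0// addr0.
have mf := measurable_modulus Gf f0; have mg := measurable_modulus Gg g0.
have mfg := measurable_modulus Gfg fg0.
apply: le_trans (minkowski_EFin _ mf mg _); last by rewrite ler1n.
rewrite unlock; apply: gt0_ler_poweR; rewrite ?invr_ge0//.
- by rewrite in_itv/= leey andbT; apply: integral_ge0 => p _; rewrite lee_fin powR_ge0.
- by rewrite in_itv/= leey andbT; apply: integral_ge0 => p _; rewrite lee_fin powR_ge0.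
have msqr (u : measurableTypeR R * measurableTypeR R -> R) : measurable_fun setT u ->
    measurable_fun setT (fun p => (`|u p| `^ 2)%:E : \bar R).
  move=> mu; apply/measurable_EFinP. 
  apply: (@measurableT_comp _ _ _ _ _ _ (@powR R ^~ 2)) => //.
  exact: measurableT_comp.
apply: ge0_le_integral => //.
- by move=> p _; rewrite lee_fin powR_ge0.
- exact: msqr.
- by apply: msqr; exact: measurable_funD.
move=> p _; apply: gt0_ler_poweR => //.
- by rewrite in_itv/= leey andbT.
- by rewrite in_itv/= leey andbT.
rewrite /= lee_fin !ger0_norm ?addr_ge0 ?modulus_ge0//.
exact: le_normcD.
Qed.

Lemma int_sqrZ (G : set R[i]) f (a : R[i]) : bergman_fun G f ->
  int_sqr G (a *: f) = ((normc a ^+ 2)%:E * int_sqr G f)%E.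
Proof.
move=> [Gf f0 _].
have af0 z : ~ G z -> (a *: f) z = 0.
  by move=> nGz; rewrite scalrfctE f0// scaler0.
rewrite !int_sqrE// -ge0_integralZl//=.
- apply: eq_integral => p _; rewrite -EFinM -exprMn.
  by rewrite /modulus -normcM.
- apply/measurable_EFinP; apply: measurable_funX.
  exact: measurable_modulus Gf f0.
- by move=> p _; rewrite lee_fin sqr_ge0.
- by rewrite lee_fin sqr_ge0.
Qed.

Lemma int_sqr_eq0 (G : set R[i]) f : bergman_fun G f -> int_sqr G f = 0%E ->
  f = 0.
Proof.
move=> Bf; have [Gf f0 _] := Bf; rewrite int_sqrE// => If.
have mf := measurable_modulus Gf f0.
have mf2 : measurable_fun setT (fun p => (modulus f p ^+ 2)%:E).
  by apply/measurable_EFinP; exact: measurable_funX.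
have I0 : (\int[area]_p `|(modulus f p ^+ 2)%:E| = 0)%E.
  by rewrite -[RHS]If; apply: eq_integral => p _; rewrite gee0_abs ?lee_fin ?sqr_ge0.
have [N [mN N0 sN]] := (ae_eq_integral_abs area measurableT mf2).1 I0.
apply/funext => z; apply: contrapT => fz.
have zE : z = cpoint (complex.Re z, complex.Im z) by case: (z).
have z0 : 0 < normc (f z).
  rewrite lt_neqAle eq_sym; apply/andP; split.
    by apply/eqP => /eq0_normc.
  by have := modulus_ge0 f (complex.Re z, complex.Im z); rewrite /modulus -zE.
have := modulus_nbhs Gf f0 (lexx _) z0; rewrite {1}zE => /box_nbhs[q [qz qf]].
have := box_pos qz; rewrite lt_neqAle => /andP[/eqP + _]; apply.
apply/esym/eqP; rewrite -measure_le0 -N0 le_measure ?inE//.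
move=> p /qf /= fp; apply: sN => /= /(_ I) [] /eqP.
by rewrite sqrf_eq0 gt_eqF.
Qed.

Lemma bergman_submod_closed (G : set R[i]) : submod_closed (bergman_pred G).
Proof.
split.
  apply/asboolP; split => //.
  by rewrite /int_sqr integral0_eq// => p _; rewrite normc0 expr0n.
move=> a f g /asboolP Bf /asboolP Bg; apply/asboolP.
have [Gf f0 fi] := Bf; have [Gg g0 gi] := Bg.
have Baf : bergman_fun G (a *: f).
  split.
  - by move=> z Gz; apply: derivableZ; exact: Gf.
  - by move=> z nGz; rewrite scalrfctE f0// scaler0.
  - by rewrite int_sqrZ// lte_mul_pinfty// lee_fin sqr_ge0.
have Gafg : analytic_on G (a *: f + g).
  by move=> z Gz; apply: derivableD; [case: Baf => + _ _; exact|exact: Gg].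
have afg0 z : ~ G z -> (a *: f + g) z = 0.
  by move=> nGz; case: Baf => _ af0 _; rewrite addrfctE af0// g0// addr0.
split => //; apply/int_sqr_ltyP => //.
apply: le_lt_trans (Lnorm_modulusD Baf Bg Gafg) _.
by case: Baf => _ af0 /(int_sqr_ltyP af0) afi;
  apply: lte_add_pinfty => //; exact/(int_sqr_ltyP g0).
Qed.

HB.instance Definition _ G :=
  GRing.isSubmodClosed.Build _ _ (bergman_pred G) (bergman_submod_closed G).

End BergmanFunctions.

Section BergmanSpace.
Context {R : realType} (G : set R[i]).

Record bergman := Bergman {
  bergman_val :> R[i] -> R[i]^o ;
  bergman_valP : bergman_val \in bergman_pred G
}.

HB.instance Definition _ := [isSub for bergman_val].
HB.instance Definition _ := [Choice of bergman by <:].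
HB.instance Definition _ := [SubChoice_isSubLmodule of bergman by <:].

Definition bergman_norm (f : bergman) : R[i] :=
  (Num.sqrt (fine (int_sqr G f)))%:C.

Lemma bergmanP (f : bergman) : bergman_fun G f.
Proof. exact/asboolP/(bergman_valP f). Qed.

Let bergman_normD (f g : bergman) :
  bergman_norm (f + g) <= bergman_norm f + bergman_norm g.
Proof.
rewrite /bergman_norm -rmorphD/= lecR -lee_fin EFinD.
rewrite (sqrt_int_sqr (bergmanP f)) (sqrt_int_sqr (bergmanP g)).
rewrite (sqrt_int_sqr (bergmanP (f + g))).
apply: (Lnorm_modulusD (bergmanP f) (bergmanP g)).
by have [] := bergmanP (f + g).
Qed.

Let bergman_normZ (a : R[i]) (f : bergman) :
  bergman_norm (a *: f) = `|a| * bergman_norm f.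
Proof.
rewrite /bergman_norm normc_norm -rmorphM/=; congr _%:C.
have fin : int_sqr G f \is a fin_num.
  by rewrite ge0_fin_numE ?int_sqr_ge0//; case: (bergmanP f).
rewrite (int_sqrZ _ (bergmanP f)).
rewrite fineM// sqrtrM ?sqr_ge0//= sqrtr_sqr ger0_norm//.
by case: (a) => x y; exact: sqrtr_ge0.
Qed.

Let bergman_norm0 (f : bergman) : bergman_norm f = 0 -> f = 0.
Proof.
move=> /complexI f0; apply: val_inj; apply: (int_sqr_eq0 (bergmanP f)).
have := sqrt_int_sqr (bergmanP f); rewrite f0.
have [_ nG _] := bergmanP f; rewrite (int_sqr_Lnorm nG) => <-.
by rewrite poweR0r.
Qed.

HB.instance Definition _ :=
  Lmodule_isNormed.Build R[i] bergman bergman_normD bergman_normZ bergman_norm0.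

Definition bergman_dot (f g : bergman) : R[i] :=
  (\int[area]_(p in cpoint @^-1` G) complex.Re (f (cpoint p) * (g (cpoint p))^*))%R +i*
  (\int[area]_(p in cpoint @^-1` G) complex.Im (f (cpoint p) * (g (cpoint p))^*))%R.

Lemma bergman_dotff (f : bergman) : bergman_dot f f = `|f| ^+ 2.
Proof.
have -> : `|f| = bergman_norm f by [].
rewrite /bergman_norm -rmorphXn/= sqr_sqrtr ?fine_ge0 ?int_sqr_ge0//.
rewrite /bergman_dot -/(_%:C); congr (_ +i* _).
  congr fine; apply: eq_integral => p _; congr EFin.
  case: (f _) => x y /=.
  by rewrite sqr_sqrtr ?addr_ge0 ?sqr_ge0// mulrN opprK -!expr2.
rewrite /Rintegral integral0_eq// => p _.
by case: (f _) => x y /=; rewrite mulrN mulrC addNr.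
Qed.

(* Multiplication by the independent variable; the default value 0 is only
   reached when G is unbounded, see mulzE. *)
Definition mulz (f : bergman) : bergman :=
  insubd (0 : bergman) (fun z => z * f z).

Lemma mulzE (M : R) : (forall z, G z -> normc z <= M) ->
  forall f z, mulz f z = z * f z.
Proof.
move=> GM f z; rewrite /mulz -[_ z]/(val (insubd (0 : bergman) _) z) insubdK//.
have Bf := bergmanP f; have [Gf f0 fi] := Bf; apply/asboolP.
have zf0 w : ~ G w -> w * f w = 0 by move=> nGw; rewrite f0// mulr0.
have Gzf : analytic_on G (fun w => w * f w).
  by move=> w Gw; apply: derivableM; [exact: derivable_id|exact: Gf].
split => //; apply: (@le_lt_trans _ _ ((M ^+ 2)%:E * int_sqr G f)%E); last first.
  by rewrite lte_mul_pinfty// lee_fin sqr_ge0.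
have mf := measurable_modulus Gf f0; have mzf := measurable_modulus Gzf zf0.
have mf2 : measurable_fun setT (fun p => (modulus f p ^+ 2)%:E).
  by apply/measurable_EFinP; exact: measurable_funX.
rewrite (int_sqrE zf0) (int_sqrE f0) -ge0_integralZl//=; last 2 first.
- by move=> p _; rewrite lee_fin sqr_ge0.
- by rewrite lee_fin sqr_ge0.
apply: ge0_le_integral => //.
- by move=> p _; rewrite lee_fin sqr_ge0.
- by apply/measurable_EFinP; exact: measurable_funX.
- exact: emeasurable_funM.
move=> p _; rewrite -EFinM lee_fin -exprMn.
have [Gp|nGp] := pselect (G (cpoint p)); last first.
  by rewrite /modulus zf0// f0// normc0 mulr0.
have nz : 0 <= normc (cpoint p) by exact: sqrtr_ge0.
have fz := modulus_ge0 f p.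
rewrite lerXn2r ?nnegrE ?mulr_ge0 ?modulus_ge0//.
  exact: le_trans nz (GM _ Gp).
by rewrite /modulus normcM ler_wpM2r// GM.
Qed.

(* bergman_dot is definite, so an adjoint is unique; it exists for T bounded,
   and the default value 0 is then not reached. *)
Definition adjoint (T : bergman -> bergman) : bergman -> bergman :=
  xget (fun=> 0)
    [set S | forall f g, bergman_dot (T f) g = bergman_dot f (S g)].

End BergmanSpace.

Section Dynamics.
Context {R : realType} {V : normedModType R[i]}.

Definition power_orbit (T : V -> V) (x : V) : set V :=
  [set iter n T x | n in [set: nat]].

(* scalars of [0, 1] in R[i] are real, so this is the real convex hull *)
Definition convex_hull (A : set V) : set V := smallest (@convex_set _ V) A.

Definition hypercyclic (T : V -> V) := exists x, dense (power_orbit T x).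

Definition convex_cyclic (T : V -> V) :=
  exists x, dense (convex_hull (power_orbit T x)).

Definition convex_poly (p : {poly R}) :=
  (forall k, 0 <= p`_k) /\ \sum_(k < size p) p`_k = 1.

Definition poly_op (p : {poly R}) (T : V -> V) : V -> V :=
  fun x => \sum_(k < size p) (p`_k)%:C *: iter k T x.

Definition purely_convex_cyclic (T : V -> V) :=
  convex_cyclic T /\
  forall p, convex_poly p -> ~ hypercyclic (poly_op p T).
End Dynamics.

(* Sequences are indexed from 0, so this is the set with index n.+1. The angle
   theta is the polar angle in [0, 2 * pi[, which matters only for
   2 * pi < beta 0: if angles were allowed to wrap around, a single set could
   then contain almost all the others. *)
Definition sector {R : realType} (alpha beta : R^nat) (n : nat) : set R[i] :=
  [set z | exists r theta, [/\ 2 < r < 2 + n.+1%:R^-1,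
     alpha n < theta < beta n, 0 <= theta < 2 * pi &
     z = (r * cos theta) +i* (r * sin theta)]].

(* Main.v *)
Require Import Defs.
From mathcomp Require Import all_boot all_order all_algebra.
From mathcomp Require Import complex ring lra.
From mathcomp Require Import all_classical all_reals all_analysis.
From mathcomp Require Import measurable_realfun.

Set Implicit Arguments.
Unset Strict Implicit.
Unset Printing Implicit Defensive.

Import Order.TTheory GRing.Theory Num.Theory.
Import numFieldNormedType.Exports.
Import Normc.

Local Open Scope classical_set_scope.
Local Open Scope ring_scope.
Local Open Scope complex_scope.

(* The adjoint [T] of [M_z] has the reproducing kernels as eigenvectors,
   [T (K z) = conj z *: K z], and kernels span a dense subspace.  A nonreal [w]
   is a root of a convex polynomial all of whose complex roots have modulus
   [|w|]: normalize [X^2m - 2 Re(w^m) X^m + |w|^2m], where [Re(w^m) <= 0].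
   Multiplying such polynomials together and by a large power of [X] gives a
   convex [p] such that [p(T)] kills a given finite combination of kernels at
   nonreal points and is as expanding as desired on kernels at finitely many
   points of other moduli.  So one can build [x = h_0 + h_1 + ...] and convex
   [p_n] with [p_n(T) h_i = 0] for [i < n], [p_n(T) h_n] prescribed, and the
   later [h_i] too small to matter: the [p_n(T) x] are dense.

   Conversely, for a convex [p], every sector close to [2] satisfies
   [Re p(z) >= 1].  On the summand of functions supported in that sector,
   [p(M_z)] has a contractive inverse, so an orbit of [p(T)] is orthogonal to
   this summand or stays away from [0].

   The existence of kernels and of the adjoint rests on the completeness of the
   Bergman space: Cauchy's formula, on a rectangle whose sides are chosen so
   that the integral of [|f|^2] along them is controlled by its area integral,
   bounds the values and the difference quotients of [f] by its norm. *)

(** * Complex numbers *)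

Section ComplexModulus.
Context {R : realType}.
Implicit Types x y z : R[i].

Lemma normc_ge0 z : 0 <= normc z.
Proof. by case: z => a b; exact: sqrtr_ge0. Qed.

Lemma normc_triangle x y : normc (x + y) <= normc x + normc y.
Proof. exact: (@le_normcD R x y). Qed.

Lemma normc_opp x : normc (- x) = normc x.
Proof. exact: (@normcN R x). Qed.

Lemma normc_sub x y : normc (x - y) <= normc x + normc y.
Proof. by rewrite -(normc_opp y) normc_triangle. Qed.

Lemma normc_subC x y : normc (x - y) = normc (y - x).
Proof. by rewrite -normc_opp opprB. Qed.

Lemma normc_mul x y : normc (x * y) = normc x * normc y.
Proof. exact: normcM. Qed.

Lemma normc_exp x n : normc (x ^+ n) = normc x ^+ n.
Proof.
elim: n => [|n IH]; first by rewrite !expr0 normc1.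
by rewrite !exprS normc_mul IH.
Qed.

Lemma normc_eq0 x : (normc x == 0) = (x == 0).
Proof. by apply/eqP/eqP => [/eq0_normc//|->]; rewrite normc0. Qed.

Lemma normc_gt0 x : (0 < normc x) = (x != 0).
Proof. by rewrite lt_def normc_ge0 andbT normc_eq0. Qed.

Lemma normc_real (a : R) : normc a%:C = `|a|.
Proof. by rewrite /= expr0n addr0 sqrtr_sqr. Qed.

Lemma normci : normc ('i : R[i]) = 1.
Proof. by rewrite /= expr0n expr1n add0r sqrtr1. Qed.

Lemma sqr_normc x : normc x ^+ 2 = complex.Re x ^+ 2 + complex.Im x ^+ 2.
Proof. by case: x => a b /=; rewrite sqr_sqrtr ?addr_ge0 ?sqr_ge0. Qed.

Lemma normr_Re_le x : `|complex.Re x| <= normc x.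
Proof.
by case: x => a b /=; rewrite -[leLHS]sqrtr_sqr ler_wsqrtr// lerDl sqr_ge0.
Qed.

Lemma normr_Im_le x : `|complex.Im x| <= normc x.
Proof.
by case: x => a b /=; rewrite -[leLHS]sqrtr_sqr ler_wsqrtr// lerDr sqr_ge0.
Qed.

Lemma normc_le_ReIm x : normc x <= `|complex.Re x| + `|complex.Im x|.
Proof.
have xE : x = (complex.Re x)%:C + 'i * (complex.Im x)%:C.
  by case: x => a b; rewrite -complexE.
by rewrite {1}xE (le_trans (normc_triangle _ _))// normc_mul normci mul1r !normc_real.
Qed.

Lemma Re_add x y : complex.Re (x + y) = complex.Re x + complex.Re y.
Proof. by case: x y => [? ?] [? ?]. Qed.
Lemma Im_add x y : complex.Im (x + y) = complex.Im x + complex.Im y.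
Proof. by case: x y => [? ?] [? ?]. Qed.
Lemma Re_opp x : complex.Re (- x) = - complex.Re x.
Proof. by case: x. Qed.
Lemma Im_opp x : complex.Im (- x) = - complex.Im x.
Proof. by case: x. Qed.
Lemma Re_mul x y : complex.Re (x * y) =
  complex.Re x * complex.Re y - complex.Im x * complex.Im y.
Proof. by case: x y => [? ?] [? ?]. Qed.
Lemma Im_mul x y : complex.Im (x * y) =
  complex.Re x * complex.Im y + complex.Im x * complex.Re y.
Proof. by case: x y => [? ?] [? ?]. Qed.

Lemma eq_complexP x y :
  complex.Re x = complex.Re y -> complex.Im x = complex.Im y -> x = y.
Proof. by case: x y => [a b] [c d] /= -> ->. Qed.

End ComplexModulus.

Section ComplexDerivative.
Context {R : realType}.
Implicit Types (f g : R[i]^o -> R[i]^o) (z : R[i]^o).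

Lemma nbhs_normcP z (P : set R[i]^o) :
  nbhs z P <-> exists2 d : R, 0 < d & forall w, normc (z - w) < d -> P w.
Proof.
split=> [/nbhs_ballP[/= e]|[d d0 dP]].
  rewrite ltcE/= => /andP[/eqP e'0 e0] eP; exists (complex.Re e) => // w zw.
  by apply: eP; rewrite /ball/= normc_norm ltcE/= e'0 eqxx.
apply/nbhs_ballP; exists d%:C; first by rewrite /= ltcR.
by move=> w; rewrite /ball/= normc_norm ltcR => /dP.
Qed.

Lemma derivable_normcP f z : derivable f z 1 <->
  exists A : R[i], forall e : R, 0 < e -> exists2 d : R, 0 < d &
    forall h : R[i], normc h < d -> normc (f (z + h) - f z - h * A) <= e * normc h.
Proof.
split=> [fz|[A fA]].
  exists ('D_1 f z) => e e0.
  have /cvgrPdist_lt/(_ e%:C) : h^-1 *: ((f \o shift z) (h *: 1) - f z)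
    @[h --> (0:R[i]^o)^'] --> 'D_1 f z by exact: fz.
  rewrite ltcR => /(_ e0); rewrite near_withinE => /nbhs_normcP[d d0 dP].
  exists d => // h hd; have [->|h0] := eqVneq h 0.
    by rewrite addr0 subrr mul0r subr0 normc0 mulr0.
  have := dP h; rewrite sub0r normc_opp => /(_ hd h0) /=.
  rewrite normc_norm ltcR => /ltW le; rewrite -normc_opp opprB.
  rewrite (_ : _ - _ = h * ('D_1 f z - h^-1 *: (f (h *: 1 + z) - f z))).
    by rewrite normc_mul mulrC ler_wpM2r ?normc_ge0.
  rewrite mulrBr; congr (_ - _).
  by rewrite /GRing.scale/= mulr1 mulVKf// (addrC h).
apply/cvg_ex; exists A; apply/cvgrPdist_le => e; rewrite ltcE/= => /andP[/eqP e'0 e0].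
rewrite near_withinE; apply/nbhs_normcP; have [d d0 dP] := fA _ e0; exists d => // h.
rewrite sub0r normc_opp => hd h0; rewrite normc_norm lecE/= e'0 eqxx/=.
have := dP h hd; have n0 : 0 < normc h by rewrite normc_gt0.
rewrite -ler_pdivrMr// => /(le_trans _); apply.
rewrite -normcV -normc_mul normc_subC /GRing.scale/= mulr1 (addrC h).
by rewrite [X in _ <= normc X]mulrC [X in _ <= normc X]mulrBr mulKf// lexx.
Qed.

Lemma derivable_continuous_normc f z : derivable f z 1 -> forall e : R, 0 < e ->
  exists2 d : R, 0 < d & forall w, normc (w - z) < d -> normc (f w - f z) < e.
Proof.
move=> /derivable1_diffP/differentiable_continuous cf e e0.
have : 0 < e%:C :> R[i] by rewrite ltcR.
move/cvgrPdist_lt : cf => /[apply] /nbhs_normcP[d d0 dP].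
exists d => // w; rewrite normc_subC => /dP /=.
by rewrite normc_norm ltcR normc_subC.
Qed.

Lemma derivable_eq_near f g z (d : R) : 0 < d ->
  (forall w, normc (w - z) < d -> f w = g w) -> derivable f z 1 -> derivable g z 1.
Proof.
move=> d0 fg /derivable_normcP[A fA]; apply/derivable_normcP; exists A => e e0.
have [d1 d10 dP] := fA _ e0; exists (Num.min d d1); first by rewrite lt_min d0.
move=> h; rewrite lt_min => /andP[hd hd1].
rewrite -!fg ?subrr ?normc0//; first exact: dP.
by rewrite addrC addKr.
Qed.

End ComplexDerivative.

(** * Line integrals and Goursat's theorem *)

Section ComplexIntegral.
Context {R : realType}.
Notation mu := (@lebesgue_measure R).
Implicit Types (a b m : R) (F H : R -> R[i]).

Definition Cint a b F : R[i] :=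
  \int[mu]_(x in `[a, b]) complex.Re (F x) +i* \int[mu]_(x in `[a, b]) complex.Im (F x).

Definition Cintegrable a b F :=
  mu.-integrable `[a, b] (EFin \o (fun x => complex.Re (F x))) /\
  mu.-integrable `[a, b] (EFin \o (fun x => complex.Im (F x))).

Lemma CintegrableD a b F H : Cintegrable a b F -> Cintegrable a b H ->
  Cintegrable a b (fun x => F x + H x).
Proof.
move=> [F1 F2] [H1 H2]; split.
  apply: (eq_integrable _ _ _ _ (integrableD _ F1 H1)) => // x _.
  by rewrite /= Re_add EFinD.
apply: (eq_integrable _ _ _ _ (integrableD _ F2 H2)) => // x _.
by rewrite /= Im_add EFinD.
Qed.

Lemma CintegrableZ a b (k : R[i]) F : Cintegrable a b F ->
  Cintegrable a b (fun x => k * F x).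
Proof.
move=> [F1 F2]; split.
  have I1 := @integrableZl _ _ _ mu _ (measurable_itv _) (complex.Re k) _ F1.
  have I2 := @integrableZl _ _ _ mu _ (measurable_itv _) (complex.Im k) _ F2.
  apply: (eq_integrable _ _ _ _ (integrableB _ I1 I2)) => // x _.
  by rewrite /= Re_mul EFinB !EFinM.
have I1 := @integrableZl _ _ _ mu _ (measurable_itv _) (complex.Re k) _ F2.
have I2 := @integrableZl _ _ _ mu _ (measurable_itv _) (complex.Im k) _ F1.
apply: (eq_integrable _ _ _ _ (integrableD _ I1 I2)) => // x _.
by rewrite /= Im_mul EFinD !EFinM.
Qed.

Lemma CintegrableN a b F : Cintegrable a b F ->
  Cintegrable a b (fun x => - F x).
Proof.
move=> /(CintegrableZ (-1)); congr (Cintegrable _ _ _).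
by apply/funext => x; rewrite mulN1r.
Qed.

Lemma CintegrableB a b F H : Cintegrable a b F -> Cintegrable a b H ->
  Cintegrable a b (fun x => F x - H x).
Proof. by move=> iF /CintegrableN; exact: CintegrableD. Qed.

Lemma CintD a b F H : Cintegrable a b F -> Cintegrable a b H ->
  Cint a b (fun x => F x + H x) = Cint a b F + Cint a b H.
Proof.
move=> [F1 F2] [H1 H2]; apply: eq_complexP => /=.
  rewrite -RintegralD//; apply: eq_Rintegral => x _.
  by rewrite Re_add.
rewrite -RintegralD//; apply: eq_Rintegral => x _.
by rewrite Im_add.
Qed.

Lemma CintZ a b (k : R[i]) F : Cintegrable a b F ->
  Cint a b (fun x => k * F x) = k * Cint a b F.
Proof.
move=> [F1 F2]; have mI := measurable_itv `[a, b].
have I (c : R) (u : R -> R) : mu.-integrable `[a, b] (EFin \o u) ->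
    mu.-integrable `[a, b] (EFin \o (fun x => c * u x)).
  move=> iu; apply: (eq_integrable _ _ _ _ (@integrableZl _ _ _ mu _ mI c _ iu)) => //.
apply: eq_complexP => /=.
  rewrite Re_mul /= -!RintegralZl// -RintegralB//; [|exact: I..].
  by apply: eq_Rintegral => x _; rewrite Re_mul.
rewrite Im_mul /= -!RintegralZl// -RintegralD//; [|exact: I..].
by apply: eq_Rintegral => x _; rewrite Im_mul.
Qed.

Lemma CintN a b F : Cintegrable a b F ->
  Cint a b (fun x => - F x) = - Cint a b F.
Proof.
move=> iF; rewrite -mulN1r -CintZ//; congr Cint.
by apply/funext => x; rewrite mulN1r.
Qed.

Lemma CintB a b F H : Cintegrable a b F -> Cintegrable a b H ->
  Cint a b (fun x => F x - H x) = Cint a b F - Cint a b H.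
Proof. by move=> iF iH; rewrite CintD ?CintN//; exact: CintegrableN. Qed.

Lemma Rintegral_itv_cst a b (k : R) : a <= b ->
  \int[mu]_(x in `[a, b]) k = k * (b - a).
Proof.
move=> ab; rewrite Rintegral_cst//; congr (_ * _).
have E : fine (@lebesgue_measure R `[a, b]) = b - a.
  rewrite lebesgue_measure_itv/= lte_fin.
  by case: ltgtP ab => //= -> _; rewrite subrr.
exact: E.
Qed.

Lemma Cint_cst a b (k : R[i]) : a <= b ->
  Cint a b (fun=> k) = k * (b - a)%:C.
Proof.
move=> ab; rewrite /Cint !Rintegral_itv_cst//.
by case: k => k l; apply: eq_complexP; rewrite /= !mulr0 ?subr0 ?add0r.
Qed.

Lemma eq_Cint a b F H : {in `[a, b], F =1 H} -> Cint a b F = Cint a b H.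
Proof.
move=> FH; apply: eq_complexP; apply: eq_Rintegral => x /=;
by rewrite inE/= => /FH ->.
Qed.

Lemma Cintegrable_sub a b a' b' F : a <= a' -> b' <= b ->
  Cintegrable a b F -> Cintegrable a' b' F.
Proof.
move=> aa bb [F1 F2]; have sub : `[a', b'] `<=` `[a, b].
  by apply: subset_itv; rewrite bnd_simp.
by split; [apply: (@integrableS _ _ _ mu _ _ _ _ _ sub F1)|
  apply: (@integrableS _ _ _ mu _ _ _ _ _ sub F2)]; exact: measurable_itv.
Qed.

Lemma Cint_split a m b F : a <= m -> m <= b -> Cintegrable a b F ->
  Cint a b F = Cint a m F + Cint m b F.
Proof.
move=> am mb [F1 F2].
have E (u : R -> R) : mu.-integrable `[a, b] (EFin \o u) ->
    \int[mu]_(x in `[a, b]) u x =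
    \int[mu]_(x in `[a, m]) u x + \int[mu]_(x in `[m, b]) u x.
  move=> iu; apply/eqP; rewrite addrC -subr_eq; apply/eqP.
  rewrite (Rintegral_itvB iu)// ?bnd_simp//.
  apply: Rintegral_itv_obnd_cbnd.
  have : mu.-integrable `[m, b] (EFin \o u).
    apply: (@integrableS _ _ _ mu _ _ _ _ _ _ iu) => //.
    by apply: subset_itv; rewrite bnd_simp.
  by apply: integrableS => //; apply: subset_itv; rewrite bnd_simp.
by apply: eq_complexP; rewrite ?Re_add ?Im_add; exact: E.
Qed.

Lemma normc_Cint_le a b F (phi : R -> R) : Cintegrable a b F ->
  mu.-integrable `[a, b] (EFin \o phi) ->
  {in `[a, b], forall x, normc (F x) <= phi x} ->
  normc (Cint a b F) <= 2 * \int[mu]_(x in `[a, b]) phi x.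
Proof.
move=> [F1 F2] iphi Fphi; have mI := measurable_itv `[a, b].
have E (u : R -> R) : mu.-integrable `[a, b] (EFin \o u) ->
    {in `[a, b], forall x, `|u x| <= phi x} ->
    `|\int[mu]_(x in `[a, b]) u x| <= \int[mu]_(x in `[a, b]) phi x.
  move=> iu uphi; apply: (@le_trans _ _ (\int[mu]_(x in `[a, b]) `|u x|)).
    exact: le_normr_Rintegral.
  apply: le_Rintegral => //.
  exact: (@integrable_norm _ _ _ mu).
rewrite (le_trans (normc_le_ReIm _))//= mulr_natl mulr2n lerD//; apply: E => //.
  by move=> x xab; rewrite (le_trans (normr_Re_le _))// Fphi.
by move=> x xab; rewrite (le_trans (normr_Im_le _))// Fphi.
Qed.

Lemma continuous_integrable_itv a b (u : R -> R) :
  (forall x, x \in `[a, b] -> forall e : R, 0 < e -> exists2 d : R, 0 < d &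
    forall y, `|y - x| < d -> `|u y - u x| < e) ->
  mu.-integrable `[a, b] (EFin \o u).
Proof.
move=> uc; apply: continuous_compact_integrable; first exact: segment_compact.
apply: continuous_in_subspaceT => x; rewrite inE => /uc ux.
apply/cvgrPdist_lt => e /ux[d d0 dP]; apply/nbhs_ballP; exists d => // y.
by rewrite /ball/= distrC => /dP; rewrite distrC.
Qed.

Lemma continuous_Cintegrable a b F :
  (forall x, x \in `[a, b] -> forall e : R, 0 < e -> exists2 d : R, 0 < d &
    forall y, `|y - x| < d -> normc (F y - F x) < e) ->
  Cintegrable a b F.
Proof.
move=> Fc; split; apply: continuous_integrable_itv => x /Fc Fx e /Fx[d d0 dP];
  exists d => // y /dP; apply: le_lt_trans.
- by rewrite -Re_opp -Re_add normr_Re_le.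
- by rewrite -Im_opp -Im_add normr_Im_le.
Qed.

Lemma integrable_itv_cst a b (k : R) : mu.-integrable `[a, b] (EFin \o fun=> k).
Proof.
by apply: continuous_integrable_itv => x _ e e0; exists 1 => // y _; rewrite subrr normr0.
Qed.

Lemma normc_Cint_le_cst a b F (M : R) : a <= b -> Cintegrable a b F ->
  {in `[a, b], forall x, normc (F x) <= M} ->
  normc (Cint a b F) <= 2 * M * (b - a).
Proof.
move=> ab iF FM; rewrite -mulrA -Rintegral_itv_cst//.
exact: normc_Cint_le (integrable_itv_cst _ _ _) FM.
Qed.

End ComplexIntegral.

Section RectangleIntegral.
Context {R : realType}.
Implicit Types (a b c d : R) (f g : R[i]^o -> R[i]^o) (z : R[i]^o).

Definition inrect a b c d z :=
  a <= complex.Re z <= b /\ c <= complex.Im z <= d.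

Definition edge a b c d z := inrect a b c d z /\
  [\/ complex.Im z = c, complex.Im z = d, complex.Re z = a | complex.Re z = b].

Definition rint a b c d f : R[i] :=
  (Cint a b (fun x => f (x +i* c)) - Cint a b (fun x => f (x +i* d))) +
  'i * (Cint c d (fun y => f (b +i* y)) - Cint c d (fun y => f (a +i* y))).

Lemma horizontal_continuous f a b c : (forall x, x \in `[a, b] -> derivable f (x +i* c) 1) ->
  forall x, x \in `[a, b] -> forall e : R, 0 < e -> exists2 d : R, 0 < d &
    forall y, `|y - x| < d -> normc (f (y +i* c) - f (x +i* c)) < e.
Proof.
move=> df x /df dx e e0.
have [d d0 dP] := derivable_continuous_normc dx e0; exists d => // y xy.
by apply: dP; rewrite (_ : _ - _ = (y - x)%:C) ?normc_real//; apply: eq_complexP;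
  rewrite /= ?subrr.
Qed.

Lemma vertical_continuous f a c d : (forall y, y \in `[c, d] -> derivable f (a +i* y) 1) ->
  forall x, x \in `[c, d] -> forall e : R, 0 < e -> exists2 d : R, 0 < d &
    forall y, `|y - x| < d -> normc (f (a +i* y) - f (a +i* x)) < e.
Proof.
move=> df x /df dx e e0.
have [r r0 rP] := derivable_continuous_normc dx e0; exists r => // y xy.
apply: rP; rewrite (_ : _ - _ = 'i * (y - x)%:C).
  by rewrite normc_mul normci mul1r normc_real.
by apply: eq_complexP; rewrite /= ?subrr ?mul0r ?mul1r ?mulr0 ?addr0 ?subr0 ?add0r.
Qed.

Lemma derivable_Cintegrable_horizontal a b c f :
  (forall x, x \in `[a, b] -> derivable f (x +i* c) 1) ->
  Cintegrable a b (fun x => f (x +i* c)).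
Proof. by move=> df; apply: continuous_Cintegrable; exact: horizontal_continuous. Qed.

Lemma derivable_Cintegrable_vertical a c d f :
  (forall y, y \in `[c, d] -> derivable f (a +i* y) 1) ->
  Cintegrable c d (fun y => f (a +i* y)).
Proof. by move=> df; apply: continuous_Cintegrable; exact: vertical_continuous. Qed.

Definition edge_derivable a b c d f := forall z, edge a b c d z -> derivable f z 1.

Definition edge_integrable a b c d f :=
  [/\ Cintegrable a b (fun x => f (x +i* c)), Cintegrable a b (fun x => f (x +i* d)),
      Cintegrable c d (fun y => f (a +i* y)) & Cintegrable c d (fun y => f (b +i* y))].

Lemma edge_derivable_integrable a b c d f : a <= b -> c <= d ->
  edge_derivable a b c d f -> edge_integrable a b c d f.
Proof.
move=> ab cd df; split.
- apply: derivable_Cintegrable_horizontal => x; rewrite in_itv/= => xab.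
  by apply: df; split; [split; rewrite //= lexx|constructor 1].
- apply: derivable_Cintegrable_horizontal => x; rewrite in_itv/= => xab.
  by apply: df; split; [split; rewrite //= lexx ?andbT|constructor 2].
- apply: derivable_Cintegrable_vertical => x; rewrite in_itv/= => xab.
  by apply: df; split; [split; rewrite //= lexx|constructor 3].
- apply: derivable_Cintegrable_vertical => x; rewrite in_itv/= => xab.
  by apply: df; split; [split; rewrite //= lexx ?andbT|constructor 4].
Qed.

Lemma rintB a b c d f g : edge_integrable a b c d f -> edge_integrable a b c d g ->
  rint a b c d (fun z => f z - g z) = rint a b c d f - rint a b c d g.
Proof.
by move=> [f1 f2 f3 f4] [g1 g2 g3 g4]; rewrite /rint !CintB//; ring.
Qed.

Lemma rintZ a b c d (k : R[i]) f : edge_integrable a b c d f ->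
  rint a b c d (fun z => k * f z) = k * rint a b c d f.
Proof. by move=> [f1 f2 f3 f4]; rewrite /rint !CintZ//; ring. Qed.

Lemma eq_rint a b c d f g : a <= b -> c <= d ->
  (forall z, edge a b c d z -> f z = g z) -> rint a b c d f = rint a b c d g.
Proof.
move=> ab cd fg; rewrite /rint; congr (_ - _ + _ * (_ - _)); apply: eq_Cint => x;
  rewrite in_itv/= => xab; apply: fg.
- by split; [split; rewrite //= lexx|constructor 1].
- by split; [split; rewrite //= lexx ?andbT|constructor 2].
- by split; [split; rewrite //= lexx ?andbT|constructor 4].
- by split; [split; rewrite //= lexx|constructor 3].
Qed.

Lemma rint_split_horizontal a m b c d f : a <= m -> m <= b ->
  Cintegrable a b (fun x => f (x +i* c)) -> Cintegrable a b (fun x => f (x +i* d)) ->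
  rint a b c d f = rint a m c d f + rint m b c d f.
Proof.
by move=> am mb f1 f2; rewrite /rint (Cint_split am mb f1) (Cint_split am mb f2); ring.
Qed.

Lemma rint_split_vertical a b c m d f : c <= m -> m <= d ->
  Cintegrable c d (fun y => f (a +i* y)) -> Cintegrable c d (fun y => f (b +i* y)) ->
  rint a b c d f = rint a b c m f + rint a b m d f.
Proof.
by move=> cm md f1 f2; rewrite /rint (Cint_split cm md f1) (Cint_split cm md f2); ring.
Qed.

Lemma normc_rint_le a b c d f (M : R) : a <= b -> c <= d ->
  edge_integrable a b c d f -> (forall z, edge a b c d z -> normc (f z) <= M) ->
  normc (rint a b c d f) <= 4 * M * ((b - a) + (d - c)).
Proof.
move=> ab cd [f1 f2 f3 f4] fM.
have h1 : normc (Cint a b (fun x => f (x +i* c))) <= 2 * M * (b - a).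
  apply: normc_Cint_le_cst => // x; rewrite in_itv/= => xab; apply: fM.
  by split; [split; rewrite //= lexx|constructor 1].
have h2 : normc (Cint a b (fun x => f (x +i* d))) <= 2 * M * (b - a).
  apply: normc_Cint_le_cst => // x; rewrite in_itv/= => xab; apply: fM.
  by split; [split; rewrite //= lexx ?andbT|constructor 2].
have h3 : normc (Cint c d (fun x => f (a +i* x))) <= 2 * M * (d - c).
  apply: normc_Cint_le_cst => // x; rewrite in_itv/= => xab; apply: fM.
  by split; [split; rewrite //= lexx|constructor 3].
have h4 : normc (Cint c d (fun x => f (b +i* x))) <= 2 * M * (d - c).
  apply: normc_Cint_le_cst => // x; rewrite in_itv/= => xab; apply: fM.
  by split; [split; rewrite //= lexx ?andbT|constructor 4].
rewrite /rint (le_trans (normc_triangle _ _))// normc_mul normci mul1r.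
have := normc_sub (Cint a b (fun x => f (x +i* c))) (Cint a b (fun x => f (x +i* d))).
have := normc_sub (Cint c d (fun x => f (b +i* x))) (Cint c d (fun x => f (a +i* x))).
lra.
Qed.

Lemma derivable_affine (k A p : R[i]^o) z :
  derivable (fun w : R[i]^o => k + (w - p) * A : R[i]^o) z 1.
Proof.
apply/derivable_normcP; exists A => e e0; exists 1 => // h _.
rewrite (_ : _ - _ = 0) ?normc0 ?mulr_ge0 ?normc_ge0 ?(ltW e0)//.
by ring.
Qed.

Lemma edge_integrable_affine a b c d (k A p : R[i]^o) : a <= b -> c <= d ->
  edge_integrable a b c d (fun z : R[i]^o => k + (z - p) * A : R[i]^o).
Proof.
move=> ab cd; apply: (edge_derivable_integrable ab cd) => z _.
exact: derivable_affine.
Qed.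

Lemma rint_affine a b c d (k A p : R[i]) : a <= b -> c <= d ->
  rint a b c d (fun z => k + (z - p) * A) = 0.
Proof.
move=> ab cd.
have [i1 i2 i3 i4] := edge_integrable_affine k A p ab cd.
rewrite /rint -!CintB//.
rewrite (_ : (fun x : R => _ - _) = fun=> 'i * (c - d)%:C * A); last first.
  apply/funext => x; rewrite (_ : _ - _ = ((x +i* c) - (x +i* d)) * A); last by ring.
  congr (_ * _); apply: eq_complexP; rewrite /= ?subrr; ring.
rewrite (_ : (fun x : R => _ - _) = fun=> (b - a)%:C * A); last first.
  apply/funext => x; rewrite (_ : _ - _ = ((b +i* x) - (a +i* x)) * A); last by ring.
  congr (_ * _); apply: eq_complexP; rewrite /= ?subrr; ring.
rewrite !Cint_cst// !rmorphB/=; ring.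
Qed.

Lemma normc_rint_le_derivative a b c d f (p A : R[i]) (e : R) : a <= b -> c <= d ->
  edge_integrable a b c d f -> inrect a b c d p -> 0 <= e ->
  (forall z, inrect a b c d z -> normc (f z - f p - (z - p) * A) <= e * normc (z - p)) ->
  normc (rint a b c d f) <= 4 * e * ((b - a) + (d - c)) ^+ 2.
Proof.
move=> ab cd fi pin e0 fA; set W := _ + _.
have i2 := edge_integrable_affine (f p) A p ab cd.
rewrite -[rint _ _ _ _ f]subr0 -(rint_affine (f p) A p ab cd) -rintB//.
rewrite expr2 mulrA -(mulrA 4); apply: normc_rint_le => //.
  case: fi i2 => [f1 f2 f3 f4] [g1 g2 g3 g4].
  by split; apply: CintegrableB.
move=> z [zin _]; rewrite opprD addrA (le_trans (fA _ zin))// ler_wpM2l//.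
rewrite (le_trans (normc_le_ReIm _))// !(Re_add, Im_add, Re_opp, Im_opp).
move: pin zin => [/andP[? ?] /andP[? ?]] [/andP[? ?] /andP[? ?]].
by apply: lerD; rewrite ler_norml; apply/andP; split; lra.
Qed.

Lemma nested_intervals (u v : nat -> R) : (forall n, u n <= u n.+1) ->
  (forall n, v n.+1 <= v n) -> (forall n, u n <= v n) ->
  exists p, forall n, u n <= p <= v n.
Proof.
move=> uS vS uv.
have uh m n : (m <= n)%N -> u m <= u n by have /nondecreasing_seqP := uS; exact.
have vh m n : (m <= n)%N -> v n <= v m by have /nonincreasing_seqP := vS; exact.
have uvmn m n : u m <= v n.
  have := uh _ _ (leq_maxl m n); have := vh _ _ (leq_maxr m n).
  by have := uv (maxn m n); lra.
have hs : has_sup (range u).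
  by split; [exists (u 0%N), 0%N|exists (v 0%N) => _ [n _ <-]].
exists (sup (range u)) => n; apply/andP; split.
  by apply: ub_le_sup; [case: hs|exists n].
by apply: ge_sup => [|_ [m _ <-]]; [exists (u 0%N), 0%N|].
Qed.

Lemma exists_div_expn2_lt (W d : R) : 0 <= W -> 0 < d -> exists n : nat, W / 2 ^+ n < d.
Proof.
move=> W0 d0; exists (Num.bound (W / d)).
have := archi_boundP (divr_ge0 W0 (ltW d0)); set n := Num.bound _ => h.
rewrite ltr_pdivrMr ?exprn_gt0// mulrC -ltr_pdivrMr// (lt_trans h)//.
by rewrite -natrX ltr_nat ltn_expl.
Qed.

Lemma rint_quarter a b c d f : a <= b -> c <= d ->
  (forall z, inrect a b c d z -> derivable f z 1) ->
  exists i j : bool,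
    let L := (b - a) / 2 in let H := (d - c) / 2 in
    let a' := a + i%:R * L in let c' := c + j%:R * H in
    normc (rint a b c d f) / 4 <= normc (rint a' (a' + L) c' (c' + H) f).
Proof.
move=> ab cd df; set L := (b - a) / 2; set H := (d - c) / 2.
have L0 : 0 <= L by rewrite /L; lra.
have H0 : 0 <= H by rewrite /H; lra.
have bE : b = a + L + L by rewrite /L; lra.
have dE : d = c + H + H by rewrite /H; lra.
have sub a1 b1 c1 d1 : a <= a1 -> a1 <= b1 -> b1 <= b -> c <= c1 -> c1 <= d1 -> d1 <= d ->
    edge_integrable a1 b1 c1 d1 f.
  move=> ? ? ? ? ? ?; apply: edge_derivable_integrable => // z [[/andP[? ?] /andP[? ?]] _].
  by apply: df; split; apply/andP; split; lra.
have E : rint a b c d f =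
    (rint a (a + L) c (c + H) f + rint a (a + L) (c + H) (c + H + H) f) +
    (rint (a + L) (a + L + L) c (c + H) f + rint (a + L) (a + L + L) (c + H) (c + H + H) f).
  have [s1 s2 _ _] : edge_integrable a b c d f by apply: sub; lra.
  rewrite (@rint_split_horizontal _ (a + L) _ _ _ _ _ _ s1 s2); [|lra..].
  rewrite -dE -bE.
  have [_ _ s3 s4] : edge_integrable a (a + L) c d f by apply: sub; lra.
  rewrite (@rint_split_vertical a _ c (c + H) _ _ _ _ s3 s4); [|lra..].
  have [_ _ s5 s6] : edge_integrable (a + L) b c d f by apply: sub; lra.
  by rewrite (@rint_split_vertical (a + L) _ c (c + H) _ _ _ _ s5 s6); [|lra..].
apply: contrapT => /forallNP h.
have {}h (i j : bool) :
    normc (rint (a + i%:R * L) (a + i%:R * L + L) (c + j%:R * H) (c + j%:R * H + H) f) <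
    normc (rint a b c d f) / 4.
  by rewrite ltNge; apply/negP => hh; apply: (h i); exists j.
have := h false false; have := h false true; have := h true false; have := h true true.
rewrite !mul0r !mul1r !addr0.
move: (rint a (a + L) c (c + H) f) (rint a (a + L) (c + H) (c + H + H) f)
  (rint (a + L) (a + L + L) c (c + H) f) (rint (a + L) (a + L + L) (c + H) (c + H + H) f) E.
move=> s t u v -> h1 h2 h3 h4.
have := normc_triangle (s + t) (u + v); have := normc_triangle s t.
have := normc_triangle u v; lra.
Qed.

Theorem goursat a b c d f : a <= b -> c <= d ->
  (forall z, inrect a b c d z -> derivable f z 1) -> rint a b c d f = 0.
Proof.
move=> ab cd df; apply/eqP; rewrite -normc_eq0 -[_ == _]negbK; apply/negP => m0.
set m := normc _ in m0; have {}m0 : 0 < m by rewrite lt_def m0 normc_ge0.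
pose L n := (b - a) / 2 ^+ n; pose H n := (d - c) / 2 ^+ n.
have LS n : L n = L n.+1 + L n.+1.
  by rewrite /L exprS invfM mulrA -mulrDl; congr (_ / _); lra.
have HS n : H n = H n.+1 + H n.+1.
  by rewrite /H exprS invfM mulrA -mulrDl; congr (_ / _); lra.
have L0 n : 0 <= L n by rewrite divr_ge0 ?exprn_ge0//; lra.
have H0 n : 0 <= H n by rewrite divr_ge0 ?exprn_ge0//; lra.
pose Bad n (p : R * R) := [/\ a <= p.1, p.1 + L n <= b, c <= p.2, p.2 + H n <= d &
  m / 4 ^+ n <= normc (rint p.1 (p.1 + L n) p.2 (p.2 + H n) f)].
have step (t : nat * (R * R)) : exists p : R * R, Bad t.1 t.2 ->
    [/\ Bad t.1.+1 p, t.2.1 <= p.1, p.1 + L t.1.+1 <= t.2.1 + L t.1,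
      t.2.2 <= p.2 & p.2 + H t.1.+1 <= t.2.2 + H t.1].
  case: t => n [s u] /=; have [|nB] := pselect (Bad n (s, u)); last by exists (s, u).
  move=> [/= as_ sb cu ud mle].
  have sL : s <= s + L n by rewrite lerDl.
  have uH : u <= u + H n by rewrite lerDl.
  have [z [/andP[z1 z2] /andP[z3 z4]]|i [j]] := @rint_quarter _ _ _ _ f sL uH.
    apply: df; move: (L n) (H n) sb ud sL uH z1 z2 z3 z4 {mle} => p q *.
    by split; apply/andP; split; lra.
  have -> : (s + L n - s) / 2 = L n.+1 by rewrite addrC addKr (LS n); lra.
  have -> : (u + H n - u) / 2 = H n.+1 by rewrite addrC addKr (HS n); lra.
  move=> /= q; exists (s + i%:R * L n.+1, u + j%:R * H n.+1) => _ /=.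
  have /andP[i0 i1] : 0 <= i%:R * L n.+1 <= L n.+1.
    by case: (i); rewrite ?mul1r ?mul0r ?L0 lexx.
  have /andP[j0 j1] : 0 <= j%:R * H n.+1 <= H n.+1.
    by case: (j); rewrite ?mul1r ?mul0r ?H0 lexx.
  have qq : m / 4 ^+ n.+1 <= normc (rint s (s + L n) u (u + H n) f) / 4.
    by rewrite exprS invfM mulrCA mulrC ler_pM2r.
  have {qq q} := le_trans qq q; rewrite /Bad/=; move: (LS n) (HS n) i0 i1 j0 j1 sb ud.
  move: (i%:R * L n.+1) (j%:R * H n.+1) (L n) (H n) (L n.+1) (H n.+1).
  move: as_ cu; clear; move=> as_ cu x y p q p' q' *.
  by split; first split=> //; lra.
have [F FP] := choice step.
pose s n := iteri n (fun k p => F (k, p)) (a, c).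
have sB n : Bad n (s n).
  elim: n => [|n IH] /=; last by case: (FP (n, s n) IH).
  by rewrite /s/Bad/= /L /H !expr0 !divr1 (addrC a) subrK (addrC c) subrK !lexx.
have sS n : [/\ (s n).1 <= (s n.+1).1, (s n.+1).1 + L n.+1 <= (s n).1 + L n,
      (s n).2 <= (s n.+1).2 & (s n.+1).2 + H n.+1 <= (s n).2 + H n].
  by case: (FP (n, s n) (sB n)).
have [p1 p1P] : exists p, forall n, (s n).1 <= p <= (s n).1 + L n.
  by apply: nested_intervals => n; [case: (sS n)|case: (sS n)|rewrite lerDl].
have [p2 p2P] : exists p, forall n, (s n).2 <= p <= (s n).2 + H n.
  by apply: nested_intervals => n; [case: (sS n)|case: (sS n)|rewrite lerDl].
have pin n : inrect (s n).1 ((s n).1 + L n) (s n).2 ((s n).2 + H n) (p1 +i* p2).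
  by split; rewrite /= ?p1P ?p2P.
have sub n z : inrect (s n).1 ((s n).1 + L n) (s n).2 ((s n).2 + H n) z -> inrect a b c d z.
  by have [? ? ? ? _] := sB n; move=> [/andP[? ?] /andP[? ?]]; split; apply/andP; split; lra.
pose W := (b - a) + (d - c); have W0 : 0 <= W by rewrite /W; lra.
pose e := m / (4 * W ^+ 2 + 1).
have den : 0 < 4 * W ^+ 2 + 1 by rewrite ltr_wpDl// mulr_ge0// sqr_ge0.
have e0 : 0 < e by rewrite divr_gt0.
have /derivable_normcP[A /(_ e e0)[r r0 rP]] : derivable f (p1 +i* p2) 1.
  exact: df (sub 0%N _ (pin 0%N)).
have [n nr] := exists_div_expn2_lt W0 r0.
have [_ _ _ _] := sB n; apply/negP; rewrite -ltNge.
have WE : L n + H n = W / 2 ^+ n by rewrite -mulrDl.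
have : normc (rint (s n).1 ((s n).1 + L n) (s n).2 ((s n).2 + H n) f) <=
    4 * e * (L n + H n) ^+ 2.
  have -> : L n + H n = ((s n).1 + L n - (s n).1) + ((s n).2 + H n - (s n).2) by lra.
  apply: (@normc_rint_le_derivative _ _ _ _ _ (p1 +i* p2) A); rewrite ?lerDl ?(ltW e0)//.
    apply: edge_derivable_integrable; rewrite ?lerDl// => z [zin _].
    exact: df (sub _ _ zin).
  move=> z zin; have := rP (z - (p1 +i* p2)); rewrite (addrC _ (z - _)) subrK; apply.
  apply: le_lt_trans nr; rewrite -WE (le_trans (normc_le_ReIm _))//.
  have := pin n; case: z zin => [x y]; rewrite /inrect/=.
  move=> [/andP[? ?] /andP[? ?]] [/andP[? ?] /andP[? ?]].
  by apply: lerD; rewrite ler_norml; apply/andP; split; lra.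
move=> /le_lt_trans; apply; rewrite WE expr_div_n -exprM mulnC exprM mulrA.
rewrite (_ : 2 ^+ 2 = 4 :> R); last by rewrite -natrX.
rewrite ltr_pM2r ?invr_gt0 ?exprn_gt0// /e (mulrC 4) -mulrA mulrAC.
by rewrite ltr_pdivrMr// ltr_pM2l// ltrDl.
Qed.

End RectangleIntegral.

(** * Cauchy's formula and Cauchy estimates *)

Section CauchyFormula.
Context {R : realType}.
Implicit Types (a b c d : R) (f g : R[i]^o -> R[i]^o) (z w p : R[i]^o).

Lemma derivable_mulc f g z : derivable f z 1 -> derivable g z 1 ->
  derivable (fun w => f w * g w : R[i]^o) z 1.
Proof. by move=> df dg; exact: (derivableM df dg). Qed.

Lemma derivable_subc f g z : derivable f z 1 -> derivable g z 1 ->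
  derivable (fun w => f w - g w : R[i]^o) z 1.
Proof. by move=> df dg; exact: (derivableB df dg). Qed.

Lemma derivable_cstc (k : R[i]^o) z : derivable (fun=> k) z 1.
Proof. exact: derivable_cst. Qed.

Lemma derivable_inv_sub p z : z != p -> derivable (fun w => (w - p)^-1 : R[i]^o) z 1.
Proof.
move=> zp; apply: (@derivableV _ _ (fun w : R[i]^o => w - p)).
  by rewrite subr_eq0.
exact: (derivable_subc (@derivable_id _ _ z 1) (@derivable_cstc p z)).
Qed.

Lemma edge_dist a b c d (r : R) p z :
  a + r <= complex.Re p <= b - r -> c + r <= complex.Im p <= d - r ->
  edge a b c d z -> r <= normc (z - p).
Proof.
move=> /andP[? ?] /andP[? ?] [_ zE].
have hR := normr_Re_le (z - p); have hI := normr_Im_le (z - p).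
rewrite Re_add Re_opp in hR; rewrite Im_add Im_opp in hI.
have := ler_norm (complex.Re z - complex.Re p).
have := ler_norm (complex.Im z - complex.Im p).
have := ler_norm (- (complex.Re z - complex.Re p)).
have := ler_norm (- (complex.Im z - complex.Im p)).
rewrite !normrN; case: zE => zE; lra.
Qed.

Lemma rint_shrink a b c d (t : R) z f : 0 < t ->
  a <= complex.Re z - t -> complex.Re z + t <= b ->
  c <= complex.Im z - t -> complex.Im z + t <= d ->
  (forall w, inrect a b c d w -> w != z -> derivable f w 1) ->
  rint a b c d f = rint (complex.Re z - t) (complex.Re z + t)
                        (complex.Im z - t) (complex.Im z + t) f.
Proof.
case: z => x y /= t0 ax xb cy yd df.
have xt : x - t <= x + t by lra. have yt : y - t <= y + t by lra.
have g0 a1 b1 c1 d1 : a <= a1 -> a1 <= b1 -> b1 <= b -> c <= c1 -> c1 <= d1 -> d1 <= d ->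
    b1 <= x - t \/ x + t <= a1 \/ d1 <= y - t \/ y + t <= c1 ->
    rint a1 b1 c1 d1 f = 0.
  move=> ? ? ? ? ? ? zE; apply: goursat => // w [/andP[k1 k2] /andP[k3 k4]]; apply: df.
    by split; apply/andP; split; lra.
  apply/eqP => wz; move: k1 k2 k3 k4; rewrite wz /=.
  by case: zE => [|[|[|]]]; lra.
have hor k : c <= k <= d -> k != y -> Cintegrable a b (fun x => f (x +i* k)).
  move=> ckd ky; apply: derivable_Cintegrable_horizontal => s; rewrite in_itv/= => sab.
  by apply: df => //; apply: contra_neq ky => -[].
have ver k : a <= k <= b -> k != x -> Cintegrable c d (fun y => f (k +i* y)).
  move=> ckd ky; apply: derivable_Cintegrable_vertical => s; rewrite in_itv/= => sab.
  by apply: df => //; apply: contra_neq ky => -[].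
have [yc yd'] : c != y /\ d != y by split; apply/eqP; lra.
have [xm xp] : x - t != x /\ x + t != x by split; apply/eqP; lra.
have hc : Cintegrable a b (fun x => f (x +i* c)) by apply: hor => //; rewrite lexx/=; lra.
have hd : Cintegrable a b (fun x => f (x +i* d)) by apply: hor => //; rewrite lexx andbT; lra.
have va : Cintegrable c d (fun y => f ((x - t) +i* y)).
  by apply: ver => //; apply/andP; split; lra.
have vb : Cintegrable c d (fun y => f ((x + t) +i* y)).
  by apply: ver => //; apply/andP; split; lra.
rewrite (@rint_split_horizontal _ a (x - t) b c d f)//; last by lra.
rewrite (g0 a (x - t)); [|lra|lra|lra|lra|lra|lra|by left; lra].
rewrite (@rint_split_horizontal _ (x - t) (x + t) b c d f)//; last 2 first.
- by apply: Cintegrable_sub hc; lra.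
- by apply: Cintegrable_sub hd; lra.
rewrite (g0 (x + t) b); [|lra|lra|lra|lra|lra|lra|by right; left; lra].
rewrite (@rint_split_vertical _ (x - t) (x + t) c (y - t) d f)//; last by lra.
rewrite (g0 _ _ c (y - t)); [|lra|lra|lra|lra|lra|lra|by right; right; left; lra].
rewrite (@rint_split_vertical _ (x - t) (x + t) (y - t) (y + t) d f)//; last 2 first.
- by apply: Cintegrable_sub va; lra.
- by apply: Cintegrable_sub vb; lra.
rewrite (g0 _ _ (y + t) d); [|lra|lra|lra|lra|lra|lra|by right; right; right; lra].
by rewrite !add0r !addr0.
Qed.

Lemma rintE a b c d f : edge_integrable a b c d f ->
  rint a b c d f = Cint a b (fun x => f (x +i* c) - f (x +i* d)) +
                   'i * Cint c d (fun y => f (b +i* y) - f (a +i* y)).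
Proof. by move=> [f1 f2 f3 f4]; rewrite /rint !CintB. Qed.

Lemma Cint_Im_ge a b F (k : R) : a <= b -> Cintegrable a b F ->
  {in `[a, b], forall x, k <= complex.Im (F x)} ->
  k * (b - a) <= complex.Im (Cint a b F).
Proof.
move=> ab [_ FI] Fk; rewrite -Rintegral_itv_cst// /Cint/=.
by apply: le_Rintegral => //; exact: integrable_itv_cst.
Qed.

Lemma Cint_Re_ge a b F (k : R) : a <= b -> Cintegrable a b F ->
  {in `[a, b], forall x, k <= complex.Re (F x)} ->
  k * (b - a) <= complex.Re (Cint a b F).
Proof.
move=> ab [FR _] Fk; rewrite -Rintegral_itv_cst// /Cint/=.
by apply: le_Rintegral => //; exact: integrable_itv_cst.
Qed.

Definition winding a b c d z : R[i] := rint a b c d (fun w => (w - z)^-1 : R[i]^o).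

Lemma winding_square_Im_ge z (t : R) : 0 < t ->
  4 <= complex.Im (winding (complex.Re z - t) (complex.Re z + t)
                           (complex.Im z - t) (complex.Im z + t) z).
Proof.
move=> t0; rewrite /winding; set x := complex.Re z; set y := complex.Im z.
have ii : edge_integrable (x - t) (x + t) (y - t) (y + t) (fun w => (w - z)^-1 : R[i]^o).
  apply: edge_derivable_integrable; [lra|lra|move=> w ew].
  apply: derivable_inv_sub; rewrite -subr_eq0 -normc_gt0 (lt_le_trans t0)//.
  by apply: edge_dist ew => /=; apply/andP; split; rewrite /x /y; lra.
have [i1 i2 i3 i4] := ii.
have key (s u : R) : u \in `[s - t, s + t] -> 1 / t <= t / ((u - s) ^+ 2 + t ^+ 2) *+ 2.
  rewrite in_itv/= => /andP[h1 h2].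
  have pos : 0 < (u - s) ^+ 2 + t ^+ 2 by rewrite ltr_wpDl ?sqr_ge0// exprn_gt0.
  rewrite -mulrnAl ler_pdivlMr// mulrAC mul1r ler_pdivrMr//.
  have : (u - s) ^+ 2 <= t ^+ 2 by rewrite !expr2; nra.
  by rewrite mulr2n; lra.
rewrite (rintE ii) Im_add Im_mul [complex.Im 'i]/= [complex.Re 'i]/= mul0r add0r mul1r.
have -> : 4 = 1 / t * (x + t - (x - t)) + 1 / t * (y + t - (y - t)) :> R.
  by field; rewrite gt_eqF.
apply: lerD.
  apply: Cint_Im_ge; [lra|exact: CintegrableB|move=> u /key; congr (_ <= _)].
  rewrite Im_add Im_opp {1 2}(_ : z = x +i* y); last by rewrite /x /y; case: (z).
  rewrite /= (_ : y - t - y = - t); last by ring.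
  by rewrite (_ : y + t - y = t); [rewrite sqrrN mulNr opprK mulr2n|ring].
apply: Cint_Re_ge; [lra|exact: CintegrableB|move=> u /key; congr (_ <= _)].
rewrite Re_add Re_opp {1 2}(_ : z = x +i* y); last by rewrite /x /y; case: (z).
rewrite /= (_ : x - t - x = - t); last by ring.
rewrite (_ : x + t - x = t); last by ring.
by rewrite sqrrN mulNr opprK mulr2n (addrC (t ^+ 2)).
Qed.

Definition interior_rect a b c d z :=
  (a < complex.Re z < b) /\ (c < complex.Im z < d).

Lemma interior_margin a b c d z : interior_rect a b c d z ->
  exists2 r : R, 0 < r & forall t, 0 < t <= r ->
  [/\ a <= complex.Re z - t, complex.Re z + t <= b,
      c <= complex.Im z - t & complex.Im z + t <= d].
Proof.
move=> [/andP[h1 h2] /andP[h3 h4]].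
exists (Num.min (Num.min (complex.Re z - a) (b - complex.Re z))
                (Num.min (complex.Im z - c) (d - complex.Im z))).
  by rewrite !lt_min !subr_gt0 h1 h2 h3 h4.
by move=> t; rewrite !le_min => /andP[t0 /andP[/andP[? ?] /andP[? ?]]]; split; lra.
Qed.

Lemma interior_rect_edge a b c d z w : interior_rect a b c d z -> edge a b c d w -> w != z.
Proof.
move=> [/andP[? ?] /andP[? ?]] [_ wE]; apply: contraPneq wE => ->.
by case=> ?; lra.
Qed.

Lemma interior_rect_le a b c d z : interior_rect a b c d z -> a <= b /\ c <= d.
Proof. by move=> [/andP[? ?] /andP[? ?]]; split; lra. Qed.

Lemma winding_rect_indep a b c d a' b' c' d' z :
  interior_rect a b c d z -> interior_rect a' b' c' d' z ->
  winding a b c d z = winding a' b' c' d' z.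
Proof.
move=> /interior_margin[r r0 rP] /interior_margin[s s0 sP].
have t0 : 0 < Num.min r s by rewrite lt_min r0.
have /rP[? ? ? ?] : 0 < Num.min r s <= r by rewrite t0 ge_min lexx.
have /sP[? ? ? ?] : 0 < Num.min r s <= s by rewrite t0 ge_min lexx orbT.
rewrite /winding (@rint_shrink _ _ _ _ (Num.min r s) z)//; last first.
  by move=> w _; exact: derivable_inv_sub.
by rewrite (@rint_shrink a' _ _ _ (Num.min r s) z)// => w _; exact: derivable_inv_sub.
Qed.

Lemma winding_Im_ge a b c d z : interior_rect a b c d z ->
  4 <= complex.Im (winding a b c d z).
Proof.
move=> zin; have [r r0 rP] := interior_margin zin.
have /rP[? ? ? ?] : 0 < r <= r by rewrite r0 lexx.
rewrite /winding (@rint_shrink _ _ _ _ r z)//; last first.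
  by move=> w _; exact: derivable_inv_sub.
exact: winding_square_Im_ge.
Qed.

Lemma edge_integrable_inv_sub a b c d z : interior_rect a b c d z ->
  edge_integrable a b c d (fun w => (w - z)^-1 : R[i]^o).
Proof.
move=> zin; have [ab cd] := interior_rect_le zin.
apply: edge_derivable_integrable => // w ew; apply: derivable_inv_sub.
exact: interior_rect_edge ew.
Qed.

(* Liouville: the difference is O(1/L) over the square of half side L. *)
Lemma winding_const a b c d z p : interior_rect a b c d z -> interior_rect a b c d p ->
  winding a b c d z = winding a b c d p.
Proof.
move=> zin pin; apply/eqP; rewrite -subr_eq0 -normc_eq0 -[_ == _]negbK; apply/negP => m0.
set m := normc _ in m0; have {}m0 : 0 < m by rewrite lt_def m0 normc_ge0.
pose L := 2 * (normc z + normc p + 1) + 64 * normc (z - p) / m.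
have nz := normc_ge0 z; have np := normc_ge0 p; have nzp := normc_ge0 (z - p).
have L1 : 2 * (normc z + normc p + 1) <= L by rewrite lerDl divr_ge0// ?mulr_ge0// ltW.
have L0 : 0 < L by lra.
have bnd q : normc q <= normc z + normc p -> interior_rect (- L) L (- L) L q /\
    (forall w, edge (- L) L (- L) L w -> L / 2 <= normc (w - q)).
  move=> qle; have := normr_Re_le q; have := normr_Im_le q; rewrite !ler_norml.
  move=> /andP[? ?] /andP[? ?]; split; first by split; apply/andP; split; lra.
  by move=> w; apply: edge_dist; apply/andP; split; lra.
have [|zL zd] := bnd z; first by lra.
have [|pL pd] := bnd p; first by lra.
have mE : m = normc (rint (- L) L (- L) L (fun w => (w - z)^-1 - (w - p)^-1 : R[i]^o)).
  rewrite rintB; [|exact: edge_integrable_inv_sub..].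
  by rewrite /m (winding_rect_indep zin zL) (winding_rect_indep pin pL).
have : m <= 4 * (normc (z - p) * 4 / L ^+ 2) * ((L - - L) + (L - - L)).
  rewrite {1}mE; apply: normc_rint_le; [lra|lra| |].
    have [h1 h2 h3 h4] := edge_integrable_inv_sub zL.
    by have [k1 k2 k3 k4] := edge_integrable_inv_sub pL; split; apply: CintegrableB.
  move=> w ew; have wz := interior_rect_edge zL ew; have wp := interior_rect_edge pL ew.
  have -> : (w - z)^-1 - (w - p)^-1 = (z - p) * ((w - z)^-1 * (w - p)^-1).
    by field; rewrite !subr_eq0 wz wp.
  rewrite !normc_mul -mulrA ler_wpM2l// !normcV.
  have h := zd _ ew; have k := pd _ ew.
  rewrite -invfM -[4]invrK -invfM lef_pV2 ?posrE.
  - have : L / 2 * (L / 2) <= normc (w - z) * normc (w - p).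
      by apply: ler_pM => //; lra.
    by rewrite expr2; lra.
  - by apply: mulr_gt0; lra.
  - by rewrite mulr_gt0 ?invr_gt0// exprn_gt0.
rewrite leNgt => /negP; apply.
have -> : 4 * (normc (z - p) * 4 / L ^+ 2) * (L - - L + (L - - L)) = 64 * normc (z - p) / L.
  by field; rewrite gt_eqF.
rewrite ltr_pdivrMr// -ltr_pdivrMl// mulrC.
by rewrite /L; lra.
Qed.

Theorem cauchy_formula a b c d z f : interior_rect a b c d z ->
  (forall w, inrect a b c d w -> derivable f w 1) ->
  rint a b c d (fun w => (w - z)^-1 * f w : R[i]^o) = winding a b c d z * f z.
Proof.
move=> zin df; have [r r0 rP] := interior_margin zin.
have [ab cd] := interior_rect_le zin.
have zin' : inrect a b c d z.
  by case: zin => /andP[? ?] /andP[? ?]; split; apply/andP; split; lra.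
have i1 : edge_integrable a b c d (fun w => (w - z)^-1 * f w : R[i]^o).
  apply: edge_derivable_integrable => // w ew; apply: derivable_mulc.
    exact/derivable_inv_sub/(interior_rect_edge zin ew).
  by apply: df; case: ew.
have i2 := edge_integrable_inv_sub zin.
have i3 : edge_integrable a b c d (fun w => f z * (w - z)^-1 : R[i]^o).
  by case: i2 => ? ? ? ?; split; apply: CintegrableZ.
apply/eqP; rewrite -subr_eq0 mulrC -(rintZ (f z) i2) -rintB//.
set g := (fun w => _).
have dg w : inrect a b c d w -> w != z -> derivable g w 1.
  move=> win wz; apply: derivable_subc; apply: derivable_mulc.
  - exact: derivable_inv_sub.
  - exact: df.
  - exact: derivable_cstc.
  - exact: derivable_inv_sub.
have /derivable_normcP[A /(_ 1 ltr01)[e e0 eP]] := df _ zin'.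
have gbnd w : w != z -> normc (w - z) < e -> normc (g w) <= normc A + 1.
  move=> wz we; have n0 : 0 < normc (w - z) by rewrite normc_gt0 subr_eq0.
  have -> : g w = (w - z)^-1 * (f w - f z) by rewrite /g mulrBr (mulrC (f z)).
  rewrite normc_mul normcV ler_pdivrMl//.
  have := eP _ we; rewrite (addrC z) subrK mul1r.
  have := normc_triangle (f w - f z - (w - z) * A) ((w - z) * A).
  rewrite subrK normc_mul mulrDr mulr1; lra.
have small t : 0 < t <= Num.min r (e / 3) -> normc (rint a b c d g) <= 4 * (normc A + 1) * (4 * t).
  rewrite le_min => /and3P[t0 tr te].
  have /rP[? ? ? ?] : 0 < t <= r by rewrite t0.
  rewrite (@rint_shrink _ _ _ _ t z)//.
  set x := complex.Re z; set y := complex.Im z.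
  rewrite (_ : 4 * t = (x + t - (x - t)) + (y + t - (y - t))); last by lra.
  have zt : interior_rect (x - t) (x + t) (y - t) (y + t) z.
    by split; apply/andP; split; rewrite /x /y; lra.
  apply: normc_rint_le; [lra|lra| |].
    apply: edge_derivable_integrable; [lra|lra|move=> w ew].
    apply: dg; last exact: interior_rect_edge ew.
    by move: ew => [[/andP[? ?] /andP[? ?]] _]; split; apply/andP; split; rewrite -?/x -?/y; lra.
  move=> w ew; apply: gbnd; first exact: interior_rect_edge ew.
  rewrite (le_lt_trans (normc_le_ReIm _))// Re_add Im_add Re_opp Im_opp -/x -/y.
  move: ew => [[/andP[? ?] /andP[? ?]] _].
  have : `|complex.Re w - x| <= t by rewrite ler_norml; apply/andP; split; lra.
  have : `|complex.Im w - y| <= t by rewrite ler_norml; apply/andP; split; lra.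
  lra.
rewrite -normc_eq0 -[_ == _]negbK; apply/negP => m0.
have {}m0 : 0 < normc (rint a b c d g) by rewrite lt_def m0 normc_ge0.
set m := normc _ in m0 small; have nA := normc_ge0 A.
pose t := Num.min (Num.min r (e / 3)) (m / (32 * (normc A + 1))).
have den : 0 < 32 * (normc A + 1) by lra.
have t0 : 0 < t by rewrite !lt_min r0 !divr_gt0//.
have := small t; rewrite t0 ge_min lexx => /(_ isT).
have : t <= m / (32 * (normc A + 1)) by rewrite ge_min lexx orbT.
rewrite ler_pdivlMr//; lra.
Qed.

End CauchyFormula.

Section CauchyEstimates.
Context {R : realType}.
Notation mu := (@lebesgue_measure R).
Implicit Types (a b c d : R) (f : R[i]^o -> R[i]^o) (z w p : R[i]^o).

Lemma normc_dist (x y : R[i]) : `|normc x - normc y| <= normc (x - y).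
Proof.
have := normc_triangle (x - y) y; have := normc_triangle (y - x) x.
rewrite !subrK (normc_subC y) => h1 h2.
by rewrite ler_norml; apply/andP; split; lra.
Qed.

Lemma continuous_integrable_sqr a b (u : R -> R) :
  (forall x, x \in `[a, b] -> forall e : R, 0 < e -> exists2 d : R, 0 < d &
    forall y, `|y - x| < d -> `|u y - u x| < e) ->
  mu.-integrable `[a, b] (EFin \o (fun x => u x ^+ 2)).
Proof.
move=> uc; apply: continuous_compact_integrable; first exact: segment_compact.
apply: continuous_in_subspaceT => x; rewrite inE => /uc ux.
have cu : {for x, continuous u}.
  apply/cvgrPdist_lt => e /ux[d d0 dP]; apply/nbhs_ballP; exists d => // y.
  by rewrite /ball/= distrC => /dP; rewrite distrC.
by rewrite (_ : (fun x => u x ^+ 2) = u \* u)//; exact: continuousM.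
Qed.

(* AM-GM [|F| <= (1 + |F|^2)/2] replaces the Cauchy-Schwarz inequality. *)
Lemma normc_Cint_mul_le a b (F K : R -> R[i]) (k B : R) : a <= b -> 0 <= k ->
  Cintegrable a b (fun x => K x * F x) ->
  (forall x, x \in `[a, b] -> forall e : R, 0 < e -> exists2 d : R, 0 < d &
    forall y, `|y - x| < d -> normc (F y - F x) < e) ->
  {in `[a, b], forall x, normc (K x) <= k} ->
  \int[mu]_(x in `[a, b]) (normc (F x) ^+ 2) <= B ->
  normc (Cint a b (fun x => K x * F x)) <= k * ((b - a) + B).
Proof.
move=> ab k0 iKF cF Kk FB.
have i2 : mu.-integrable `[a, b] (EFin \o (fun x => normc (F x) ^+ 2)).
  apply: continuous_integrable_sqr => x /cF cFx e /cFx[d d0 dP].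
  by exists d => // y /dP; apply: le_lt_trans; exact: normc_dist.
pose phi x : R := k / 2 + k / 2 * normc (F x) ^+ 2.
have i1 := integrable_itv_cst a b (k / 2).
have i3 : mu.-integrable `[a, b] (EFin \o (fun x => k / 2 * normc (F x) ^+ 2)).
  by apply: (eq_integrable _ _ _ _ (@integrableZl _ _ _ mu _ _ (k / 2) _ i2)).
have i4 : mu.-integrable `[a, b] (EFin \o phi).
  by apply: (eq_integrable _ _ _ _ (@integrableD _ _ _ mu _ _ _ _ i1 i3)).
rewrite (le_trans (normc_Cint_le iKF i4 _))//.
  move=> x xab; rewrite normc_mul /phi.
  have := Kk _ xab; have := normc_ge0 (K x); have := normc_ge0 (F x).
  move: (normc (F x)) (normc (K x)) => u v u0 v0 vk.
  have h : 2 * u <= 1 + u ^+ 2 by have := sqr_ge0 (u - 1); rewrite !expr2; lra.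
  have h2 : v * u <= k * u by rewrite ler_wpM2r.
  have h3 : k * (2 * u) <= k * (1 + u ^+ 2) by rewrite ler_wpM2l.
  move: h3; rewrite mulrDr mulr1 [k * (2 * u)]mulrCA; lra.
rewrite RintegralD// Rintegral_itv_cst// RintegralZl//.
have h : k * \int[mu]_(x in `[a, b]) (normc (F x) ^+ 2) <= k * B by rewrite ler_wpM2l.
rewrite mulrDr; lra.
Qed.

Definition edge_sqr_le a b c d f (B : R) :=
  [/\ \int[mu]_(x in `[a, b]) (normc (f (x +i* c)) ^+ 2) <= B,
      \int[mu]_(x in `[a, b]) (normc (f (x +i* d)) ^+ 2) <= B,
      \int[mu]_(y in `[c, d]) (normc (f (a +i* y)) ^+ 2) <= B &
      \int[mu]_(y in `[c, d]) (normc (f (b +i* y)) ^+ 2) <= B].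

Lemma normc_rint_mul_le a b c d f (K : R[i]^o -> R[i]^o) (k B : R) : a <= b -> c <= d ->
  0 <= k -> edge_derivable a b c d f -> edge_derivable a b c d K ->
  (forall w, edge a b c d w -> normc (K w) <= k) -> edge_sqr_le a b c d f B ->
  normc (rint a b c d (fun w => K w * f w)) <= k * (2 * ((b - a) + (d - c)) + 4 * B).
Proof.
move=> ab cd k0 df dK Kk [B1 B2 B3 B4].
have [i1 i2 i3 i4] : edge_integrable a b c d (fun w => K w * f w).
  apply: (edge_derivable_integrable ab cd) => w ew.
  exact: (derivable_mulc (dK _ ew) (df _ ew)).
have e1 x : x \in `[a, b] -> edge a b c d (x +i* c).
  by rewrite in_itv/= => xab; split; [split; rewrite //= lexx|constructor 1].
have e2 x : x \in `[a, b] -> edge a b c d (x +i* d).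
  by rewrite in_itv/= => xab; split; [split; rewrite //= lexx ?andbT|constructor 2].
have e3 x : x \in `[c, d] -> edge a b c d (a +i* x).
  by rewrite in_itv/= => xab; split; [split; rewrite //= lexx|constructor 3].
have e4 x : x \in `[c, d] -> edge a b c d (b +i* x).
  by rewrite in_itv/= => xab; split; [split; rewrite //= lexx ?andbT|constructor 4].
have h1 : normc (Cint a b (fun x => K (x +i* c) * f (x +i* c))) <= k * ((b - a) + B).
  apply: normc_Cint_mul_le => //; last by move=> x /e1 /Kk.
  by apply: horizontal_continuous => x /e1 /df.
have h2 : normc (Cint a b (fun x => K (x +i* d) * f (x +i* d))) <= k * ((b - a) + B).
  apply: normc_Cint_mul_le => //; last by move=> x /e2 /Kk.
  by apply: horizontal_continuous => x /e2 /df.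
have h3 : normc (Cint c d (fun x => K (a +i* x) * f (a +i* x))) <= k * ((d - c) + B).
  apply: normc_Cint_mul_le => //; last by move=> x /e3 /Kk.
  by apply: vertical_continuous => x /e3 /df.
have h4 : normc (Cint c d (fun x => K (b +i* x) * f (b +i* x))) <= k * ((d - c) + B).
  apply: normc_Cint_mul_le => //; last by move=> x /e4 /Kk.
  by apply: vertical_continuous => x /e4 /df.
rewrite /rint (le_trans (normc_triangle _ _))// normc_mul normci mul1r.
rewrite (le_trans (lerD (normc_sub _ _) (normc_sub _ _)))//.
rewrite (le_trans (lerD (lerD h1 h2) (lerD h4 h3)))//.
by rewrite -!mulrDr ler_wpM2l//; lra.
Qed.

Definition margin a b c d (r : R) z :=
  a + r <= complex.Re z <= b - r /\ c + r <= complex.Im z <= d - r.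

Lemma margin_interior a b c d r z : 0 < r -> margin a b c d r z -> interior_rect a b c d z.
Proof. by move=> r0 [/andP[? ?] /andP[? ?]]; split; apply/andP; split; lra. Qed.

Lemma margin_shift a b c d r s z h : margin a b c d r z -> normc h <= s ->
  margin a b c d (r - s) (z + h).
Proof.
move=> [/andP[? ?] /andP[? ?]] hs.
have := normr_Re_le h; have := normr_Im_le h; rewrite !ler_norml.
move=> /andP[? ?] /andP[? ?]; split; rewrite ?Re_add ?Im_add; apply/andP; split; lra.
Qed.

Lemma margin_dist a b c d r z w : margin a b c d r z -> edge a b c d w -> r <= normc (w - z).
Proof. by case=> h1 h2; exact: edge_dist. Qed.

Lemma normc_ge_Im4 (x : R[i]) : 4 <= complex.Im x -> 4 <= normc x.
Proof. by move=> h; rewrite (le_trans h)// (le_trans (ler_norm _))// normr_Im_le. Qed.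

Lemma cauchy_value_bound a b c d r z f B : 0 < r -> margin a b c d r z ->
  (forall w, inrect a b c d w -> derivable f w 1) -> edge_sqr_le a b c d f B ->
  4 * normc (f z) <= r^-1 * (2 * ((b - a) + (d - c)) + 4 * B).
Proof.
move=> r0 zr df fB; have zin := margin_interior r0 zr.
have [ab cd] := interior_rect_le zin.
apply: (@le_trans _ _ (normc (winding a b c d z * f z))).
  by rewrite normc_mul ler_wpM2r ?normc_ge0// normc_ge_Im4// winding_Im_ge.
rewrite -cauchy_formula//; apply: normc_rint_mul_le => //.
- by rewrite invr_ge0 ltW.
- by move=> w [win _]; exact: df.
- by move=> w ew; apply: derivable_inv_sub; exact: interior_rect_edge zin ew.
move=> w ew; have h := margin_dist zr ew.
by rewrite normcV lef_pV2 ?posrE// (lt_le_trans r0).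
Qed.

Lemma difference_quotient_identity (F : fieldType) (u h k y : F) :
  u != 0 -> u - h != 0 -> u - k != 0 -> h != 0 -> k != 0 ->
  (h - k) * (u^-1 * ((u - h)^-1 * (u - k)^-1)) * y =
  h^-1 * ((u - h)^-1 * y - u^-1 * y) - k^-1 * ((u - k)^-1 * y - u^-1 * y).
Proof. by move=> u0 uh uk h0 k0; field; rewrite u0 uh uk h0 k0. Qed.

Lemma cauchy_quotient_bound a b c d r z f B (h h' : R[i]) : 0 < r -> margin a b c d r z ->
  (forall w, inrect a b c d w -> derivable f w 1) -> edge_sqr_le a b c d f B ->
  h != 0 -> h' != 0 -> normc h <= r / 2 -> normc h' <= r / 2 ->
  4 * normc ((f (z + h) - f z) / h - (f (z + h') - f z) / h') <=
  normc (h - h') * (4 / r ^+ 3) * (2 * ((b - a) + (d - c)) + 4 * B).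
Proof.
move=> r0 zr df fB h0 h'0 hr h'r; have zin := margin_interior r0 zr.
have [ab cd] := interior_rect_le zin.
have r2 : 0 < r - r / 2 by lra.
have zhr := margin_shift zr hr; have zhin := margin_interior r2 zhr.
have zh'r := margin_shift zr h'r; have zh'in := margin_interior r2 zh'r.
pose I p := rint a b c d (fun w => (w - p)^-1 * f w).
have df' : edge_derivable a b c d f by move=> w [win _]; exact: df.
have dI p : interior_rect a b c d p -> edge_derivable a b c d (fun w => (w - p)^-1 * f w).
  move=> pin w ew; apply: derivable_mulc; last exact: df'.
  exact/derivable_inv_sub/(interior_rect_edge pin ew).
have iI p : interior_rect a b c d p -> edge_integrable a b c d (fun w => (w - p)^-1 * f w).
  by move=> /dI; exact: (edge_derivable_integrable ab cd).
have iB (u v : R[i]^o -> R[i]^o) : edge_integrable a b c d u -> edge_integrable a b c d v ->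
    edge_integrable a b c d (fun w => u w - v w).
  by move=> [? ? ? ?] [? ? ? ?]; split; exact: CintegrableB.
have iZ (k : R[i]) (u : R[i]^o -> R[i]^o) : edge_integrable a b c d u ->
    edge_integrable a b c d (fun w => k * u w).
  by move=> [? ? ? ?]; split; exact: CintegrableZ.
have IE p : interior_rect a b c d p -> I p = winding a b c d z * f p.
  by move=> pin; rewrite /I cauchy_formula// (winding_const zin pin).
pose K w : R[i]^o := (h - h') * ((w - z)^-1 * ((w - (z + h))^-1 * (w - (z + h'))^-1)).
have E : winding a b c d z * ((f (z + h) - f z) / h - (f (z + h') - f z) / h') =
    rint a b c d (fun w => K w * f w).
  transitivity (h^-1 * (I (z + h) - I z) - h'^-1 * (I (z + h') - I z)).
    by rewrite !IE//; ring.
  rewrite /I -(rintB (iI _ zhin) (iI _ zin)) -(rintB (iI _ zh'in) (iI _ zin)).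
  have j1 := iB _ _ (iI _ zhin) (iI _ zin); have j2 := iB _ _ (iI _ zh'in) (iI _ zin).
  rewrite -(rintZ _ j1) -(rintZ _ j2) -(rintB (iZ _ _ j1) (iZ _ _ j2)).
  apply: eq_rint => // w ew; rewrite /K.
  have nz p : interior_rect a b c d p -> w - p != 0.
    by move=> pin; rewrite subr_eq0 (interior_rect_edge pin ew).
  have := nz _ zin; have := nz _ zhin; have := nz _ zh'in.
  rewrite !opprD !addrA => n1 n2 n3.
  by rewrite (@difference_quotient_identity R[i] (w - z) h h' (f w) n3 n2 n1 h0 h'0).
apply: (@le_trans _ _ (normc (winding a b c d z *
  ((f (z + h) - f z) / h - (f (z + h') - f z) / h')))).
  by rewrite [leRHS]normc_mul ler_wpM2r ?normc_ge0// normc_ge_Im4// winding_Im_ge.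
rewrite E; apply: (@normc_rint_mul_le _ _ _ _ f K _ B ab cd _ df' _ _ fB).
- apply: mulr_ge0; first exact: normc_ge0.
  by apply: divr_ge0 => //; apply: exprn_ge0; exact: ltW.
- move=> w ew; apply: derivable_mulc; first exact: derivable_cstc.
  apply: derivable_mulc; first exact/derivable_inv_sub/(interior_rect_edge zin ew).
  apply: derivable_mulc; first exact/derivable_inv_sub/(interior_rect_edge zhin ew).
  exact/derivable_inv_sub/(interior_rect_edge zh'in ew).
move=> w ew; rewrite /K normc_mul ler_wpM2l ?normc_ge0// !normc_mul !normcV.
have k1 := margin_dist zr ew; have k2 := margin_dist zhr ew; have k3 := margin_dist zh'r ew.
have -> : 4 / r ^+ 3 = r^-1 * ((r - r / 2)^-1 * (r - r / 2)^-1).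
  by field; rewrite gt_eqF//=; lra.
have inv (x y : R) : 0 < x -> x <= y -> 0 <= y^-1 <= x^-1.
  move=> x0 xy; have y0 : 0 < y by exact: lt_le_trans xy.
  by rewrite invr_ge0 (ltW y0)/= lef_pV2.
have /andP[? ?] := inv _ _ r0 k1; have /andP[? ?] := inv _ _ r2 k2.
have /andP[? ?] := inv _ _ r2 k3.
by apply: ler_pM => //; [exact: mulr_ge0|exact: ler_pM].
Qed.

Lemma exists_le_of_integral_le1 (A : R -> \bar R) a b : a < b ->
  measurable_fun setT A -> (forall x, (0 <= A x)%E) -> (\int[mu]_x A x <= 1)%E ->
  exists2 x, a < x < b & (A x <= (2 / (b - a))%:E)%E.
Proof.
move=> ab mA A0 A1; apply: contrapT => nex.
have {}nex x : a < x < b -> ((2 / (b - a))%:E <= A x)%E.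
  move=> xab; rewrite leNgt; apply/negP => h; apply: nex; exists x => //.
  exact: ltW.
have : (\int[mu]_(x in `]a, b[) A x <= 1)%E.
  by apply: le_trans A1; apply: ge0_subset_integral.
apply/negP; rewrite -ltNge.
have E : (\int[mu]_(x in `]a, b[) (2 / (b - a))%:E = 2%:E)%E.
  rewrite (@integral_cst _ _ _ mu)// [X in (_ * X)%E](_ : _ = (b - a)%:E).
    by rewrite -EFinM divfK// gt_eqF// subr_gt0.
  have M : @lebesgue_measure R `]a, b[%classic = (b - a)%:E.
    by rewrite lebesgue_measure_itv/= lte_fin ab.
  exact: M.
apply: (@lt_le_trans _ _ 2%:E); first by rewrite lte_fin; lra.
rewrite -E; apply: ge0_le_integral => //.
- by move=> x _; rewrite lee_fin divr_ge0//; lra.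
exact: measurable_funS mA.
Qed.

End CauchyEstimates.

(** * The Bergman space as a Hilbert space *)

Section BergmanLocal.
Context {R : realType}.
Notation mu := (@lebesgue_measure R).
Implicit Types (G : set R[i]) (f : R[i] -> R[i]^o).

Definition copen G := forall z, G z -> exists2 d : R, 0 < d & forall w, normc (w - z) < d -> G w.

Lemma fine_le_of_le (x : \bar R) (B : R) : (0 <= x)%E -> (x <= B%:E)%E -> fine x <= B.
Proof. by case: x => [x| |]//=; rewrite lee_fin. Qed.

Let measurable_sqr G f : bergman_fun G f ->
  measurable_fun setT (fun p => (modulus f p ^+ 2)%:E).
Proof.
move=> [Gf f0 _]; apply/measurable_EFinP; apply: measurable_funX.
exact: measurable_modulus Gf f0.
Qed.

Let sqr_pos f (p : measurableTypeR R * measurableTypeR R) : (0 <= (modulus f p ^+ 2)%:E)%E.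
Proof. by rewrite lee_fin sqr_ge0. Qed.

Lemma exists_vertical_side G f a b : bergman_fun G f -> (int_sqr G f <= 1)%E -> a < b ->
  exists2 x, a < x < b & forall c d,
    \int[mu]_(y in `[c, d]) (normc (f (x +i* y)) ^+ 2) <= 2 / (b - a).
Proof.
move=> Bf f1 ab; have mS := measurable_sqr Bf; have [_ f0 _] := Bf.
pose S p := (modulus f p ^+ 2)%:E.
have mA := @measurable_fun_fubini_tonelli_F _ _ _ _ _ mu S mS (sqr_pos f).
have [||x xab Ax] := exists_le_of_integral_le1 ab mA.
- by move=> x; apply: integral_ge0 => y _; rewrite lee_fin sqr_ge0.
- by rewrite -(@fubini_tonelli1 _ _ _ _ _ mu mu S mS (sqr_pos f)) -(int_sqrE f0).
exists x => // c d; apply: fine_le_of_le.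
  by apply: integral_ge0 => y _; rewrite lee_fin sqr_ge0.
apply: le_trans Ax; apply: (@ge0_subset_integral _ _ _ mu) => //.
  exact: (measurableT_comp mS (pair1_measurable _)).
by move=> y _; rewrite lee_fin sqr_ge0.
Qed.

Lemma exists_horizontal_side G f a b : bergman_fun G f -> (int_sqr G f <= 1)%E -> a < b ->
  exists2 y, a < y < b & forall c d,
    \int[mu]_(x in `[c, d]) (normc (f (x +i* y)) ^+ 2) <= 2 / (b - a).
Proof.
move=> Bf f1 ab; have mS := measurable_sqr Bf; have [_ f0 _] := Bf.
pose S p := (modulus f p ^+ 2)%:E.
have mA := @measurable_fun_fubini_tonelli_G _ _ _ _ _ mu S mS (sqr_pos f).
have [||x xab Ax] := exists_le_of_integral_le1 ab mA.
- by move=> x; apply: integral_ge0 => y _; rewrite lee_fin sqr_ge0.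
- by rewrite -(@fubini_tonelli2 _ _ _ _ _ mu mu S mS (sqr_pos f)) -(int_sqrE f0).
exists x => // c d; apply: fine_le_of_le.
  by apply: integral_ge0 => y _; rewrite lee_fin sqr_ge0.
apply: le_trans Ax; apply: (@ge0_subset_integral _ _ _ mu) => //.
  exact: (measurableT_comp mS (pair2_measurable _)).
by move=> y _; rewrite lee_fin sqr_ge0.
Qed.

Lemma bergman_unit_ball_bound G z : copen G -> G z ->
  exists C r : R, [/\ 0 <= C, 0 < r &
  forall f, bergman_fun G f -> (int_sqr G f <= 1)%E ->
    normc (f z) <= C /\
    forall h h' : R[i], h != 0 -> h' != 0 -> normc h <= r -> normc h' <= r ->
      normc ((f (z + h) - f z) / h - (f (z + h') - f z) / h') <= C * normc (h - h')].
Proof.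
move=> oG /oG[d d0 dG].
have near_half (u v e : R) : u - e < v < u + e -> `|v - u| <= e.
  by move=> /andP[? ?]; rewrite ler_norml; apply/andP; split; lra.
have corner (u v e : R) : u <= e / 3 -> v <= e / 3 -> 0 < e -> u + v < e by lra.
pose s := d / 3; have s0 : 0 < s by rewrite /s; lra.
pose r := s / 2; have r0 : 0 < r by rewrite /r; lra.
pose B := 2 / r; have B0 : 0 < B by rewrite divr_gt0.
pose M := 8 * s + 4 * B; have M0 : 0 < M by rewrite /M; lra.
pose C1 := r^-1 * M; pose C2 := 4 / r ^+ 3 * M.
have C10 : 0 < C1 by rewrite mulr_gt0// invr_gt0.
have C20 : 0 < C2 by rewrite mulr_gt0// divr_gt0// exprn_gt0.
exists (C1 + C2), (r / 2); split; [lra|lra|move=> f Bf f1].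
set x := complex.Re z; set y := complex.Im z.
have side (u : R) : u - s < u - r /\ u + r < u + s by rewrite /r; lra.
have len (u : R) : 2 / (u - r - (u - s)) = B /\ 2 / (u + s - (u + r)) = B.
  by split; congr (_ / _); rewrite /r; lra.
have [x1 /andP[x1l ?] h1] := exists_vertical_side Bf f1 (side x).1.
have [x2 /andP[? x2r] h2] := exists_vertical_side Bf f1 (side x).2.
have [y1 /andP[y1l ?] h3] := exists_horizontal_side Bf f1 (side y).1.
have [y2 /andP[? y2r] h4] := exists_horizontal_side Bf f1 (side y).2.
have fB : edge_sqr_le x1 x2 y1 y2 f B.
  have [e1 e2] := len x; have [e3 e4] := len y.
  by split; [rewrite -e3|rewrite -e4|rewrite -e1|rewrite -e2].
have zr : margin x1 x2 y1 y2 r z.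
  by split; apply/andP; split; rewrite -/x -/y; lra.
have df w : inrect x1 x2 y1 y2 w -> derivable (f : R[i]^o -> R[i]^o) w 1.
  move=> [/andP[? ?] /andP[? ?]]; have [Gf _ _] := Bf; apply: Gf; apply: dG.
  rewrite (le_lt_trans (normc_le_ReIm _))// Re_add Im_add Re_opp Im_opp -/x -/y.
  apply: corner => //; apply: near_half; apply/andP; split.
  - exact: lt_le_trans x1l _.
  - exact: le_lt_trans x2r.
  - exact: lt_le_trans y1l _.
  - exact: le_lt_trans y2r.
have WM : 2 * ((x2 - x1) + (y2 - y1)) + 4 * B <= M by rewrite /M; lra.
split.
  have := cauchy_value_bound r0 zr df fB; have := normc_ge0 (f z).
  have : r^-1 * (2 * (x2 - x1 + (y2 - y1)) + 4 * B) <= C1.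
    by rewrite ler_wpM2l// invr_ge0 ltW.
  lra.
move=> h h' h0 h'0 hr hr'; have := cauchy_quotient_bound r0 zr df fB h0 h'0 hr hr'.
set q := normc _; have q0 : 0 <= q by exact: normc_ge0.
have n0 := normc_ge0 (h - h').
have : normc (h - h') * (4 / r ^+ 3) * (2 * (x2 - x1 + (y2 - y1)) + 4 * B) <=
    C2 * normc (h - h').
  by rewrite -mulrA [leRHS]mulrC ler_wpM2l// ler_wpM2l// divr_ge0// exprn_ge0// ltW.
have : 0 <= C1 * normc (h - h') by rewrite mulr_ge0// ltW.
rewrite mulrDl; lra.
Qed.

End BergmanLocal.

Section ComplexLimits.
Context {R : realType}.
Implicit Types (v : nat -> R[i]^o) (L : R[i]^o).

Lemma cvg_normcP v L : v @ \oo --> L <->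
  forall e : R, 0 < e -> exists N, forall n, (N <= n)%N -> normc (v n - L) < e.
Proof.
split=> [vL e e0|vL].
  have : 0 < e%:C :> R[i] by rewrite ltcR.
  move/cvgrPdist_lt : vL => /[apply] -[N _ NP]; exists N => n /NP /=.
  by rewrite normc_norm ltcR normc_subC.
apply/cvgrPdist_lt => e; rewrite ltcE/= => /andP[/eqP e'0 /vL[N NP]].
exists N => // n /NP /=; rewrite normc_norm normc_subC => h.
by rewrite ltcE/= e'0 eqxx.
Qed.

Lemma normc_lim_le v L (B : R) : v @ \oo --> L ->
  (forall n, normc (v n) <= B) -> normc L <= B.
Proof.
move=> /cvg_normcP vL vB; apply/ler_addgt0Pr => e /vL[N /(_ N (leqnn N)) h].
have := normc_triangle (v N - L) L; rewrite subrK => _.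
have := normc_triangle (v N) (- (v N - L)); rewrite normc_opp opprB addrC subrK.
by have := vB N; lra.
Qed.

Lemma real_cauchy_cvg (u : nat -> R) :
  (forall e : R, 0 < e -> exists N, forall n, (N <= n)%N -> `|u n - u N| < e) ->
  exists l, forall e : R, 0 < e -> exists N, forall n, (N <= n)%N -> `|u n - l| < e.
Proof.
move=> uC; have : cvg (u @ \oo).
  apply/cauchy_cvgP/cauchy_exP => e /uC[N NP]; exists (u N), N => // n /NP.
  by rewrite /ball/= distrC.
move=> /cvg_ex[l /cvgrPdist_lt ul]; exists l => e /ul[N _ NP]; exists N => n /NP /=.
by rewrite distrC.
Qed.

Lemma complex_cauchy_cvg v :
  (forall e : R, 0 < e -> exists N, forall n, (N <= n)%N -> normc (v n - v N) < e) ->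
  exists L : R[i]^o, v @ \oo --> L.
Proof.
move=> vC.
have [a aP] : exists a, forall e : R, 0 < e ->
    exists N, forall n, (N <= n)%N -> `|complex.Re (v n) - a| < e.
  apply: real_cauchy_cvg => e /vC[N NP]; exists N => n /NP; apply: le_lt_trans.
  by rewrite -Re_opp -Re_add normr_Re_le.
have [b bP] : exists a, forall e : R, 0 < e ->
    exists N, forall n, (N <= n)%N -> `|complex.Im (v n) - a| < e.
  apply: real_cauchy_cvg => e /vC[N NP]; exists N => n /NP; apply: le_lt_trans.
  by rewrite -Im_opp -Im_add normr_Im_le.
exists (a +i* b); apply/cvg_normcP => e e0; have e2 : 0 < e / 2 by rewrite divr_gt0.
have [N NP] := aP _ e2; have [M MP] := bP _ e2.
exists (maxn N M) => n; rewrite geq_max => /andP[/NP h1 /MP h2].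
rewrite (le_lt_trans (normc_le_ReIm _))// Re_add Im_add Re_opp Im_opp /=; lra.
Qed.

Lemma derivable_of_quotient_bound (F : R[i]^o -> R[i]^o) (z : R[i]^o) (C r : R) : 0 <= C -> 0 < r ->
  (forall h h' : R[i], h != 0 -> h' != 0 -> normc h <= r -> normc h' <= r ->
     normc ((F (z + h) - F z) / h - (F (z + h') - F z) / h') <= C * normc (h - h')) ->
  derivable F z 1.
Proof.
move=> C0 r0 FC; pose q (h : R[i]) : R[i] := (F (z + h) - F z) / h.
pose hs n : R[i] := (r / n.+1%:R)%:C.
have nhs n : normc (hs n) = r / n.+1%:R by rewrite normc_real ger0_norm// divr_ge0// ltW.
have hs0 n : hs n != 0 by rewrite -normc_gt0 nhs divr_gt0.
have hsr n : normc (hs n) <= r by rewrite nhs ler_pdivrMr// ler_peMr ?ler1n// ltW.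
have small (e : R) : 0 < e -> exists N, forall n, (N <= n)%N -> normc (hs n) < e.
  move=> e0; exists (Num.bound (r / e)) => n nN; rewrite nhs ltr_pdivrMr//.
  rewrite mulrC -ltr_pdivrMr// (lt_le_trans (archi_boundP _))//.
    by rewrite divr_ge0// ltW.
  by rewrite ler_nat (leq_trans nN).
have [A qA] : exists A : R[i]^o, (fun n => q (hs n) : R[i]^o) @ \oo --> A.
  apply: complex_cauchy_cvg => e e0.
  have den : 0 < 2 * C + 1 by lra.
  pose d := e / (2 * C + 1); have d0 : 0 < d by rewrite divr_gt0.
  have dE : e = C * (2 * d) + d by rewrite -[LHS](divfK (lt0r_neq0 den)) -/d; ring.
  have [N NP] := small _ d0; exists N => n nN.
  have := FC _ _ (hs0 n) (hs0 N) (hsr n) (hsr N); rewrite -/(q _) -/(q _).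
  move=> /le_lt_trans; apply; have h1 := NP _ nN; have h2 := NP _ (leqnn N).
  have h3 := normc_sub (hs n) (hs N).
  have : C * normc (hs n - hs N) <= C * (2 * d) by rewrite ler_wpM2l//; lra.
  by rewrite dE; lra.
apply/derivable_normcP; exists A => e e0.
exists (Num.min r (e / (C + 1))); first by rewrite lt_min r0 divr_gt0// ltr_wpDl.
move=> h; rewrite lt_min => /andP[hr he].
have [->|h0] := eqVneq h 0; first by rewrite addr0 subrr mul0r subr0 normc0 mulr0.
have hA : normc (q h - A) <= C * normc h.
  apply/ler_addgt0Pr => d d0; have den : 0 < 2 * (C + 1) by lra.
  pose t := d / (2 * (C + 1)); have d2 : 0 < t by rewrite divr_gt0.
  have dE : d = 2 * (C * t) + 2 * t by rewrite -[LHS](divfK (lt0r_neq0 den)) -/t; ring.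
  have d3 : 0 < d / 2 by rewrite divr_gt0.
  have [N NP] := small _ d2; have [M MP] := (cvg_normcP _ _).1 qA _ d3.
  have h1 := NP _ (leq_maxl N M); have h2 := MP _ (leq_maxr N M).
  set n := maxn N M in h1 h2.
  have := FC _ _ h0 (hs0 n) (ltW hr) (hsr n); rewrite -/(q _) -/(q _) => h3.
  have h4 : C * normc (h - hs n) <= C * normc h + C * t.
    by rewrite -mulrDr ler_wpM2l// (le_trans (normc_sub _ _))//; lra.
  have := normc_triangle (q h - q (hs n)) (q (hs n) - A); rewrite addrA subrK; lra.
have -> : F (z + h) - F z - h * A = h * (q h - A).
  by rewrite mulrBr /q mulrCA divff// mulr1.
rewrite normc_mul mulrC ler_wpM2r ?normc_ge0// (le_trans hA)//.
have den : 0 < C + 1 by lra.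
rewrite ltr_pdivlMr// in he.
have := normc_ge0 h; lra.
Qed.

End ComplexLimits.
Section BergmanNorm.
Context {R : realType} {G : set R[i]}.
Implicit Types (f g : bergman G) (z : R[i]).

Definition mkbergman (f : R[i] -> R[i]^o) (Bf : bergman_fun G f) : bergman G :=
  @Bergman R G f (asboolT Bf).

Definition bnorm f : R := Num.sqrt (fine (int_sqr G f)).

Lemma bnormE f : `|f| = (bnorm f)%:C. Proof. by []. Qed.

Lemma bnorm_ge0 f : 0 <= bnorm f. Proof. exact: sqrtr_ge0. Qed.

Lemma bnorm_sqr f : (bnorm f ^+ 2)%:E = int_sqr G f.
Proof.
rewrite /bnorm sqr_sqrtr ?fine_ge0 ?int_sqr_ge0// fineK// ge0_fin_numE ?int_sqr_ge0//.
by have [] := bergmanP f.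
Qed.

Lemma bnormD f g : bnorm (f + g) <= bnorm f + bnorm g.
Proof. by have := ler_normD f g; rewrite !bnormE -rmorphD/= lecR. Qed.

Lemma bnormZ (a : R[i]) f : bnorm (a *: f) = normc a * bnorm f.
Proof. by have := normrZ a f; rewrite !bnormE normc_norm -rmorphM/= => /complexI. Qed.

Lemma bnormN f : bnorm (- f) = bnorm f.
Proof. by rewrite -scaleN1r bnormZ normc_opp normc1 mul1r. Qed.

Lemma bnorm_subC f g : bnorm (f - g) = bnorm (g - f).
Proof. by rewrite -bnormN opprB. Qed.

Lemma bnorm0 : bnorm 0 = 0.
Proof. by rewrite -(scale0r 0) bnormZ normc0 mul0r. Qed.

Lemma bnorm_eq0 f : bnorm f = 0 -> f = 0.
Proof. by move=> f0; apply/eqP; rewrite -normr_eq0 bnormE f0. Qed.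

Lemma bnorm_gt0 f : f != 0 -> 0 < bnorm f.
Proof.
move=> f0; rewrite lt_def bnorm_ge0 andbT; apply: contra_neq f0; exact: bnorm_eq0.
Qed.

Lemma bnorm_sum (I : Type) (r : seq I) (F : I -> bergman G) :
  bnorm (\sum_(i <- r) F i) <= \sum_(i <- r) bnorm (F i).
Proof.
elim: r => [|i r IH]; first by rewrite !big_nil bnorm0.
by rewrite !big_cons (le_trans (bnormD _ _))// lerD2l.
Qed.

Lemma bergman_addE f g z : (f + g) z = f z + g z. Proof. by []. Qed.
Lemma bergman_subE f g z : (f - g) z = f z - g z. Proof. by []. Qed.
Lemma bergman_scaleE (a : R[i]) f z : (a *: f) z = a * f z. Proof. by []. Qed.
Lemma bergman_zeroE z : (0 : bergman G) z = 0. Proof. by []. Qed.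

Lemma bergman_out f z : ~ G z -> f z = 0.
Proof. by have [_ + _] := bergmanP f; exact. Qed.

Lemma bergman_ext f g : (forall z, f z = g z) -> f = g.
Proof. by move=> fg; apply: val_inj; apply/funext. Qed.

Lemma bergman_analytic f z : G z -> derivable (f : R[i]^o -> R[i]^o) z 1.
Proof. by have [+ _ _] := bergmanP f; exact. Qed.

Hypothesis oG : copen G.

Lemma bergman_local_bound z : G z ->
  exists C r : R, [/\ 0 <= C, 0 < r & forall f,
    normc (f z) <= C * bnorm f /\
    forall h h' : R[i], h != 0 -> h' != 0 -> normc h <= r -> normc h' <= r ->
      normc ((f (z + h) - f z) / h - (f (z + h') - f z) / h') <=
        C * bnorm f * normc (h - h')].
Proof.
move=> Gz; have [C [r [C0 r0 H]]] := bergman_unit_ball_bound oG Gz.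
exists C, r; split=> // f; have [->|f0] := eqVneq f 0.
  rewrite bnorm0 mulr0 !bergman_zeroE normc0; split=> // h h' _ _ _ _.
  by rewrite !bergman_zeroE !subrr !mul0r subrr normc0.
have n0 := bnorm_gt0 f0; pose g := ((bnorm f)^-1)%:C *: f.
have g1 : (int_sqr G g <= 1)%E.
  rewrite -bnorm_sqr bnormZ normc_real ger0_norm ?invr_ge0 ?bnorm_ge0// mulVf ?expr1n//.
  by rewrite gt_eqF.
have fE w : f w = (bnorm f)%:C * g w.
  by rewrite bergman_scaleE mulrA -rmorphM/= divff ?mul1r// gt_eqF.
have [gz gq] := H _ (bergmanP g) g1.
have nb : normc (bnorm f)%:C = bnorm f by rewrite normc_real ger0_norm// bnorm_ge0.
split; first by rewrite fE normc_mul nb mulrC ler_wpM2r// bnorm_ge0.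
move=> h h' h0 h'0 hr h'r; clearbody g.
have -> : (f (z + h) - f z) / h - (f (z + h') - f z) / h' =
    (bnorm f)%:C * ((g (z + h) - g z) / h - (g (z + h') - g z) / h').
  by rewrite !fE; ring.
rewrite normc_mul nb mulrAC [leRHS]mulrC ler_wpM2l ?bnorm_ge0//.
exact: gq.
Qed.

Lemma bergman_eval_bound z : exists2 C : R, 0 <= C & forall f, normc (f z) <= C * bnorm f.
Proof.
have [/bergman_local_bound[C [r [C0 _ H]]]|nGz] := pselect (G z).
  by exists C => // f; case: (H f).
by exists 0 => // f; rewrite bergman_out// normc0 mul0r.
Qed.

Lemma limn_einf_le (v : nat -> \bar R) (B : \bar R) :
  (forall n, (v n <= B)%E) -> (limn_einf v <= B)%E.
Proof.
move=> vB; rewrite limn_einf_lim; apply: lime_le; first exact: is_cvg_einfs.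
near=> n; apply: le_trans (vB n); apply: ereal_inf_lbound.
by exists n => //=.
Unshelve. all: by end_near. Qed.

Theorem bergman_complete (u : nat -> bergman G) :
  (forall e : R, 0 < e -> exists N, forall m n, (N <= m)%N -> (N <= n)%N ->
    bnorm (u m - u n) < e) ->
  exists l, forall e : R, 0 < e -> exists N, forall n, (N <= n)%N -> bnorm (u n - l) <= e.
Proof.
move=> uC.
have /choice[F FP] (z : R[i]) : exists L : R[i]^o, (fun n => u n z : R[i]^o) @ \oo --> L.
  have [C C0 CP] := bergman_eval_bound z.
  apply: complex_cauchy_cvg => e e0.
  have d0 : 0 < e / (C + 1) by rewrite divr_gt0// ltr_wpDl.
  have [N NP] := uC _ d0; exists N => n nN.
  rewrite -bergman_subE (le_lt_trans (CP _))//.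
  have := NP _ _ nN (leqnn N); rewrite ltr_pdivlMr ?ltr_wpDl//.
  have := bnorm_ge0 (u n - u N); lra.
have F0 z : ~ G z -> F z = 0.
  move=> nGz; have := FP z; rewrite (_ : (fun n => u n z) = cst 0).
    by move=> /cvg_lim <-//; exact: lim_cst.
  by apply/funext => n; rewrite bergman_out.
have [B B0 uB] : exists2 B : R, 0 <= B & forall n, bnorm (u n) <= B.
  have [N NP] := uC _ ltr01.
  exists (\sum_(i < N) bnorm (u i) + (bnorm (u N) + 1)).
    by rewrite addr_ge0 ?sumr_ge0// ?addr_ge0 ?bnorm_ge0// => i _; exact: bnorm_ge0.
  move=> n; have [nN|Nn] := ltnP n N.
    rewrite (bigD1 (Ordinal nN))//= -addrA lerDl addr_ge0 ?sumr_ge0//.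
      by move=> i _; exact: bnorm_ge0.
    by rewrite addr_ge0 ?bnorm_ge0.
  have := NP _ _ Nn (leqnn N); have := bnormD (u n - u N) (u N); rewrite subrK.
  have : 0 <= \sum_(i < N) bnorm (u i) by rewrite sumr_ge0// => i _; exact: bnorm_ge0.
  lra.
have dF z : G z -> derivable (F : R[i]^o -> R[i]^o) z 1.
  move=> /bergman_local_bound[C [r [C0 r0 H]]].
  apply: (@derivable_of_quotient_bound _ _ _ (C * B) r) => //; first exact: mulr_ge0.
  move=> h h' h0 h'0 hr h'r; have q (k : R[i]) :
      (fun n => (u n (z + k) - u n z) / k : R[i]^o) @ \oo --> ((F (z + k) - F z) / k : R[i]^o).
    by apply: cvgMl; apply: cvgB.
  apply: normc_lim_le (cvgB (q h) (q h')) _ => n.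
  have [_ /(_ h h' h0 h'0 hr h'r) hn] := H (u n).
  by rewrite (le_trans hn)// ler_wpM2r ?normc_ge0// ler_wpM2l.
pose D m : R[i] -> R[i]^o := F - (u m : R[i] -> R[i]^o).
have key m (e : R) N : 0 <= e -> (forall n, (N <= n)%N -> bnorm (u n - u m) <= e) ->
    bergman_fun G (D m) /\ (int_sqr G (D m) <= (e ^+ 2)%:E)%E.
  move=> e0 H; have out z : ~ G z -> D m z = 0.
    by move=> nGz; rewrite /D !fctE F0// bergman_out// subr0.
  have le2 : (int_sqr G (D m) <= (e ^+ 2)%:E)%E.
    rewrite int_sqrE//.
    pose f n p := (modulus (u (n + N)%N - u m) p ^+ 2)%:E.
    have mf n : measurable_fun setT (f n).
      apply/measurable_EFinP; apply: measurable_funX.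
      by have [Gf f0 _] := bergmanP (u (n + N)%N - u m); exact: measurable_modulus Gf f0.
    have f0 n p : setT p -> (0 <= f n p)%E by move=> _; rewrite lee_fin sqr_ge0.
    have := @fatou _ _ _ (@area R) setT measurableT f mf f0.
    set I := (X in (X <= _)%E -> _) => h.
    have -> : (\int[area]_p (modulus (D m) p ^+ 2)%:E)%E = I.
      apply: eq_integral => p _; apply/esym.
      have hc : (fun n => modulus (u (n + N)%N - u m) p) @ \oo --> modulus (D m) p.
        apply/cvgrPdist_lt => d d0.
        have /cvg_normcP/(_ d d0)[M MP] := FP (Defs.cpoint p).
        exists M => // n /= Mn; rewrite /modulus distrC (le_lt_trans (normc_dist _ _))//.
        set q := Defs.cpoint p.
        have -> : (u (n + N)%N - u m) q - D m q = u (n + N)%N q - u m q - (F q - u m q) by [].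
        rewrite opprB addrA subrK; apply: MP.
        exact: leq_trans Mn (leq_addr _ _).
      have : (f ^~ p) @ \oo --> (modulus (D m) p ^+ 2)%:E.
        apply: cvg_EFin; first by near=> n.
        exact: (cvgM hc hc).
      by move=> /cvg_limn_einf_sup[-> _].
    apply: le_trans h _; apply: limn_einf_le => n.
    have [_ o _] := bergmanP (u (n + N)%N - u m).
    rewrite -(int_sqrE o) -bnorm_sqr lee_fin lerXn2r ?nnegrE ?bnorm_ge0//.
    by apply: H; rewrite leq_addl.
  split; last exact: le2.
  split; [move=> z Gz|exact: out|exact: (le_lt_trans le2 (ltry _))].
  exact: (derivable_subc (dF z Gz) (bergman_analytic (f := u m) Gz)).
have [N0 N0P] := uC _ ltr01.
have BF0 : bergman_fun G (D N0).
  apply: (key N0 1 N0 ler01 _).1 => n nN; apply: ltW; exact: N0P.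
have BF : bergman_fun G F.
  pose f0 : bergman G := mkbergman BF0.
  have -> : F = bergman_val (f0 + u N0).
    apply/funext => z; rewrite bergman_addE.
    have -> : f0 z = F z - u N0 z by [].
    by rewrite subrK.
  exact: bergmanP.
exists (mkbergman BF) => e e0; have [N NP] := uC _ e0.
exists N => m mN; rewrite bnorm_subC.
have [|_ le2] := key m e N (ltW e0); first by move=> n nN; apply/ltW/NP.
by rewrite -(@ler_pXn2r _ 2)// ?nnegrE ?bnorm_ge0 ?(ltW e0)// -lee_fin bnorm_sqr.
Unshelve. all: by end_near. Qed.

End BergmanNorm.

Section ComplexConjugate.
Context {R : realType}.
Implicit Types x y : R[i].

Lemma conj_add x y : conjc (x + y) = conjc x + conjc y.
Proof. by case: x y => [a b] [c d] /=; rewrite opprD. Qed.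
Lemma conj_mul x y : conjc (x * y) = conjc x * conjc y.
Proof. by case: x y => [a b] [c d] /=; apply: eq_complexP => /=; ring. Qed.
Lemma conj_opp x : conjc (- x) = - conjc x. Proof. by case: x. Qed.
Lemma conj_zero : conjc (0 : R[i]) = 0. Proof. by rewrite /= oppr0. Qed.
Lemma conj_one : conjc (1 : R[i]) = 1. Proof. by rewrite /= oppr0. Qed.
Lemma conj_conj x : conjc (conjc x) = x.
Proof. by case: x => a b /=; rewrite opprK. Qed.
Lemma conj_real (k : R) : conjc k%:C = k%:C.
Proof. by rewrite /= oppr0. Qed.
Lemma normc_conjc x : normc (conjc x) = normc x.
Proof. by case: x => a b /=; rewrite sqrrN. Qed.

End ComplexConjugate.

Section BergmanDot.
Context {R : realType} {G : set R[i]}.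
Implicit Types (f g h : bergman G) (a : R[i]).
Local Notation plane := (measurableTypeR R * measurableTypeR R)%type.

Definition Redot f g (p : plane) : R :=
  complex.Re (f (Defs.cpoint p) * (g (Defs.cpoint p))^*).

Let Imdot f g (p : plane) :
  complex.Im (f (Defs.cpoint p) * (g (Defs.cpoint p))^*) = Redot (- 'i *: f) g p.
Proof.
rewrite /Redot bergman_scaleE; case: (f _) => x y; case: (g _) => s t /=.
by rewrite oppr0 !mulN1r !mul0r; ring.
Qed.

Lemma integrable_sqr_modulus f : area.-integrable setT (fun p => (modulus f p ^+ 2)%:E).
Proof.
have [Gf f0 fi] := bergmanP f; apply/integrableP; split.
  apply/measurable_EFinP; apply: measurable_funX; exact: measurable_modulus Gf f0.
rewrite (int_sqrE f0) in fi; apply: le_lt_trans fi; rewrite le_eqVlt; apply/orP; left.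
by apply/eqP/eq_integral => p _; rewrite gee0_abs// lee_fin sqr_ge0.
Qed.

Lemma Redot_polarization f g p :
  Redot f g p = 4^-1 * (modulus (f + g) p ^+ 2 - modulus (f - g) p ^+ 2).
Proof.
rewrite /Redot /modulus bergman_addE bergman_subE !sqr_normc.
by case: (f _) => x y; case: (g _) => s t /=; field.
Qed.

Lemma integrable_Redot f g : area.-integrable setT (EFin \o Redot f g).
Proof.
have i1 := integrable_sqr_modulus (f + g); have i2 := integrable_sqr_modulus (f - g).
apply: (eq_integrable _ _ _ _ (@integrableZl _ _ _ area _ _ 4^-1 _
  (@integrableB _ _ _ area _ _ _ _ i1 i2))) => // p _.
by rewrite /= Redot_polarization EFinM.
Qed.

Definition rdot f g : R := \int[area]_p Redot f g p.

Lemma bergman_dotE f g : bergman_dot f g = rdot f g +i* rdot (- 'i *: f) g.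
Proof.
have out (u : R[i] -> R) p : u 0 = 0 ->
    ((fun p => u (f (Defs.cpoint p) * (g (Defs.cpoint p))^*)) \_ (Defs.cpoint @^-1` G)) p =
    u (f (Defs.cpoint p) * (g (Defs.cpoint p))^*).
  move=> u0; rewrite patchE; case: ifPn => // /negP; rewrite inE/= => nG.
  by rewrite (bergman_out f nG) mul0r u0.
rewrite /bergman_dot /rdot; congr (_ +i* _); rewrite Rintegral_mkcond; apply: eq_Rintegral => p _.
  by rewrite (out (@complex.Re R)).
by rewrite (out (@complex.Im R))// Imdot.
Qed.

Lemma rdotD f g h : rdot (f + g) h = rdot f h + rdot g h.
Proof.
rewrite /rdot -RintegralD//; [|exact: integrable_Redot..].
by apply: eq_Rintegral => p _; rewrite /Redot bergman_addE mulrDl Re_add.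
Qed.

Lemma rdotZ (k : R) f g : rdot (k%:C *: f) g = k * rdot f g.
Proof.
rewrite /rdot -RintegralZl//; last exact: integrable_Redot.
apply: eq_Rintegral => p _; rewrite /Redot bergman_scaleE -mulrA Re_mul /= mul0r subr0.
by [].
Qed.

Lemma rdotN f g : rdot (- f) g = - rdot f g.
Proof. by have := rdotZ (-1) f g; rewrite rmorphN1 scaleN1r mulN1r. Qed.

Lemma rdotC f g : rdot f g = rdot g f.
Proof.
apply: eq_Rintegral => p _; rewrite /Redot.
by case: (f _) => x y; case: (g _) => s t /=; ring.
Qed.

Lemma rdot_i f g : rdot ('i *: f) ('i *: g) = rdot f g.
Proof.
apply: eq_Rintegral => p _; rewrite /Redot !bergman_scaleE.
by case: (f _) => x y; case: (g _) => s t /=; ring.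
Qed.

Lemma dotDl f g h : bergman_dot (f + g) h = bergman_dot f h + bergman_dot g h.
Proof. by rewrite !bergman_dotE scalerDr !rdotD. Qed.

Lemma complex_scale_split a f :
  a *: f = (complex.Re a)%:C *: f + (complex.Im a)%:C *: ('i *: f).
Proof.
by rewrite scalerA -scalerDl; congr (_ *: _); rewrite mulrC -complexE; case: (a).
Qed.

Lemma dotZl a f g : bergman_dot (a *: f) g = a * bergman_dot f g.
Proof.
rewrite !bergman_dotE.
have E1 : rdot (a *: f) g = complex.Re a * rdot f g - complex.Im a * rdot (- 'i *: f) g.
  by rewrite complex_scale_split rdotD !rdotZ scaleNr rdotN mulrN opprK.
have E2 : rdot (- 'i *: (a *: f)) g = complex.Re a * rdot (- 'i *: f) g + complex.Im a * rdot f g.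
  rewrite (scalerA _ a) (mulrC _ a) -(scalerA a) (complex_scale_split a) rdotD !rdotZ.
  by rewrite (scalerA 'i) mulrN -expr2 sqr_i opprK scale1r.
by rewrite E1 E2; apply: eq_complexP; rewrite ?Re_mul ?Im_mul.
Qed.

Lemma dotC f g : bergman_dot g f = conjc (bergman_dot f g).
Proof.
rewrite !bergman_dotE /=; congr (_ +i* _); first exact: rdotC.
rewrite rdotC -[LHS]rdot_i scalerA mulrN -expr2 sqr_i opprK scale1r.
by rewrite scaleNr rdotN opprK.
Qed.

Lemma dotDr f g h : bergman_dot f (g + h) = bergman_dot f g + bergman_dot f h.
Proof. by rewrite dotC dotDl conj_add -!dotC. Qed.

Lemma dotZr a f g : bergman_dot f (a *: g) = conjc a * bergman_dot f g.
Proof. by rewrite dotC dotZl conj_mul -dotC. Qed.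

Lemma dotNl f g : bergman_dot (- f) g = - bergman_dot f g.
Proof. by rewrite -scaleN1r dotZl mulN1r. Qed.

Lemma dotNr f g : bergman_dot f (- g) = - bergman_dot f g.
Proof. by rewrite -scaleN1r dotZr conj_opp conj_one mulN1r. Qed.

Lemma dotBl f g h : bergman_dot (f - g) h = bergman_dot f h - bergman_dot g h.
Proof. by rewrite dotDl dotNl. Qed.

Lemma dotBr f g h : bergman_dot f (g - h) = bergman_dot f g - bergman_dot f h.
Proof. by rewrite dotDr dotNr. Qed.

Lemma dot0l f : bergman_dot 0 f = 0.
Proof. by rewrite -(scale0r 0) dotZl mul0r. Qed.

Lemma dot0r f : bergman_dot f 0 = 0.
Proof. by rewrite dotC dot0l conj_zero. Qed.

Lemma dotff f : bergman_dot f f = (bnorm f ^+ 2)%:C.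
Proof. by rewrite bergman_dotff bnormE rmorphXn. Qed.

Lemma dot_suml (I : Type) (r : seq I) (F : I -> bergman G) g :
  bergman_dot (\sum_(i <- r) F i) g = \sum_(i <- r) bergman_dot (F i) g.
Proof.
by elim: r => [|i r IH]; rewrite ?big_nil ?dot0l// !big_cons dotDl IH.
Qed.

Lemma dot_sumr (I : Type) (r : seq I) (F : I -> bergman G) g :
  bergman_dot g (\sum_(i <- r) F i) = \sum_(i <- r) bergman_dot g (F i).
Proof.
by elim: r => [|i r IH]; rewrite ?big_nil ?dot0r// !big_cons dotDr IH.
Qed.

Lemma bnorm_sqrD f g : bnorm (f + g) ^+ 2 =
  bnorm f ^+ 2 + 2 * complex.Re (bergman_dot f g) + bnorm g ^+ 2.
Proof.
apply: (@complexI R); rewrite -dotff dotDl !dotDr !dotff (dotC f g).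
by case: (bergman_dot f g) => x y; apply: eq_complexP; rewrite /=; ring.
Qed.

Lemma cauchy_schwarz f g : normc (bergman_dot f g) <= bnorm f * bnorm g.
Proof.
have [->|g0] := eqVneq g 0; first by rewrite dot0r normc0 bnorm0 mulr0.
have n0 := bnorm_gt0 g0; pose A := bnorm g ^+ 2; pose c := bergman_dot f g.
have A0 : 0 < A by rewrite exprn_gt0.
have : 0 <= bnorm (A%:C *: f - c *: g) ^+ 2 by exact: sqr_ge0.
rewrite bnorm_sqrD bnormN !bnormZ dotNr Re_opp dotZl dotZr -/c.
rewrite normc_real (ger0_norm (ltW A0)) !exprMn -/A.
have -> : complex.Re (A%:C * (conjc c * c)) = A * normc c ^+ 2.
  by rewrite sqr_normc; case: (c) => x y /=; ring.
move=> h; have {}h : 0 <= A * (A * bnorm f ^+ 2 - normc c ^+ 2) by lra.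
rewrite pmulr_rge0// subr_ge0 -exprMn_comm// in h; last exact: mulrC.
rewrite -(@ler_pXn2r _ 2)// ?nnegrE ?mulr_ge0 ?bnorm_ge0 ?normc_ge0//.
by rewrite [bnorm f * _]mulrC.
Qed.

Lemma dot_eq0 g : (forall f, bergman_dot f g = 0) -> g = 0.
Proof.
move=> /(_ g); rewrite dotff => /complexI/eqP; rewrite sqrf_eq0 => /eqP.
exact: bnorm_eq0.
Qed.

Lemma dot_inj g h : (forall f, bergman_dot f g = bergman_dot f h) -> g = h.
Proof.
move=> gh; apply/eqP; rewrite -subr_eq0; apply/eqP/dot_eq0 => f.
by rewrite dotBr gh subrr.
Qed.

End BergmanDot.

Section Hilbert.
Context {R : realType} {G : set R[i]}.
Hypothesis oG : copen G.
Implicit Types (f g h x y m : bergman G) (a : R[i]).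

Definition subspace_pred (M : bergman G -> Prop) :=
  [/\ M 0, forall f g, M f -> M g -> M (f + g) & forall a f, M f -> M (a *: f)].

Lemma parallelogram f g :
  bnorm (f - g) ^+ 2 = 2 * bnorm f ^+ 2 + 2 * bnorm g ^+ 2 - bnorm (f + g) ^+ 2.
Proof. rewrite (bnorm_sqrD f (- g)) (bnorm_sqrD f g) bnormN dotNr Re_opp; lra. Qed.

Lemma exists_inv_succ_lt (e : R) : 0 < e -> exists N, forall n, (N <= n)%N -> n.+1%:R^-1 < e.
Proof.
move=> e0; exists (Num.bound e^-1) => n nN.
rewrite invf_plt ?posrE// (lt_le_trans (archi_boundP _))// ?invr_ge0 ?(ltW e0)//.
by rewrite ler_nat (leq_trans nN).
Qed.

Lemma orthogonal_approximation (M : bergman G -> Prop) x : subspace_pred M ->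
  exists y, (forall m, M m -> bergman_dot m y = 0) /\
    forall e : R, 0 < e -> exists2 m, M m & bnorm (y - (x + m)) < e.
Proof.
move=> [M0 MD MZ].
pose D := [set bnorm (x + m) ^+ 2 | m in [set m | M m]].
have Dlb : has_inf D.
  split; first by exists (bnorm (x + 0) ^+ 2), 0.
  by exists 0 => _ [m _ <-]; exact: sqr_ge0.
pose d := inf D.
have dle m : M m -> d <= bnorm (x + m) ^+ 2.
  by move=> Mm; apply: ge_inf; [case: Dlb|exists m].
have /choice[s sP] (n : nat) : exists m, M m /\ bnorm (x + m) ^+ 2 < d + n.+1%:R^-1.
  have n0 : 0 < n.+1%:R^-1 :> R by rewrite invr_gt0.
  by have [_ [m Mm <-] h] := inf_adherent n0 Dlb; exists m.
have MB f g : M f -> M g -> M (f - g).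
  by move=> Mf Mg; apply: MD => //; rewrite -scaleN1r; exact: MZ.
have two : (2%:R : R[i]) != 0 by rewrite pnatr_eq0.
have close n k : bnorm ((x + s n) - (x + s k)) ^+ 2 <= 2 * (n.+1%:R^-1 + k.+1%:R^-1).
  have [M1 h1] := sP n; have [M2 h2] := sP k.
  rewrite parallelogram.
  have -> : x + s n + (x + s k) = 2%:R *: (x + 2%:R^-1 *: (s n + s k)).
    by rewrite scalerDr scalerA mulfV// scale1r scaler_nat mulr2n addrACA.
  rewrite bnormZ exprMn.
  have -> : normc (2%:R : R[i]) ^+ 2 = 4.
    have -> : (2%:R : R[i]) = (2%:R : R)%:C by rewrite rmorph_nat.
    by rewrite normc_real ger0_norm// -natrX.
  have := dle (2%:R^-1 *: (s n + s k)) (MZ _ _ (MD _ _ M1 M2)).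
  move: (bnorm _ ^+ 2) (bnorm _ ^+ 2) (bnorm _ ^+ 2) (n.+1%:R^-1) (k.+1%:R^-1) h1 h2.
  move=> u v w p q; lra.
have [e e0|y yP] := bergman_complete oG (u := fun n => x + s n).
  have e4 : 0 < e ^+ 2 / 4 by rewrite divr_gt0// exprn_gt0.
  have [N NP] := exists_inv_succ_lt e4; exists N => n k nN kN.
  rewrite -(@ltr_pXn2r _ 2)// ?nnegrE ?bnorm_ge0 ?(ltW e0)//.
  apply: le_lt_trans (close n k) _; have := NP _ nN; have := NP _ kN.
  by move: (n.+1%:R^-1) (k.+1%:R^-1) (e ^+ 2) => p q t; lra.
exists y; split.
  move=> m Mm; have [->|m0] := eqVneq m 0; first by rewrite dot0l.
  have n0 := bnorm_gt0 m0; pose A := bnorm m ^+ 2; have A0 : 0 < A by rewrite exprn_gt0.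
  have orth n : normc (bergman_dot m (x + s n)) ^+ 2 <= A * n.+1%:R^-1.
    have [Ms h] := sP n; set c := bergman_dot m _.
    have := dle (s n + (- conjc c * (A^-1)%:C) *: m) (MD _ _ Ms (MZ _ _ Mm)).
    rewrite addrA bnorm_sqrD dotZr dotC -/c bnormZ exprMn -/A.
    have -> : complex.Re (conjc (- conjc c * (A^-1)%:C) * conjc c) = - (A^-1 * normc c ^+ 2).
      by rewrite sqr_normc; case: (c) => p q /=; ring.
    rewrite normc_mul normc_opp normc_conjc normc_real ger0_norm ?invr_ge0 ?(ltW A0)//.
    have -> : (normc c * A^-1) ^+ 2 * A = A^-1 * normc c ^+ 2.
      by field; rewrite gt_eqF.
    move=> h2; have : A^-1 * normc c ^+ 2 <= n.+1%:R^-1.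
      move: h h2; move: (bnorm _ ^+ 2) (A^-1 * normc c ^+ 2) (n.+1%:R^-1) => u v w; lra.
    by rewrite ler_pdivrMl.
  apply/eqP; rewrite -normc_eq0 -[_ == _]negbK; apply/negP => k0.
  set k := normc _ in k0; have {}k0 : 0 < k by rewrite lt_def k0 normc_ge0.
  have t0 : 0 < k / (2 * bnorm m) by rewrite divr_gt0// mulr_gt0.
  have u0 : 0 < (k / 2) ^+ 2 / A by rewrite divr_gt0// exprn_gt0// divr_gt0.
  have [N NP] := yP _ t0; have [K KP] := exists_inv_succ_lt u0.
  have h1 := NP _ (leq_maxl N K); have h2 := KP _ (leq_maxr N K).
  set n := maxn N K in h1 h2.
  have h3 : normc (bergman_dot m (x + s n)) < k / 2.
    rewrite -(@ltr_pXn2r _ 2)// ?nnegrE ?normc_ge0// ?divr_ge0// ?(ltW k0)//.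
    by apply: le_lt_trans (orth n) _; rewrite mulrC -ltr_pdivlMr.
  have h4 : normc (bergman_dot m (x + s n - y)) <= k / 2.
    apply: le_trans (cauchy_schwarz _ _) _; apply: le_trans (ler_wpM2l (bnorm_ge0 m) h1) _.
    by rewrite le_eqVlt; apply/orP; left; apply/eqP; field; rewrite gt_eqF.
  rewrite dotBr in h4.
  have := normc_sub (bergman_dot m (x + s n)) (bergman_dot m (x + s n) - bergman_dot m y).
  by rewrite opprB addrC subrK -/k; lra.
move=> e e0; have e2 : 0 < e / 2 by rewrite divr_gt0.
have [N /(_ _ (leqnn N)) h] := yP _ e2; exists (s N); first by case: (sP N).
rewrite bnorm_subC; lra.
Qed.

Theorem riesz_representation (phi : bergman G -> R[i]) (C : R) :
  (forall f g, phi (f + g) = phi f + phi g) -> (forall a f, phi (a *: f) = a * phi f) ->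
  (forall f, normc (phi f) <= C * bnorm f) ->
  exists k, forall f, phi f = bergman_dot f k.
Proof.
move=> phiD phiZ phiC.
have phi0 : phi 0 = 0 by rewrite -(scale0r 0) phiZ mul0r.
have phiB f g : phi (f - g) = phi f - phi g by rewrite phiD -scaleN1r phiZ mulN1r.
have [z|] := pselect (forall f, phi f = 0).
  by exists 0 => f; rewrite dot0r z.
move=> /existsNP[x /eqP x0].
have [|y [yM yx]] := @orthogonal_approximation (fun f => phi f = 0) x.
  split=> //; first by move=> f g f0 g0; rewrite phiD f0 g0 addr0.
  by move=> a f f0; rewrite phiZ f0 mulr0.
have C0 : 0 <= C.
  have n0 : 0 < bnorm x.
    by apply: bnorm_gt0; apply: contra_neq x0 => ->.
  by have := le_trans (normc_ge0 _) (phiC x); rewrite pmulr_lge0.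
have phiy : phi y = phi x.
  apply/eqP; rewrite -subr_eq0 -normc_eq0 -[_ == _]negbK; apply/negP => k0.
  set k := normc _ in k0; have {}k0 : 0 < k by rewrite lt_def k0 normc_ge0.
  have den : 0 < C + 1 by lra.
  have [m m0] := yx _ (divr_gt0 k0 den); rewrite ltr_pdivlMr// => h.
  have := phiC (y - (x + m)); rewrite phiB phiD m0 addr0 -/k.
  have := bnorm_ge0 (y - (x + m)); lra.
have y0 : phi y != 0 by rewrite phiy.
have ny : (bnorm y ^+ 2)%:C != 0 :> R[i].
  have : 0 < bnorm y by apply: bnorm_gt0; apply: contra_neq y0 => ->.
  move=> h; rewrite -normc_gt0 normc_real ger0_norm ?sqr_ge0//.
  by rewrite exprn_gt0.
exists ((conjc (phi y) * ((bnorm y ^+ 2)^-1)%:C) *: y) => f.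
have : bergman_dot (f - (phi f / phi y) *: y) y = 0.
  by apply: yM; rewrite phiB phiZ divfK// subrr.
rewrite dotBl dotZl dotff => /eqP; rewrite subr_eq0 => /eqP E.
rewrite dotZr E conj_mul conj_conj conj_real.
have -> : ((bnorm y ^+ 2)^-1)%:C = ((bnorm y ^+ 2)%:C)^-1 :> R[i].
  exact: (fmorphV (real_complex R)).
move: (phi y) ((bnorm y ^+ 2)%:C) (phi f) y0 ny => p q r p0 q0.
by field; rewrite p0 q0.
Qed.

Lemma exists_kernel : exists K : R[i] -> bergman G,
  forall z f, f z = bergman_dot f (K z).
Proof.
have /choice[K KP] (z : R[i]) : exists k, forall f : bergman G, f z = bergman_dot f k.
  have [C _ CP] := bergman_eval_bound oG z.
  exact: (@riesz_representation (fun f => f z) C).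
by exists K => z f; exact: KP.
Qed.

Lemma bergman_mul (q : R[i] -> R[i]) (B : R) (f : bergman G) : 0 <= B ->
  (forall z, G z -> derivable (q : R[i]^o -> R[i]^o) z 1) ->
  (forall z, G z -> normc (q z) <= B) ->
  exists2 g : bergman G, (forall z, g z = q z * f z) & bnorm g <= B * bnorm f.
Proof.
move=> B0 dq qB; have [Gf f0 fi] := bergmanP f.
pose h z : R[i]^o := q z * f z.
have h0 w : ~ G w -> h w = 0 by move=> nGw; rewrite /h f0// mulr0.
have Gh : analytic_on G h.
  by move=> w Gw; exact: (derivable_mulc (dq w Gw) (Gf w Gw)).
have mf := measurable_modulus Gf f0; have mh := measurable_modulus Gh h0.
have le : (int_sqr G h <= (B ^+ 2)%:E * int_sqr G f)%E.
  rewrite (int_sqrE h0) (int_sqrE f0) -ge0_integralZl//=; last 3 first.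
  - by apply/measurable_EFinP; exact: measurable_funX.
  - by move=> p _; rewrite lee_fin sqr_ge0.
  - by rewrite lee_fin sqr_ge0.
  apply: ge0_le_integral => //.
  - by move=> p _; rewrite lee_fin sqr_ge0.
  - by apply/measurable_EFinP; exact: measurable_funX.
  - apply: measurable_funeM; apply/measurable_EFinP; exact: measurable_funX.
  move=> p _; rewrite -EFinM lee_fin -exprMn.
  have [Gp|nGp] := pselect (G (Defs.cpoint p)); last first.
    by rewrite /modulus h0// f0// normc0 mulr0.
  rewrite lerXn2r ?nnegrE ?mulr_ge0 ?modulus_ge0//.
  by rewrite /modulus /h normc_mul ler_wpM2r ?normc_ge0// qB.
have Bh : bergman_fun G h.
  split=> //; apply: le_lt_trans le _.
  by rewrite lte_mul_pinfty// lee_fin sqr_ge0.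
exists (mkbergman Bh) => //.
rewrite -(@ler_pXn2r _ 2)// ?nnegrE ?mulr_ge0 ?bnorm_ge0//.
by rewrite -lee_fin exprMn bnorm_sqr EFinM bnorm_sqr.
Qed.

Hypothesis bG : exists M : R, forall z, G z -> normc z <= M.

Lemma mulz_bound : exists2 M : R, 0 <= M & forall f, bnorm (mulz f) <= M * bnorm f.
Proof.
have [M MP] := bG; exists `|M| => // f.
have [|z Gz|g gE gB] := @bergman_mul id `|M| f (normr_ge0 M).
- by move=> z _; exact: derivable_id.
- by rewrite (le_trans (MP _ Gz))// ler_norm.
by have -> : mulz f = g by apply: bergman_ext => z; rewrite gE (mulzE MP).
Qed.

Lemma mulzEz f z : mulz f z = z * f z.
Proof. by have [M MP] := bG; exact: mulzE MP f z. Qed.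

Lemma mulzD f g : mulz (f + g) = mulz f + mulz g.
Proof.
by apply: bergman_ext => z; rewrite bergman_addE !mulzEz -mulrDr.
Qed.

Lemma mulzZ a f : mulz (a *: f) = a *: mulz f.
Proof.
by apply: bergman_ext => z; rewrite bergman_scaleE !mulzEz mulrCA.
Qed.

Lemma adjoint_mulzP f g : bergman_dot (mulz f) g = bergman_dot f (adjoint (@mulz R G) g).
Proof.
suff : [set S | forall f g, bergman_dot (mulz f) g = bergman_dot f (S g)] (adjoint (@mulz R G)).
  by move=> /= H; exact: H.
apply: xgetPex.
have [M M0 MP] := mulz_bound.
have /choice[S SP] (g' : bergman G) :
    exists k, forall f', bergman_dot (mulz f') g' = bergman_dot f' k.
  apply: (@riesz_representation _ (M * bnorm g')).
  - by move=> u v; rewrite mulzD dotDl.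
  - by move=> a u; rewrite mulzZ dotZl.
  - move=> u; apply: le_trans (cauchy_schwarz _ _) _.
    by rewrite mulrAC ler_wpM2r ?bnorm_ge0.
by exists S => f' g'; exact: SP.
Qed.

Local Notation T := (adjoint (@mulz R G)).

Lemma adjoint_mulzD f g : T (f + g) = T f + T g.
Proof. by apply: dot_inj => h; rewrite dotDr -!adjoint_mulzP dotDr. Qed.

Lemma adjoint_mulzZ a f : T (a *: f) = a *: T f.
Proof. by apply: dot_inj => h; rewrite dotZr -!adjoint_mulzP dotZr. Qed.

Lemma adjoint_mulz_bound : exists2 M : R, 0 <= M & forall f, bnorm (T f) <= M * bnorm f.
Proof.
have [M M0 MP] := mulz_bound; exists M => // f.
have [->|n0] := eqVneq (T f) 0; first by rewrite bnorm0 mulr_ge0// bnorm_ge0.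
have {}n0 := bnorm_gt0 n0; rewrite -(ler_pM2r n0) -expr2.
have -> : bnorm (T f) ^+ 2 = normc (bergman_dot (mulz (T f)) f).
  by rewrite adjoint_mulzP dotff normc_real ger0_norm// sqr_ge0.
apply: le_trans (cauchy_schwarz _ _) _.
by rewrite mulrAC ler_wpM2r ?bnorm_ge0.
Qed.

End Hilbert.

(** * Convex polynomials and convex hulls *)

Section ConvexPolynomials.
Context {R : realType}.
Implicit Types (p q : {poly R}) (w u : R[i]).

Definition ceval p w : R[i] := (map_poly (real_complex R) p).[w].

Lemma cevalE p w : ceval p w = \sum_(k < size p) (p`_k)%:C * w ^+ k.
Proof.
rewrite /ceval (@horner_coef_wide _ (size p)); last first.
  by rewrite size_map_poly.
by apply: eq_bigr => k _; rewrite coef_map.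
Qed.

Lemma cevalM p q w : ceval (p * q) w = ceval p w * ceval q w.
Proof. by rewrite /ceval rmorphM hornerM. Qed.

Lemma cevalXn n w : ceval 'X^n w = w ^+ n.
Proof. by rewrite /ceval map_polyXn hornerXn. Qed.

Lemma convex_polyP p : convex_poly p <-> (forall k, 0 <= p`_k) /\ p.[1] = 1.
Proof.
rewrite /convex_poly; suff -> : p.[1] = \sum_(k < size p) p`_k by [].
by rewrite horner_coef; apply: eq_bigr => k _; rewrite expr1n mulr1.
Qed.

Lemma convex_polyM p q : convex_poly p -> convex_poly q -> convex_poly (p * q).
Proof.
move=> /convex_polyP[p0 p1] /convex_polyP[q0 q1]; apply/convex_polyP; split.
  by move=> k; rewrite coefM sumr_ge0// => i _; rewrite mulr_ge0.
by rewrite hornerM p1 q1 mulr1.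
Qed.

Lemma convex_polyXn n : convex_poly ('X^n : {poly R}).
Proof.
apply/convex_polyP; split; last by rewrite hornerXn expr1n.
by move=> k; rewrite coefXn ler0n.
Qed.

(* Squaring doubles the tangent of the argument as long as the real part stays positive. *)
Lemma exists_pow_Re_le0 w : complex.Im w != 0 -> exists2 m, (0 < m)%N & complex.Re (w ^+ m) <= 0.
Proof.
move=> w0; apply: contrapT => nex.
have {nex}pos m : (0 < m)%N -> 0 < complex.Re (w ^+ m).
  by move=> m0; rewrite ltNge; apply/negP => h; apply: nex; exists m.
pose a k := complex.Re (w ^+ (2 ^ k)); pose b k := complex.Im (w ^+ (2 ^ k)).
have a0 k : 0 < a k by apply: pos; rewrite expn_gt0.
have E k : w ^+ (2 ^ k.+1) = w ^+ (2 ^ k) * w ^+ (2 ^ k) by rewrite -exprD addnn -mul2n expnS.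
have aS k : a k.+1 = a k ^+ 2 - b k ^+ 2 by rewrite /a E Re_mul !expr2.
have bS k : b k.+1 = 2 * a k * b k by rewrite /b E Im_mul -/(a k) -/(b k); ring.
have ba k : `|b k| < a k.
  have := a0 k.+1; rewrite aS subr_gt0 -(real_normK (num_real (b k))).
  by rewrite ltr_pXn2r// ?nnegrE ?(ltW (a0 k)).
pose t := `|b 0%N| / a 0%N.
have t0 : 0 < t by rewrite divr_gt0// normr_gt0 /b expn0 expr1.
have grow k : 2 ^+ k * t * a k <= `|b k|.
  elim: k => [|k IH]; first by rewrite expr0 mul1r divfK// gt_eqF.
  rewrite bS !normrM (ger0_norm (ltW (a0 k))) [`|2|]ger0_norm//.
  apply: (@le_trans _ _ (2 * a k * (2 ^+ k * t * a k))); last first.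
    by rewrite ler_wpM2l// mulr_ge0// ltW.
  have -> : 2 * a k * (2 ^+ k * t * a k) = 2 ^+ k.+1 * t * a k ^+ 2.
    by rewrite exprS; ring.
  rewrite ler_wpM2l//; first by rewrite mulr_ge0 ?exprn_ge0// ltW.
  by rewrite aS gerBl sqr_ge0.
have [n nP] : exists n, 1 <= 2 ^+ n * t.
  have [n h] := exists_div_expn2_lt ler01 t0; exists n.
  by move: h; rewrite ltr_pdivrMr ?exprn_gt0// mulrC => /ltW.
have := ba n; rewrite ltNge => /negP; apply.
by rewrite (le_trans _ (grow n))// ler_peMl// ltW.
Qed.

Lemma killing_poly w : complex.Im w != 0 -> exists q, [/\ convex_poly q, ceval q w = 0 &
  forall u, ceval q u = 0 -> normc u = normc w].
Proof.
move=> w0; have [m m0 mRe] := exists_pow_Re_le0 w0.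
pose s := - 2 * complex.Re (w ^+ m); pose n := normc (w ^+ m) ^+ 2.
have s0 : 0 <= s by rewrite /s; lra.
have n0 : 0 <= n by exact: sqr_ge0.
pose N := 1 + s + n; have N0 : 0 < N by rewrite /N; lra.
pose q0 : {poly R} := 'X^(m + m) + s *: 'X^m + n%:P.
have evq0 u : ceval q0 u = (u ^+ m - w ^+ m) * (u ^+ m - conjc (w ^+ m)).
  transitivity (u ^+ m * u ^+ m + s%:C * u ^+ m + n%:C).
    rewrite /ceval /q0 !rmorphD/= map_polyZ !map_polyXn map_polyC !hornerD hornerZ !hornerXn.
    by rewrite hornerC exprD.
  have -> : n%:C = w ^+ m * conjc (w ^+ m).
    by rewrite /n sqr_normc; case: (w ^+ m) => x y; apply: eq_complexP; rewrite /=; ring.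
  have -> : s%:C = - (w ^+ m + conjc (w ^+ m)).
    by rewrite /s; case: (w ^+ m) => x y; apply: eq_complexP; rewrite /=; ring.
  by rewrite /=; ring.
have evq u : ceval (N^-1 *: q0) u = (N^-1)%:C * ceval q0 u.
  by rewrite /ceval map_polyZ hornerZ.
have Nc : (N^-1)%:C != 0 :> R[i].
  by rewrite -normc_gt0 normc_real normr_gt0 invr_eq0 gt_eqF.
exists (N^-1 *: q0); split.
- apply/convex_polyP; split.
    move=> k; rewrite coefZ mulr_ge0 ?invr_ge0 ?(ltW N0)// !coefD coefZ !coefXn coefC.
    have nk : 0 <= (if k == 0%N then n else 0) by case: (k == 0%N).
    by rewrite !addr_ge0 ?ler0n// mulr_ge0 ?ler0n.
  rewrite hornerZ !hornerD hornerZ !hornerXn hornerC !expr1n mulr1.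
  by rewrite mulVf// gt_eqF.
- by rewrite evq evq0 subrr mul0r mulr0.
move=> u; rewrite evq evq0 => /eqP; rewrite mulf_eq0 (negbTE Nc)/= mulf_eq0 !subr_eq0.
move=> h; have {h} : normc u ^+ m = normc w ^+ m.
  by case/orP: h => /eqP h; rewrite -!normc_exp h ?normc_conjc.
by move/eqP; rewrite eqrXn2 ?normc_ge0// => /eqP.
Qed.

Lemma common_killing_poly (ws : seq R[i]) : {in ws, forall w, complex.Im w != 0} ->
  exists q, [/\ convex_poly q, {in ws, forall w, ceval q w = 0} &
    forall u, normc u \notin [seq normc w | w <- ws] -> ceval q u != 0].
Proof.
elim: ws => [|w ws IH] wsP.
  exists 'X^0; split => //; first exact: convex_polyXn.
  by move=> u _; rewrite cevalXn expr0 oner_neq0.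
have [|q [cq q0 qn0]] := IH; first by move=> v vws; apply: wsP; rewrite inE vws orbT.
have [|r [cr r0 rn0]] := @killing_poly w; first by apply: wsP; rewrite inE eqxx.
exists (q * r); split; first exact: convex_polyM.
  move=> v; rewrite inE cevalM => /orP[/eqP ->|/q0 ->]; first by rewrite r0 mulr0.
  by rewrite mul0r.
move=> u; rewrite /= inE negb_or => /andP[uw uws]; rewrite cevalM mulf_neq0 ?qn0//.
by apply: contra uw => /eqP/rn0/eqP.
Qed.

Lemma bernoulli_inequality (t : R) k : 0 <= t -> 1 + k%:R * t <= (1 + t) ^+ k.
Proof.
move=> t0; elim: k => [|k IH]; first by rewrite mul0r addr0 expr0.
rewrite exprS; apply: (@le_trans _ _ ((1 + t) * (1 + k%:R * t))); last first.
  by rewrite ler_wpM2l// addr_ge0.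
have : 0 <= t * (k%:R * t) by rewrite !mulr_ge0.
rewrite -natr1; move: (k%:R) => x; lra.
Qed.

Lemma exists_pow_ge (us : seq R[i]) q (B : R) :
  {in us, forall u, 1 < normc u /\ ceval q u != 0} ->
  exists n, {in us, forall u, B <= normc (ceval ('X^n * q) u)}.
Proof.
elim: us => [|v us IH] usP; first by exists 0%N.
have [|n nP] := IH; first by move=> u uus; apply: usP; rewrite inE uus orbT.
have [v1 qv] := usP v (mem_head _ _).
have qv0 : 0 < normc (ceval q v) by rewrite normc_gt0.
pose t := normc v - 1; have t0 : 0 < t by rewrite subr_gt0.
pose k := Num.bound (`|B| / normc (ceval q v) / t).
have kB : B <= normc v ^+ k * normc (ceval q v).
  rewrite -ler_pdivrMr//; apply: (@le_trans _ _ (1 + k%:R * t)).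
    have := archi_boundP (divr_ge0 (divr_ge0 (normr_ge0 B) (ltW qv0)) (ltW t0)).
    rewrite -/k ltr_pdivrMr// => h; apply: ltW; apply: le_lt_trans (lt_trans h _); last first.
      by rewrite ltrDr.
    by rewrite ler_pM2r ?invr_gt0// ler_norm.
  have -> : normc v = 1 + t by rewrite /t addrC subrK.
  by rewrite bernoulli_inequality// ltW.
exists (n + k)%N => u; rewrite inE => /orP[/eqP ->|uus].
  rewrite cevalM cevalXn normc_mul normc_exp exprD (le_trans kB)// ler_wpM2r ?normc_ge0//.
  by rewrite ler_peMl ?exprn_ge0 ?normc_ge0// exprn_ege1// ltW.
have := nP _ uus; rewrite !cevalM !cevalXn !normc_mul !normc_exp => h.
rewrite (le_trans h)// ler_wpM2r ?normc_ge0// exprD ler_peMr ?exprn_ge0 ?normc_ge0//.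
by rewrite exprn_ege1//; apply: ltW; case: (usP u _); rewrite ?inE ?uus ?orbT.
Qed.

End ConvexPolynomials.

Section ConvexHull.
Context {R : realType} {V : normedModType R[i]}.

Lemma convex_set_sum (A : set V) n (c : nat -> R) (v : nat -> V) :
  @convex_set _ V A -> (forall k, 0 <= c k) -> \sum_(k < n) c k = 1 ->
  (forall k, A (v k)) -> A (\sum_(k < n) (c k)%:C *: v k).
Proof.
move=> cA; elim: n c => [|n IH] c c0; first by rewrite big_ord0 => /eqP; rewrite eq_sym oner_eq0.
rewrite !big_ord_recr/= => c1 Av.
set s := \sum_(i < n) c i in c1; have s0 : 0 <= s by exact: sumr_ge0.
have [sE|sn0] := eqVneq s 0.
  rewrite big1; last first.
    move=> i _; have /eqP : s == 0 by rewrite sE.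
    move/eqP; rewrite psumr_eq0// => /allP/(_ i); rewrite mem_index_enum => /(_ isT) /= /eqP ->.
    by rewrite scale0r.
  by move: c1; rewrite sE add0r => ->; rewrite add0r scale1r.
have sp : 0 < s by rewrite lt_def sn0.
have s1 : s <= 1 by have := c0 n; lra.
have sC0 : 0 <= s%:C :> R[i] by rewrite lecR.
have sC1 : s%:C <= 1 :> R[i] by rewrite lecR.
pose x := \sum_(k < n) (c k / s)%:C *: v k.
have Ax : A x.
  apply: (IH (fun k => c k / s)) => //.
    by move=> k; rewrite divr_ge0.
  by rewrite -mulr_suml divff.
have := cA x (v n) (Itv01 sC0 sC1); rewrite !inE => /(_ Ax (Av n)).
congr (A _); rewrite /conv/=; congr (_ + _).
  rewrite scaler_sumr; apply: eq_bigr => k _.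
  by rewrite scalerA -rmorphM/= mulrC divfK.
congr (_ *: _); have -> : c n = 1 - s by lra.
by rewrite rmorphB rmorph1.
Qed.

Lemma poly_op_convex_hull (p : {poly R}) (T : V -> V) x : convex_poly p ->
  convex_hull (power_orbit T x) (poly_op p T x).
Proof.
move=> [p0 p1] A [cA orbA].
apply: (@convex_set_sum A (size p) (fun k => p`_k) (fun k => iter k T x)) => // k.
by apply: orbA; exists k.
Qed.

End ConvexHull.

(** * Convex-cyclicity *)

Section ConvexCyclic.
Context {R : realType} {G : set R[i]}.
Hypothesis oG : copen G.
Hypothesis bG : exists M : R, forall z, G z -> normc z <= M.
Variable K : R[i] -> bergman G.
Hypothesis KP : forall z (f : bergman G), f z = bergman_dot f (K z).
Local Notation T := (adjoint (@mulz R G)).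
Implicit Types (f g : bergman G) (z w : R[i]) (p q : {poly R}) (l : seq (R[i] * R[i])).

Lemma adjoint_mulz_kernel z : T (K z) = conjc z *: K z.
Proof. by apply: dot_inj => f; rewrite dotZr conj_conj -adjoint_mulzP// -!KP mulzEz. Qed.

Lemma iter_adjointD k f g : iter k T (f + g) = iter k T f + iter k T g.
Proof. by elim: k => [|k IH]//=; rewrite IH adjoint_mulzD. Qed.

Lemma iter_adjointZ k (a : R[i]) f : iter k T (a *: f) = a *: iter k T f.
Proof. by elim: k => [|k IH]//=; rewrite IH adjoint_mulzZ. Qed.

Lemma poly_opD p f g : poly_op p T (f + g) = poly_op p T f + poly_op p T g.
Proof.
rewrite /poly_op -big_split/=; apply: eq_bigr => k _.
by rewrite iter_adjointD scalerDr.
Qed.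

Lemma poly_opZ p (a : R[i]) f : poly_op p T (a *: f) = a *: poly_op p T f.
Proof.
rewrite /poly_op scaler_sumr; apply: eq_bigr => k _.
by rewrite iter_adjointZ !scalerA mulrC.
Qed.

Lemma poly_op0 p : poly_op p T 0 = 0.
Proof. by have := poly_opZ p 0 0; rewrite !scale0r. Qed.

Lemma poly_opB p f g : poly_op p T (f - g) = poly_op p T f - poly_op p T g.
Proof. by rewrite poly_opD -scaleN1r poly_opZ scaleN1r. Qed.

Lemma poly_op_sum p n (F : nat -> bergman G) :
  poly_op p T (\sum_(i < n) F i) = \sum_(i < n) poly_op p T (F i).
Proof.
elim: n => [|n IH]; first by rewrite !big_ord0 poly_op0.
by rewrite !big_ord_recr/= poly_opD IH.
Qed.

Lemma poly_op_bound p : exists2 C : R, 0 <= C & forall f, bnorm (poly_op p T f) <= C * bnorm f.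
Proof.
have [M M0 MP] := adjoint_mulz_bound oG bG.
have iP k f : bnorm (iter k T f) <= M ^+ k * bnorm f.
  elim: k => [|k IH]; first by rewrite expr0 mul1r.
  by rewrite iterS exprS -mulrA (le_trans (MP _))// ler_wpM2l.
exists (\sum_(k < size p) `|p`_k| * M ^+ k).
  by apply: sumr_ge0 => k _; rewrite mulr_ge0// exprn_ge0.
move=> f; rewrite /poly_op (le_trans (bnorm_sum _ _))// mulr_suml ler_sum// => k _.
by rewrite bnormZ normc_real -mulrA ler_wpM2l.
Qed.

Lemma poly_op_kernel p z : poly_op p T (K z) = ceval p (conjc z) *: K z.
Proof.
rewrite cevalE scaler_suml; apply: eq_bigr => k _; rewrite -scalerA; congr (_ *: _).
elim: (k : nat) => [|j IH]; first by rewrite expr0 scale1r.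
by rewrite iterS IH adjoint_mulzZ// adjoint_mulz_kernel scalerA exprSr.
Qed.

Definition comb l : bergman G := \sum_(x <- l) x.1 *: K x.2.

Lemma comb_cat l l' : comb (l ++ l') = comb l + comb l'.
Proof. by rewrite /comb big_cat. Qed.

Lemma poly_op_comb p l :
  poly_op p T (comb l) = \sum_(x <- l) (x.1 * ceval p (conjc x.2)) *: K x.2.
Proof.
rewrite /comb; elim: l => [|x l IH]; first by rewrite !big_nil poly_op0.
by rewrite !big_cons poly_opD IH poly_opZ poly_op_kernel scalerA.
Qed.

Lemma bnorm_triangle f g h : bnorm (f - h) <= bnorm (f - g) + bnorm (g - h).
Proof.
have -> : f - h = (f - g) + (g - h) by rewrite addrA subrK.
exact: bnormD.
Qed.

Lemma kernel_span_dense (D : R[i] -> Prop) :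
  (forall z, G z -> forall d : R, 0 < d -> exists2 w, D w & normc (w - z) < d) ->
  forall f (e : R), 0 < e -> exists l, {in l, forall x, D x.2} /\ bnorm (f - comb l) < e.
Proof.
move=> dD f e e0; pose M g := exists l, {in l, forall x, D x.2} /\ g = comb l.
have [|y [yM yf]] := @orthogonal_approximation _ _ oG M f.
  split; first by exists [::]; split=> //; rewrite /comb big_nil.
    move=> _ _ [l [lD ->]] [l' [lD' ->]]; exists (l ++ l'); rewrite comb_cat; split=> //.
    by move=> x; rewrite mem_cat => /orP[/lD|/lD'].
  move=> a _ [l [lD ->]]; exists [seq (a * x.1, x.2) | x <- l]; split.
    by move=> _ /mapP[x /lD xD ->].
  by rewrite /comb scaler_sumr big_map; apply: eq_bigr => x _; rewrite scalerA.
have yD w : D w -> y w = 0.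
  move=> Dw; rewrite KP dotC (yM (K w)) ?conj_zero//.
  exists [:: (1, w)]; split; first by move=> x; rewrite inE => /eqP ->.
  by rewrite /comb big_seq1 scale1r.
have y0 : y = 0.
  apply: bergman_ext => z; rewrite bergman_zeroE.
  have [Gz|nGz] := pselect (G z); last exact: bergman_out.
  apply/eqP; rewrite -normc_eq0 -[_ == _]negbK; apply/negP => k0.
  have {}k0 : 0 < normc (y z) by rewrite lt_def k0 normc_ge0.
  have [d d0 dP] := derivable_continuous_normc (bergman_analytic (f := y) Gz) k0.
  have [w Dw wz] := dD _ Gz _ d0.
  by have := dP _ wz; rewrite yD// sub0r normc_opp ltxx.
have [m [l [lD ->]] lf] := yf _ e0.
exists [seq (- x.1, x.2) | x <- l]; split; first by move=> _ /mapP[x /lD xD ->].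
have -> : comb [seq (- x.1, x.2) | x <- l] = - comb l.
  by rewrite /comb -sumrN big_map; apply: eq_bigr => x _; rewrite scaleNr.
by rewrite opprK -bnormN; move: lf; rewrite y0 sub0r.
Qed.

Lemma exists_between_notin (s : seq R) (a b : R) : a < b -> exists2 t, a < t < b & t \notin s.
Proof.
elim: s a b => [|m s IH] a b ab; first by exists ((a + b) / 2) => //; apply/andP; split; lra.
have [amb|namb] := boolP (a < m < b).
  have /andP[am mb] := amb; have [t /andP[at_ tm] ts] := IH _ _ am.
  exists t; first by rewrite at_ (lt_trans tm).
  by rewrite inE negb_or ts lt_eqF.
have [t tab ts] := IH _ _ ab; exists t => //.
by rewrite inE negb_or ts andbT; apply: contraNneq namb => <-.
Qed.

Definition good (ms : seq R) z := [/\ G z, complex.Im z != 0 & normc z \notin ms].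

Lemma good_dense ms z (d : R) : G z -> 0 < d -> exists2 w, good ms w & normc (w - z) < d.
Proof.
move=> Gz d0; have [r r0 rG] := oG Gz.
pose e := Num.min d r / 2; have e0 : 0 < e by rewrite divr_gt0// lt_min d0.
have [er ed] : e + e <= r /\ e + e <= d.
  by rewrite /e -splitr !ge_min !lexx orbT.
have [h /andP[h0 he] /[!inE] hz] := @exists_between_notin [:: - complex.Im z] _ _ e0.
pose z1 : R[i] := z + 'i * h%:C.
have z1I : complex.Im z1 != 0.
  rewrite /z1 Im_add Im_mul /= mul0r add0r mul1r; apply: contra hz => /eqP E.
  by apply/eqP; lra.
have z1z : normc (z1 - z) < e.
  by rewrite addrC addKr normc_mul normci mul1r normc_real ger0_norm// ltW.
have n0 : 0 < normc z1.
  by rewrite normc_gt0; apply: contraNneq z1I => ->.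
have [t /andP[t1 t2] tms] := @exists_between_notin ms (normc z1) (normc z1 + e) ltac:(lra).
pose w : R[i] := (t / normc z1)%:C * z1.
have t0 : 0 < t by lra.
have wt : normc w = t.
  by rewrite normc_mul normc_real ger0_norm ?divfK ?gt_eqF// divr_ge0// ltW.
have ww : normc (w - z1) < e.
  have -> : w - z1 = ((t - normc z1) / normc z1)%:C * z1.
    rewrite /w mulrBl divff ?gt_eqF// rmorphB/= mulrBl; congr (_ - _).
    by rewrite -[LHS]mul1r.
  rewrite normc_mul normc_real ger0_norm ?divfK ?gt_eqF//; first by lra.
  by rewrite divr_ge0// ltW// subr_gt0.
have wz : normc (w - z) < e + e.
  have := normc_triangle (w - z1) (z1 - z); rewrite addrA subrK; lra.
exists w; last exact: lt_le_trans wz ed.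
split; [exact: rG (lt_le_trans wz er)| |by rewrite wt].
rewrite /w Im_mul /= mul0r addr0 mulf_neq0//.
by rewrite gt_eqF// divr_gt0.
Qed.

Lemma rational_dense z (d : R) : 0 < d ->
  exists a b : rat, normc ((ratr a +i* ratr b) - z) < d.
Proof.
move=> d0.
have [a] : exists a : rat, ratr a \in `]complex.Re z - d / 2, complex.Re z + d / 2[.
  by apply: rat_in_itvoo; lra.
have [b] : exists b : rat, ratr b \in `]complex.Im z - d / 2, complex.Im z + d / 2[.
  by apply: rat_in_itvoo; lra.
rewrite !in_itv/= => /andP[b1 b2] /andP[a1 a2]; exists a, b.
rewrite (le_lt_trans (normc_le_ReIm _))// Re_add Im_add Re_opp Im_opp /=.
have : `|ratr a - complex.Re z| < d / 2 by rewrite ltr_norml; apply/andP; split; lra.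
have : `|ratr b - complex.Im z| < d / 2 by rewrite ltr_norml; apply/andP; split; lra.
lra.
Qed.

Let code := seq ((rat * rat) * (rat * rat)).
Let cpx (q : rat * rat) : R[i] := ratr q.1 +i* ratr q.2.
Let decode (c : code) : bergman G := comb [seq (cpx x.1, cpx x.2) | x <- c].

Lemma rational_comb_dense f (e : R) : 0 < e -> exists c : code, bnorm (f - decode c) < e.
Proof.
move=> e0; have e2 : 0 < e / 2 by rewrite divr_gt0.
have [l [lD lf]] : exists l, {in l, forall x, exists r : rat * rat, x.2 = cpx r} /\
    bnorm (f - comb l) < e / 2.
  apply: (@kernel_span_dense (fun w => exists r : rat * rat, w = cpx r)) => // z Gz d d0.
  by have [a [b h]] := rational_dense z d0; exists (cpx (a, b)) => //; exists (a, b).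
suff [c cl] : exists c : code, bnorm (comb l - decode c) < e / 2.
  exists c; apply: le_lt_trans (bnorm_triangle f (comb l) (decode c)) _.
  by rewrite (splitr e) ltrD.
elim: l lD (e / 2) e2 {lf} => [|x l IH] lD d d0.
  by exists [::]; rewrite /decode /comb !big_nil subrr bnorm0.
have d2 : 0 < d / 2 by rewrite divr_gt0.
have [c cP] := IH (fun y yl => lD y (mem_behead (s := x :: l) yl)) _ d2.
have [q xq] := lD x (mem_head _ _).
have den : 0 < bnorm (K x.2) + 1 by have := bnorm_ge0 (K x.2); lra.
have [a [b abP]] := rational_dense x.1 (divr_gt0 d2 den).
exists (((a, b), q) :: c); rewrite /decode /comb /= !big_cons /= -/(comb l).
rewrite -/(comb _) -/(decode c) -xq opprD addrACA -scalerBl.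
rewrite (le_lt_trans (bnormD _ _))// bnormZ normc_subC.
rewrite ltr_pdivlMr// in abP.
have := bnorm_ge0 (K x.2); have := normc_ge0 (cpx (a, b) - x.1).
move: abP cP; rewrite -/(cpx (a, b)).
rewrite mulrDr mulr1; lra.
Qed.

Hypothesis G1 : forall z, G z -> 1 < normc z.

Definition hist := seq (({poly R} * seq (R[i] * R[i])) * R).

Lemma step (H : hist) (d : bergman G) (delta eta : R) : 0 < delta -> 0 < eta ->
  {in H, forall t, {in t.1.2, forall x, complex.Im x.2 != 0}} ->
  exists p l, [/\ convex_poly p, {in l, forall x, complex.Im x.2 != 0},
    {in H, forall t, poly_op p T (comb t.1.2) = 0},
    bnorm (poly_op p T (comb l) - d) < delta & bnorm (comb l) <= eta].
Proof.
move=> delta0 eta0 HIm.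
pose zs := flatten [seq [seq conjc x.2 | x <- t.1.2] | t <- H].
have zsIm : {in zs, forall w, complex.Im w != 0}.
  move=> _ /flattenP[_ /mapP[t tH ->] /mapP[x xt ->]].
  by have := HIm t tH x xt; case: (x.2) => a b /=; rewrite oppr_eq0.
have [q [cq q0 qn0]] := common_killing_poly zsIm.
have [l [lg ld]] : exists l, {in l, forall x, good [seq normc w | w <- zs] x.2} /\
    bnorm (d - comb l) < delta.
  by apply: kernel_span_dense => // z Gz r r0; exact: good_dense.
pose S := \sum_(x <- l) normc x.1 * bnorm (K x.2).
have S0 : 0 <= S by apply: sumr_ge0 => x _; rewrite mulr_ge0 ?normc_ge0 ?bnorm_ge0.
pose B := S / eta + 1; have B0 : 0 < B by rewrite ltr_wpDl// divr_ge0// ltW.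
have [|n nP] := @exists_pow_ge _ [seq conjc x.2 | x <- l] q B.
  move=> _ /mapP[x xl ->]; have [Gx _ xz] := lg x xl.
  by rewrite normc_conjc; split; [exact: G1|apply: qn0; rewrite normc_conjc].
set p := 'X^n * q in nP; pose v (x : R[i] * R[i]) := ceval p (conjc x.2).
have vB x : x \in l -> B <= normc (v x) by move=> xl; apply: nP; exact: map_f.
have v0 x : x \in l -> v x != 0 by move=> /vB; rewrite -normc_gt0; exact: lt_le_trans.
exists p, [seq (x.1 / v x, x.2) | x <- l]; split.
- by apply: convex_polyM => //; exact: convex_polyXn.
- by move=> _ /mapP[x /lg[] _ xI _ ->].
- move=> t tH; rewrite poly_op_comb big_seq big1// => x xt.
  rewrite cevalM q0 ?mulr0 ?scale0r//.
  by apply/flattenP; exists [seq conjc x.2 | x <- t.1.2]; apply: map_f.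
- rewrite poly_op_comb big_map.
  have -> : \sum_(x <- l) ((x.1 / v x) * ceval p (conjc x.2)) *: K x.2 = comb l.
    by rewrite /comb !big_seq; apply: eq_bigr => x xl; rewrite divfK// v0.
  by rewrite bnorm_subC.
rewrite /comb big_map (le_trans (bnorm_sum _ _))//.
apply: (@le_trans _ _ (S / B)).
  rewrite /S mulr_suml !big_seq ler_sum// => x xl.
  rewrite bnormZ /= normc_mul normcV mulrAC ler_wpM2l ?mulr_ge0 ?normc_ge0 ?bnorm_ge0//.
  by rewrite lef_pV2 ?posrE ?vB// (lt_le_trans B0)// vB.
rewrite ler_pdivrMr// /B mulrDr mulr1 mulrCA divff ?gt_eqF// mulr1.
by rewrite lerDl ltW.
Qed.

Lemma exists_small_norm (H : hist) (s : R) : 0 < s -> {in H, forall t, 0 < t.2} ->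
  exists2 eta : R, 0 < eta <= s & {in H, forall t, forall f, bnorm f <= eta ->
    bnorm (poly_op t.1.1 T f) <= t.2 * s}.
Proof.
move=> s0; elim: H => [|t H IH] H0; first by exists s; rewrite ?s0 ?lexx.
have [|eta /andP[eta0 etas] etaP] := IH.
  by move=> u uH; apply: H0; rewrite inE uH orbT.
have t0 := H0 t (mem_head _ _); have [C C0 CP] := poly_op_bound t.1.1.
have den : 0 < C + 1 by lra.
exists (Num.min eta (t.2 * s / (C + 1))).
  by rewrite lt_min ge_min etas eta0 divr_gt0// mulr_gt0.
move=> u; rewrite inE => /orP[/eqP ->|uH] f; rewrite le_min => /andP[fe fC].
  rewrite (le_trans (CP f))//; rewrite ler_pdivlMr// in fC.
  by have := bnorm_ge0 f; lra.
exact: etaP.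
Qed.

Theorem universal_vector (d : nat -> bergman G) (delta : nat -> R) :
  (forall n, 0 < delta n) ->
  exists x, forall n, exists2 p, convex_poly p & bnorm (poly_op p T x - d n) <= 3 * delta n.
Proof.
move=> delta0; have three (a : R) : a + (a + a) <= 3 * a by lra.
pose inv (H : hist) := {in H, forall t, {in t.1.2, forall x, complex.Im x.2 != 0} /\ 0 < t.2}.
have /choice[F FP] (H : hist) : exists t : ({poly R} * seq (R[i] * R[i])) * R, inv H ->
    [/\ convex_poly t.1.1, {in t.1.2, forall x, complex.Im x.2 != 0}, t.2 = delta (size H) &
      [/\ {in H, forall u, poly_op t.1.1 T (comb u.1.2) = 0},
       bnorm (poly_op t.1.1 T (comb t.1.2) - d (size H)) < delta (size H),
       bnorm (comb t.1.2) <= 2 ^- (size H) &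
       {in H, forall u, bnorm (poly_op u.1.1 T (comb t.1.2)) <= u.2 * 2 ^- (size H)}]].
  have [iH|] := pselect (inv H); last by exists ((0, [::]), 0).
  have s0 : 0 < 2 ^- (size H) :> R by rewrite invr_gt0 exprn_gt0.
  have [|eta /andP[eta0 etas] etaP] := @exists_small_norm H _ s0.
    by move=> u /iH[].
  have [|p [l [cp lI pH pd leta]]] := @step H (d (size H)) _ _ (delta0 (size H)) eta0.
    by move=> u /iH[].
  exists ((p, l), delta (size H)) => _; split => //; split => //.
    exact: le_trans etas.
  by move=> u /etaP; exact.
pose hs := fix hs n : hist := if n is k.+1 then F (hs k) :: hs k else [::].
have sz n : size (hs n) = n by elim: n => //= n ->.
have iv n : inv (hs n).
  elim: n => [|n IH]; first by move=> t; rewrite in_nil.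
  move=> t /=; rewrite inE => /orP[/eqP ->|/IH//].
  by have [_ ? -> _] := FP _ IH; split.
pose t n := F (hs n).
have tin i n : (i < n)%N -> t i \in hs n.
  elim: n => // n IH; rewrite ltnS leq_eqVlt => /orP[/eqP ->|/IH h]; rewrite inE ?eqxx//.
  by rewrite h orbT.
pose p n := (t n).1.1; pose h n := comb (t n).1.2.
have cp n : convex_poly (p n) by have [] := FP _ (iv n).
have tD n : (t n).2 = delta n by have [_ _ + _] := FP _ (iv n); rewrite sz.
have ph i n : (i < n)%N -> poly_op (p n) T (h i) = 0.
  by move=> /tin in_; have [_ _ _ [+ _ _ _]] := FP _ (iv n); exact.
have pd n : bnorm (poly_op (p n) T (h n) - d n) < delta n.
  by have [_ _ _ [_ + _ _]] := FP _ (iv n); rewrite sz.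
have hn n : bnorm (h n) <= 2 ^- n.
  by have [_ _ _ [_ _ + _]] := FP _ (iv n); rewrite sz.
have pih i n : (i < n)%N -> bnorm (poly_op (p i) T (h n)) <= delta i * 2 ^- n.
  move=> /tin in_; have [_ _ _ [_ _ _ +]] := FP _ (iv n); rewrite sz => /(_ _ in_).
  by rewrite tD.
pose s n := \sum_(i < n) h i.
have sS n : s n.+1 = s n + h n by rewrite /s big_ord_recr.
have half n : 2 ^- n.+1 + 2 ^- n.+1 = 2 ^- n :> R.
  rewrite exprS invfM; move: (2 ^- n) => a; lra.
have sC n k : bnorm (s (n + k)%N - s n) <= 2 * 2 ^- n - 2 * 2 ^- (n + k).
  elim: k => [|k IH]; first by rewrite addn0 !subrr bnorm0.
  rewrite addnS sS addrAC (le_trans (bnormD _ _))//.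
  have := hn (n + k)%N; have := half (n + k)%N.
  move: (2 ^- n) (2 ^- (n + k)) (2 ^- (n + k).+1) IH => a b c; lra.
have pow0 n : 0 < 2 ^- n :> R by rewrite invr_gt0 exprn_gt0.
have [e e0|x xP] := bergman_complete oG (u := s).
  have [N NP] := @exists_div_expn2_lt R 8 e ltac:(lra) e0; exists N => m n Nm Nn.
  have sN k : (N <= k)%N -> bnorm (s k - s N) <= 2 * 2 ^- N.
    move=> /subnKC <-; apply: le_trans (sC _ _) _.
    by rewrite gerBl mulr_ge0// ltW.
  apply: le_lt_trans (bnorm_triangle (s m) (s N) (s n)) _.
  rewrite (bnorm_subC (s N)); apply: le_lt_trans (lerD (sN _ Nm) (sN _ Nn)) _.
  by apply: le_lt_trans NP; rewrite -mulrDl ler_wpM2r ?(ltW (pow0 _))//; lra.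
exists x => n; exists (p n) => //.
have tail k : bnorm (poly_op (p n) T (s (n.+1 + k)%N) - poly_op (p n) T (h n)) <=
    delta n * (1 - 2 ^- k).
  elim: k => [|k IH].
    rewrite addn0 sS poly_opD /s poly_op_sum big1 => [|i _]; last exact: ph.
    by rewrite add0r subrr bnorm0 expr0 invr1 subrr mulr0.
  rewrite addnS sS poly_opD addrAC (le_trans (bnormD _ _))//.
  have h1 : bnorm (poly_op (p n) T (h (n.+1 + k)%N)) <= delta n * 2 ^- k.+1.
    have := pih n (n.+1 + k)%N (leq_addr _ _) => /le_trans; apply.
    rewrite ler_wpM2l ?(ltW (delta0 n))// lef_pV2 ?posrE ?exprn_gt0//.
    by rewrite ler_eXn2l ?ltr1n// addSn -addnS leq_addl.
  have := half k; move: (2 ^- k) (2 ^- k.+1) IH h1 => a b IH h1 ab; rewrite -ab in IH.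
  rewrite mulrBr mulrDr in IH; rewrite mulrBr; lra.
have [C C0 CP] := poly_op_bound (p n).
have den : 0 < C + 1 by lra.
have [N NP] := xP _ (divr_gt0 (delta0 n) den).
have {NP} := NP (n.+1 + N)%N (leq_addl _ _); have := tail N; set m := (n.+1 + N)%N.
move=> h1 h2; rewrite bnorm_subC ler_pdivlMr// in h2.
have h3 : bnorm (poly_op (p n) T x - poly_op (p n) T (s m)) <= delta n.
  rewrite -poly_opB (le_trans (CP _))//; have := bnorm_ge0 (x - s m); lra.
have h4 : delta n * (1 - 2 ^- N) <= delta n.
  by rewrite ger_pMr// gerBl ltW.
apply: le_trans (bnorm_triangle _ (poly_op (p n) T (s m)) _) _.
apply: le_trans (lerD h3 (bnorm_triangle _ (poly_op (p n) T (h n)) _)) _.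
apply: le_trans (lerD (lexx _) (lerD (le_trans h1 h4) (ltW (pd n)))) _.
exact: three.
Qed.

Theorem convex_cyclic_adjoint_mulz : convex_cyclic T.
Proof.
have arith (r a : R) : a < r / 6 -> r / 2 + 3 * a <= r by lra.
pose d n : bergman G := if @unpickle (nat * code)%type n is Some (_, c) then decode c else 0.
pose delta n : R := if @unpickle (nat * code)%type n is Some (k, _) then k.+1%:R^-1 else 1.
have [n|x xP] := @universal_vector d delta.
  by rewrite /delta; case: unpickle => [[k c]|]; rewrite ?invr_gt0.
exists x => O [f Of] oO.
have : nbhs f O by apply: open_nbhs_nbhs; split.
move=> /nbhs_ballP[/= e]; rewrite ltcE/= => /andP[/eqP e'0 e0] eO.
set r := complex.Re e in e0; have r2 : 0 < r / 2 by rewrite divr_gt0.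
have [c cP] := rational_comb_dense f r2.
have r6 : 0 < r / 6 by rewrite divr_gt0.
have [k /(_ _ (leqnn k)) kP] := exists_inv_succ_lt r6.
have [p cp pP] := xP (pickle (k, c)).
rewrite /d /delta pickleK in pP.
exists (poly_op p T x); split; last exact: poly_op_convex_hull.
apply: eO; rewrite -ball_normE /ball_/= bnormE ltcE/= e'0 eqxx/= -/r.
apply: le_lt_trans (bnorm_triangle f (decode c) (poly_op p T x)) _.
rewrite (bnorm_subC (decode c)); apply: lt_le_trans (ltr_leD cP pP) _.
exact: arith.
Qed.

End ConvexCyclic.

(** * Absence of hypercyclicity *)

Section NotHypercyclic.
Context {R : realType} {G : set R[i]}.
Hypothesis oG : copen G.
Hypothesis bG : exists M : R, forall z, G z -> normc z <= M.
Local Notation T := (adjoint (@mulz R G)).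
Implicit Types (f g x u v : bergman G) (z w : R[i]) (p q : {poly R}).

Lemma derivable_ceval p w : derivable (ceval p : R[i]^o -> R[i]^o) w 1.
Proof.
elim/poly_ind: p => [|p c IH].
  rewrite (_ : ceval 0 = fun=> 0 :> R[i]^o); first exact: derivable_cstc.
  by apply/funext => z; rewrite /ceval rmorph0 horner0.
rewrite (_ : ceval _ = fun z => ceval p z * z - (- c%:C) : R[i]^o).
  exact: (derivable_subc (derivable_mulc IH (@derivable_id _ _ _ _)) (@derivable_cstc _ _ _)).
apply/funext => z; rewrite /ceval rmorphD rmorphM/= map_polyX map_polyC.
by rewrite hornerD hornerM hornerX hornerC opprK.
Qed.


Lemma iter_mulzE k u z : iter k (@mulz R G) u z = z ^+ k * u z.
Proof.
by elim: k => [|k IH]; rewrite ?expr0 ?mul1r// iterS mulzEz// IH exprS mulrA.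
Qed.

Lemma dot_iter_adjoint k u x : bergman_dot u (iter k T x) = bergman_dot (iter k (@mulz R G) u) x.
Proof. by elim: k u => [|k IH] u //; rewrite iterS -adjoint_mulzP// IH -iterSr. Qed.

Lemma bergman_sumE (I : Type) (r : seq I) (F : I -> bergman G) z :
  (\sum_(i <- r) F i) z = \sum_(i <- r) F i z.
Proof. by elim: r => [|i r IH]; rewrite ?big_nil// !big_cons bergman_addE IH. Qed.

Lemma dot_poly_op p u v x : (forall z, v z = ceval p z * u z) ->
  bergman_dot u (poly_op p T x) = bergman_dot v x.
Proof.
move=> vE; rewrite /poly_op dot_sumr.
have -> : v = \sum_(k < size p) (p`_k)%:C *: iter k (@mulz R G) u.
  apply: bergman_ext => z; rewrite vE bergman_sumE cevalE mulr_suml.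
  by apply: eq_bigr => k _; rewrite bergman_scaleE iter_mulzE mulrA.
rewrite dot_suml; apply: eq_bigr => k _.
by rewrite dotZr dotZl conj_real dot_iter_adjoint.
Qed.

Variable U : set R[i].
Hypothesis UG : U `<=` G.
Hypothesis oU : copen U.
Hypothesis oGU : copen (G `\` U).

Let cut (q : R[i] -> R[i]) z : R[i] := if z \in U then q z else 0.

Let cut_derivable (q : R[i] -> R[i]) z :
  (forall w, U w -> derivable (q : R[i]^o -> R[i]^o) w 1) -> G z ->
  derivable (cut q : R[i]^o -> R[i]^o) z 1.
Proof.
move=> dq Gz; have [Uz|nUz] := pselect (U z).
  have [d d0 dU] := oU Uz; apply: (@derivable_eq_near _ q _ _ d) => //; last exact: dq.
  by move=> w /dU Uw; rewrite /cut mem_set.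
have [d d0 dU] := oGU (conj Gz nUz).
apply: (@derivable_eq_near _ (fun=> 0) _ _ d) => //.
by move=> w /dU[_ nUw]; rewrite /cut memNset.
Qed.

Let cut_bound (q : R[i] -> R[i]) (B : R) z : 0 <= B ->
  (forall w, U w -> normc (q w) <= B) -> normc (cut q z) <= B.
Proof.
by move=> B0 qB; rewrite /cut; case: ifPn => [/set_mem/qB//|_]; rewrite normc0.
Qed.

Lemma exists_indicator : exists e : bergman G, forall z, e z = if z \in U then 1 else 0.
Proof.
have [M MP] := bG; pose e z : R[i]^o := cut (fun=> 1) z.
have e0 z : ~ G z -> e z = 0.
  by move=> nGz; rewrite /e /cut memNset// => /UG.
have Ge : analytic_on G e.
  by move=> z Gz; apply: cut_derivable => // w _; exact: derivable_cstc.
pose I : set (measurableTypeR R) := `[- M, M]%classic.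
have mI : measurable I by exact: measurable_itv.
have mII : measurable (I `*` I) by exact: measurableX.
have area_fin : (area (I `*` I) < +oo)%E.
  have E : area (I `*` I) = (@lebesgue_measure R I * @lebesgue_measure R I)%E.
    exact: product_measure1E.
  rewrite E /I lebesgue_measure_itv/=.
  by case: ifP => _; rewrite ?mule0// -EFinB -EFinM ltry.
have Be : bergman_fun G e.
  split=> //; apply: le_lt_trans area_fin; rewrite int_sqrE//.
  have <- : (\int[area]_p (\1_(I `*` I) p)%:E)%E = area (I `*` I).
    by rewrite integral_indic// setIT.
  apply: ge0_le_integral => //.
  - by move=> p _; rewrite lee_fin sqr_ge0.
  - apply/measurable_EFinP; apply: measurable_funX; exact: measurable_modulus Ge e0.
  - by apply/measurable_EFinP; exact: measurable_indic.
  move=> p _; rewrite lee_fin /modulus /e /cut indicE.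
  have [/set_mem /UG /MP h|_] := boolP (Defs.cpoint p \in U); last first.
    by rewrite normc0 expr0n ler0n.
  rewrite mem_set ?normc1 ?expr1n//.
  have h1 := le_trans (normr_Re_le _) h; have h2 := le_trans (normr_Im_le _) h.
  by move: h1 h2; rewrite !ler_norml; split; rewrite /I/= in_itv/=.
by exists (mkbergman Be).
Qed.

Lemma dot_supported u x (y : bergman G) : (forall z, ~ U z -> u z = 0) ->
  (forall z, U z -> x z = y z) ->
  bergman_dot u x = bergman_dot u y.
Proof.
move=> u0 xy.
have E z : u z * (x z)^* = u z * (y z)^*.
  have [Uz|nUz] := pselect (U z); first by rewrite xy.
  by rewrite u0// !mul0r.
by rewrite /bergman_dot; congr (_ +i* _); apply: eq_Rintegral => p _; rewrite E.
Qed.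

Theorem not_hypercyclic_poly_op p : U !=set0 ->
  (forall z, U z -> 1 <= normc (ceval p z)) -> ~ hypercyclic (poly_op p T).
Proof.
move=> [z0 Uz0] p1 [x xD]; set S := poly_op p T.
have orbit_near (f : bergman G) (r : R) : 0 < r -> exists k, bnorm (f - iter k S x) < r.
  move=> r0; have r0C : 0 < r%:C :> R[i] by rewrite ltcR.
  have [|y [fO [k _ kE]]] := xD (ball f r%:C) _ (ball_open f r%:C).
    by exists f; exact: ballxx.
  by exists k; move: fO; rewrite -ball_normE /ball_/= bnormE ltcR kE.
have pn0 z : U z -> ceval p z != 0 by move=> /p1; rewrite -normc_gt0; exact: lt_le_trans.
pose q k z : R[i] := ((ceval p z)^-1) ^+ k.
have dq k w : U w -> derivable (q k : R[i]^o -> R[i]^o) w 1.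
  move=> Uw; elim: k => [|k IH]; first exact: derivable_cstc.
  rewrite (_ : q k.+1 = fun z => (ceval p z)^-1 * q k z); last first.
    by apply/funext => z; rewrite /q exprS.
  have dinv : derivable (fun z : R[i]^o => (ceval p z)^-1 : R[i]^o) w 1.
    by apply: (@derivableV _ _ (ceval p : R[i]^o -> R[i]^o)); [exact: pn0|exact: derivable_ceval].
  exact: (derivable_mulc dinv IH).
have qB k w : U w -> normc (q k w) <= 1.
  move=> Uw; rewrite /q normc_exp normcV exprn_ile1 ?invr_ge0 ?normc_ge0//.
  by rewrite invf_le1 ?p1// normc_gt0 pn0.
have mulc k g : exists2 h : bergman G, (forall z, h z = cut (q k) z * g z) & bnorm h <= bnorm g.
  have [|z Gz|h hE hB] := @bergman_mul R G (cut (q k)) 1 g ler01.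
  - by move=> z Gz; apply: cut_derivable => // w; exact: dq.
  - exact: (cut_bound z ler01 (qB k)).
  by exists h => //; rewrite mul1r in hB.
have [y yE _] := mulc 0%N x.
have yU z : U z -> y z = x z by move=> Uz; rewrite yE /cut mem_set// /q expr0 mul1r.
have ynU z : ~ U z -> y z = 0 by move=> nUz; rewrite yE /cut memNset// mul0r.
have [y0|yn0] := eqVneq y 0.
  have [e eE] := exists_indicator.
  have eU z : U z -> e z = 1 by move=> Uz; rewrite eE mem_set.
  have enU z : ~ U z -> e z = 0 by move=> nUz; rewrite eE memNset.
  have orth k (u : bergman G) : (forall z, ~ U z -> u z = 0) -> bergman_dot u (iter k S x) = 0.
    elim: k u => [|k IH] u u0.
      rewrite (@dot_supported u x y)//; first by rewrite y0 dot0r.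
      by move=> z /yU.
    have [C CP] : exists C : R, forall z, G z -> normc (ceval p z) <= C.
      have [M MP] := bG; exists (\sum_(k < size p) `|p`_k| * `|M| ^+ k) => z Gz.
      rewrite cevalE.
      have nsum (I : Type) (r : seq I) (F : I -> R[i]) :
          normc (\sum_(i <- r) F i) <= \sum_(i <- r) normc (F i).
        elim: r => [|i r IHr]; first by rewrite !big_nil normc0.
        by rewrite !big_cons (le_trans (normc_triangle _ _))// lerD2l.
      rewrite (le_trans (nsum _ _ _))// ler_sum// => i _.
      rewrite normc_mul normc_real normc_exp ler_wpM2l// lerXn2r ?nnegrE ?normc_ge0//.
      by rewrite (le_trans (MP _ Gz))// ler_norm.
    have [|z Gz|v vE _] := @bergman_mul R G (ceval p) `|C| u (normr_ge0 C).
    - by move=> z _; exact: derivable_ceval.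
    - by rewrite (le_trans (CP _ Gz))// ler_norm.
    rewrite iterS (dot_poly_op _ vE) IH// => z nUz.
    by rewrite vE u0// mulr0.
  have en0 : e != 0.
    apply/eqP => e0; have := eU _ Uz0; rewrite e0 bergman_zeroE => /eqP.
    by rewrite eq_sym oner_eq0.
  have n0 := bnorm_gt0 en0; have [k kP] := orbit_near e _ n0.
  have : bnorm e ^+ 2 <= bnorm e * bnorm (e - iter k S x).
    apply: le_trans (cauchy_schwarz _ _).
    by rewrite dotBr orth// subr0 dotff normc_real ger0_norm// sqr_ge0.
  by rewrite expr2 ler_pM2l// leNgt kP.
have n0 := bnorm_gt0 yn0; have [k] := orbit_near 0 _ n0; rewrite sub0r bnormN.
rewrite ltNge => /negP; apply.
have [w wE wB] : exists2 w : bergman G, (forall z, w z = cut (q k) z * y z) & bnorm w <= bnorm y.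
  exact: mulc.
have E j (v : bergman G) : (forall z, v z = cut (q j) z * y z) ->
    bergman_dot v (iter j S x) = bergman_dot y y.
  elim: j v => [|j IH] v vE.
    have -> : v = y.
      apply: bergman_ext => z; rewrite vE; have [Uz|nUz] := pselect (U z).
        by rewrite /cut mem_set// /q expr0 mul1r.
      by rewrite ynU// mulr0.
    by apply: dot_supported => // z /yU.
  have [v' v'E _] := mulc j y.
  rewrite iterS (@dot_poly_op p v v') ?IH// => z; rewrite v'E vE.
  have [Uz|nUz] := pselect (U z); last by rewrite ynU// !mulr0.
  by rewrite /cut mem_set// /q exprS !mulrA mulfV ?mul1r// pn0.
have := cauchy_schwarz w (iter k S x); rewrite E// dotff normc_real ger0_norm ?sqr_ge0// => h.
by rewrite -(ler_pM2l n0) -expr2 (le_trans h)// ler_wpM2r// bnorm_ge0.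
Qed.

End NotHypercyclic.

(** * The sectors *)

Section Sectors.
Context {R : realType}.
Variables alpha beta : nat -> R.
Hypothesis alpha_gt0 : forall n, 0 < alpha n.
Hypothesis alpha_decr : forall n, alpha n.+1 < alpha n.
Hypothesis interlaced : forall n, alpha n.+1 < beta n.+1 < alpha n.
Implicit Types (r t : R) (z w : R[i]).

Definition polar r t : R[i] := (r * cos t) +i* (r * sin t).

Lemma normc_polar r t : 0 <= r -> normc (polar r t) = r.
Proof.
move=> r0; apply/eqP; rewrite -(@eqrXn2 _ 2)// ?normc_ge0// sqr_normc /=.
by rewrite !exprMn -mulrDr cos2Dsin2 mulr1.
Qed.

Lemma polar_mul r s t u : polar r t * polar s u = polar (r * s) (t + u).
Proof. by apply: eq_complexP; rewrite /polar /= ?cosD ?sinD; ring. Qed.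

Lemma polar_exp r t n : polar r t ^+ n = polar (r ^+ n) (n%:R * t).
Proof.
elim: n => [|n IH].
  by rewrite !expr0 mul0r /polar cos0 sin0 mulr1 mulr0.
by rewrite exprS IH polar_mul -exprS -natr1 mulrDl mul1r addrC.
Qed.

Lemma normc_sector n z : sector alpha beta n z -> 2 < normc z < 3.
Proof.
move=> [r [t [/andP[r2 rn] _ _ ->]]]; rewrite -/(polar r t) normc_polar; last by lra.
rewrite r2/= (lt_le_trans rn)//.
have : (n.+1%:R)^-1 <= 1 :> R by rewrite invf_le1 ?ler1n.
by move: (n.+1%:R^-1) => a; lra.
Qed.

Lemma atan_small (e : R) : 0 < e -> exists2 d : R, 0 < d & forall t, `|t| < d -> `|atan t| < e.
Proof.
move=> e0; have /cvgrPdist_lt/(_ e e0) := @continuous_atan R 0.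
move=> /nbhs_ballP[d /= d0 dP]; exists d => // t td.
by have := dP t; rewrite /ball/= sub0r normrN => /(_ td); rewrite atan0 sub0r normrN.
Qed.

Lemma polar_atan (a b : R) : 0 < a ->
  a +i* b = polar (normc (a +i* b)) (atan (b / a)).
Proof.
move=> a0; set t := b / a; set r := normc _.
have rE : r = a * Num.sqrt (1 + t ^+ 2).
  rewrite /r /=.
  have -> : a ^+ 2 + b ^+ 2 = a ^+ 2 * (1 + t ^+ 2).
    by rewrite mulrDr mulr1 /t expr_div_n mulrCA divff ?mulr1// expf_neq0// gt_eqF.
  by rewrite sqrtrM ?sqr_ge0// sqrtr_sqr ger0_norm// ltW.
have s0 : 0 < Num.sqrt (1 + t ^+ 2) by rewrite sqrtr_gt0 ltr_pwDl// sqr_ge0.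
have c0 : cos (atan t) != 0 by rewrite cos_atan invr_eq0 gt_eqF.
have cE : r * cos (atan t) = a.
  by rewrite rE cos_atan mulfK// gt_eqF.
have sE : sin (atan t) = t * cos (atan t).
  by rewrite -[LHS](divfK c0) -/(tan _) atanK.
rewrite /polar cE sE mulrCA cE; congr (_ +i* _).
by rewrite /t divfK// gt_eqF.
Qed.

Lemma copen_sector n : copen (sector alpha beta n).
Proof.
move=> z [r [t [/andP[r2 rn] /andP[ta tb] /andP[t0 t2pi] zE]]].
have shift (phi e a b : R) : e <= t - a -> e <= b - t -> - e < phi -> phi < e ->
    a < phi + t < b.
  by move=> *; apply/andP; split; lra.
have radius (s q m : R) : m <= r - 2 -> m <= 2 + q - r -> `|s - r| < m -> 2 < s < 2 + q.
  by move=> ? ?; rewrite ltr_norml => /andP[? ?]; apply/andP; split; lra.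
have tpos : 0 < t by rewrite (lt_trans _ ta).
pose e := Num.min (Num.min (t - alpha n) (beta n - t)) (Num.min t (2 * pi - t)).
have e0 : 0 < e by rewrite !lt_min !subr_gt0 ta tb tpos t2pi.
have [d d0 dP] := atan_small e0.
pose m := Num.min (Num.min 1 d) (Num.min (r - 2) (2 + n.+1%:R^-1 - r)).
have m0 : 0 < m by rewrite !lt_min ltr01 d0 !subr_gt0 r2 rn.
have /and4P[m1 md mr mn] : [&& m <= 1, m <= d, m <= r - 2 & m <= 2 + n.+1%:R^-1 - r].
  by rewrite !ge_min !lexx !orbT.
exists m => // w wz; pose u := w * polar 1 (- t).
have zr : z * polar 1 (- t) = r%:C.
  rewrite zE -/(polar r t) polar_mul mulr1 subrr /polar cos0 sin0 mulr1 mulr0.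
  by [].
have wE : w = u * polar 1 t.
  by rewrite /u -mulrA polar_mul mulr1 addNr /polar cos0 sin0 mul1r mulr0 mulr1.
have ur : normc (u - r%:C) = normc (w - z).
  by rewrite -zr -mulrBl normc_mul normc_polar ?mulr1.
have nu : normc u = normc w by rewrite normc_mul normc_polar ?mulr1.
have nz : normc z = r by rewrite zE -/(polar r t) normc_polar//; lra.
have hRe := normr_Re_le (u - r%:C); have hIm := normr_Im_le (u - r%:C).
rewrite ur Re_add Re_opp /= in hRe; rewrite ur Im_add Im_opp /= subr0 in hIm.
have a1 : 1 < complex.Re u.
  by move: hRe; rewrite ler_norml => /andP[? ?]; lra.
have a0 : 0 < complex.Re u by lra.
have small : `|complex.Im u / complex.Re u| < d.
  rewrite normrM normfV (gtr0_norm a0) ltr_pdivrMr//.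
  have : d <= d * complex.Re u by rewrite ler_peMr ?ltW//.
  lra.
have /and4P[e1 e2 e3 e4] : [&& e <= t - alpha n, e <= beta n - t, e <= t & e <= 2 * pi - t].
  by rewrite !ge_min !lexx !orbT.
have := dP _ small; set phi := atan _; rewrite ltr_norml => /andP[p1 p2].
exists (normc w), (phi + t); split.
- by apply: radius mr mn _; rewrite -nz (le_lt_trans (normc_dist _ _)).
- exact: shift e1 e2 p1 p2.
- have /andP[/ltW -> ->//] : 0 < phi + t < 2 * pi by apply: shift e4 p1 p2; rewrite subr0.
rewrite -/(polar (normc w) (phi + t)) {1}wE.
have -> : u = polar (normc u) phi.
  by rewrite {1 2}(_ : u = complex.Re u +i* complex.Im u); [exact: polar_atan|case: (u)].
by rewrite polar_mul mulr1 nu.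
Qed.

Lemma polar_inj r s t u : 0 < r -> 0 < s -> 0 <= t < 2 * pi -> 0 <= u < 2 * pi ->
  polar r t = polar s u -> t = u.
Proof.
move=> r0 s0 /andP[t0 t1] /andP[u0 u1] E.
have rs : r = s by rewrite -(normc_polar t (ltW r0)) E normc_polar// ltW.
move: E; rewrite rs => -[/(mulfI (lt0r_neq0 s0)) ce /(mulfI (lt0r_neq0 s0)) se].
have c1 : cos (t - u) = 1 by rewrite cosB ce se -!expr2 cos2Dsin2.
have sh : sin ((t - u) / 2) = 0.
  have := cos_mulr2n ((t - u) / 2); have -> : (t - u) / 2 *+ 2 = t - u by rewrite mulr2n -splitr.
  rewrite c1; have := cos2Dsin2 ((t - u) / 2); rewrite mulr2n.
  move=> h1 h2; apply/eqP; rewrite -sqrf_eq0; apply/eqP; lra.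
have [tu|ut|//] := ltgtP t u.
  have : 0 < sin ((u - t) / 2) by apply: sin_gt0_pi; apply/andP; split; lra.
  by rewrite -opprB mulNr sinN sh oppr0 ltxx.
have : 0 < sin ((t - u) / 2) by apply: sin_gt0_pi; apply/andP; split; lra.
by rewrite sh ltxx.
Qed.

Lemma sector_disjoint m n z : sector alpha beta m z -> sector alpha beta n z -> m = n.
Proof.
have al i j : (i <= j)%N -> alpha j <= alpha i.
  have /nonincreasing_seqP : forall k, alpha k.+1 <= alpha k by move=> k; exact: ltW.
  exact.
have lt i j : (i < j)%N -> beta j < alpha i.
  case: j => // j; rewrite ltnS => /al h; have /andP[_ k] := interlaced j.
  exact: lt_le_trans h.
move=> [r [t [/andP[r2 _] /andP[ta tb] tp zE]]] [s [u [/andP[s2 _] /andP[ua ub] up]]].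
rewrite zE => E; have tu : t = u.
  by apply: (@polar_inj r s t u) => //; lra.
rewrite -tu in ua ub.
by case: (ltngtP m n) => // /lt h; exfalso; lra.
Qed.

Lemma copen_bigcup (F : nat -> set R[i]) (P : set nat) : (forall n, copen (F n)) ->
  copen (\bigcup_(n in P) F n).
Proof.
move=> oF z [n Pn Fz]; have [d d0 dP] := oF n z Fz.
by exists d => // w /dP Fw; exists n.
Qed.

Lemma sectors_setD n : \bigcup_k sector alpha beta k `\` sector alpha beta n =
  \bigcup_(k in [set k | k != n]) sector alpha beta k.
Proof.
apply/seteqP; split=> z; last first.
  move=> [k /= kn kz]; split; first by exists k.
  by move=> nz; move: kn; rewrite (sector_disjoint kz nz) eqxx.
move=> [[k _ kz] nz]; exists k => //=; apply/eqP => kn; apply: nz.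
by rewrite -kn.
Qed.

Lemma cos_ge_half : exists2 d : R, 0 < d & forall t, `|t| < d -> 2^-1 <= cos t.
Proof.
have h0 : 0 < 2^-1 :> R by rewrite invr_gt0.
have /cvgrPdist_lt/(_ _ h0) := @continuous_cos R 0.
move=> /nbhs_ballP[d /= d0 dP]; exists d => // t td.
have := dP t; rewrite /ball/= sub0r normrN => /(_ td); rewrite cos0 ltr_norml => /andP[_ h].
lra.
Qed.

Hypothesis alpha_cvg0 : alpha @ \oo --> 0.

(* [Re z^k >= 1] on a sector close to [2], for all [k] up to the degree of [p]. *)
Lemma exists_sector_normc_ge1 (p : {poly R}) : convex_poly p -> exists n,
  sector alpha beta n !=set0 /\ forall z, sector alpha beta n z -> 1 <= normc (ceval p z).
Proof.
move=> [p0 p1]; have [d d0 dP] := cos_ge_half.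
pose N : R := (size p)%:R + 1; have N0 : 0 < N by rewrite /N ltr_wpDl.
pose e := Num.min pi (d / N); have e0 : 0 < e by rewrite lt_min pi_gt0 divr_gt0.
have [n an] : exists n, alpha n < e.
  have /cvgrPdist_lt/(_ e e0)[n _ /(_ n (leqnn n))] := alpha_cvg0.
  by rewrite /= sub0r normrN gtr0_norm// => h; exists n.
have /andP[ab ba] := interlaced n; exists n.+1; split.
  pose r : R := 2 + n.+2%:R^-1 / 2; pose t : R := (alpha n.+1 + beta n.+1) / 2.
  have q0 : 0 < n.+2%:R^-1 :> R by rewrite invr_gt0.
  exists (polar r t); exists r, t; split => //.
  - by rewrite /r; move: (n.+2%:R^-1) q0 => q q0; apply/andP; split; lra.
  - by rewrite /t; apply/andP; split; lra.
  - have := alpha_gt0 n.+1; have := @pi_gt0 R; move: an; rewrite lt_min => /andP[h1 h2].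
    by rewrite /t => ? ?; apply/andP; split; lra.
move=> _ [r [t [/andP[r2 _] /andP[ta tb] _ ->]]]; rewrite -/(polar r t).
have t0 : 0 < t by rewrite (lt_trans _ ta).
have te : t < d / N.
  by move: an; rewrite lt_min => /andP[_ h]; lra.
apply: (@le_trans _ _ (complex.Re (ceval p (polar r t)))); last first.
  by rewrite (le_trans (ler_norm _))// normr_Re_le.
rewrite cevalE.
have Resum (I : Type) (s : seq I) (F : I -> R[i]) :
    complex.Re (\sum_(i <- s) F i) = \sum_(i <- s) complex.Re (F i).
  by elim: s => [|i s IH]; rewrite ?big_nil// !big_cons Re_add IH.
rewrite Resum -p1 ler_sum// => k _.
rewrite Re_mul /= mul0r subr0 polar_exp /= ler_peMr//.
have [->|k0] := eqVneq (k : nat) 0%N; first by rewrite expr0 mul0r cos0 mulr1.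
have ck : 2^-1 <= cos (k%:R * t).
  apply: dP; rewrite ger0_norm ?mulr_ge0 ?(ltW t0)//.
  move: te; rewrite ltr_pdivlMr// => te; apply: le_lt_trans te.
  rewrite mulrC ler_wpM2l ?(ltW t0)// /N.
  by apply: le_trans (_ : (size p)%:R <= _); rewrite ?ler_nat ?lerDl//; exact: ltnW.
have rk : 2 <= r ^+ k.
  apply: le_trans (ltW r2) _; rewrite -[leLHS]expr1 ler_weXn2l ?lt0n//; lra.
apply: (@le_trans _ _ (2 * 2^-1)); first by rewrite divff.
by apply: ler_pM => //; rewrite invr_ge0.
Qed.

End Sectors.

Theorem mainTheorem9 (R : realType) (alpha beta : R^nat)
  (alpha_gt0 : forall n, 0 < alpha n)
  (beta_gt0 : forall n, 0 < beta n)
  (alpha_decr : forall n, alpha n.+1 < alpha n)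
  (beta_decr : forall n, beta n.+1 < beta n)
  (interlaced : forall n, alpha n.+1 < beta n.+1 < alpha n)
  (alpha_cvg0 : alpha @ \oo --> 0) :
  purely_convex_cyclic (adjoint (@mulz R (\bigcup_n sector alpha beta n))).
Proof.
set G := \bigcup_n _.
have os n : copen (sector alpha beta n) by exact: copen_sector.
have oG : copen G by exact: copen_bigcup.
have nG z : G z -> 2 < normc z < 3 by move=> [n _]; exact: normc_sector.
have bG : exists M : R, forall z, G z -> normc z <= M.
  by exists 3 => z /nG/andP[_ /ltW].
split.
  have [K KP] := exists_kernel oG.
  apply: (convex_cyclic_adjoint_mulz oG bG KP) => z /nG/andP[h _].
  by apply: lt_trans h; lra.
move=> p cp; have [n [n0 np]] := exists_sector_normc_ge1 alpha_gt0 interlaced alpha_cvg0 cp.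
apply: (@not_hypercyclic_poly_op _ _ oG bG (sector alpha beta n)) => //.
- by move=> z nz; exists n.
- by rewrite /G sectors_setD//; exact: copen_bigcup.
Qed.
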